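(* Let $(\vartheta_0,D)$ be one of the pairs $(0.924,6)$, $(0.739,8)$, $(0.643,12)$, $(0.584,16)$, $(0.544,20)$, $(0.516,26)$, and suppose some $\vartheta>\vartheta_0$ satisfies both conditions (A) and (B) below. Then there exist absolute constants $C$, $c>0$, an odd integer $b\le C$ and an even integer $d$ with $0<|d|\le D$ such that $P^-(p+d)>p^c$ and $\Omega(p+d)=b$ for infinitely many primes $p$.
   Context: $P^-(n)$ is the smallest prime factor of $n$; $\Omega(n)$ is the number of prime factors of $n$ counted with multiplicity and $\lambda(n)=(-1)^{\Omega(n)}$. Condition (A): for every $\varepsilon>0$, $A>0$, $\sum_{q\le N^{\vartheta-\varepsilon}}\max_{a:(a,q)=1}\bigl|\sum_{p\le N,\,p\equiv a\ (\mathrm{mod}\ q)}\log p-\frac{N}{\varphi(q)}\bigr|\ll_{\varepsilon,A}\frac{N}{(\log N)^A}$ ($p$ over primes). Condition (B): for every $\varepsilon>0$, $A>0$, $\sum_{q\le N^{\vartheta-\varepsilon}}\max_{y\le N}\max_a\bigl|\sum_{n\le y,\,n\equiv a\ (\mathrm{mod}\ q)}\lambda(n)\bigr|\ll_{\varepsilon,A}\frac{N}{(\log N)^A}$. *)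

(* Defs.v *)
From Stdlib Require Import Reals.
From mathcomp Require Import all_boot all_order all_algebra.
From mathcomp Require Import Rstruct.

Set Implicit Arguments.
Unset Strict Implicit.
Unset Printing Implicit Defensive.

Definition bigOmega (n : nat) : nat := \sum_(p <- primes n) logn p n.

Definition liouville (n : nat) : R := pow (Ropp (INR 1)) (bigOmega n).

Definition least_prime_factor (n : nat) : nat := pdiv n.

Open Scope R_scope.

Definition Rleb (x y : R) : bool := if Rle_dec x y then true else false.

Definition prime_AP_error (N q a : nat) : R :=
  (\sum_(p < N.+1 | prime p && (p %% q == a %% q)%N) ln (INR p))%R
  - INR N / INR (totient q).

Definition liouville_AP_sum (y q a : nat) : R :=
  (\sum_(1 <= n < y.+1 | (n %% q == a %% q)%N) liouville n)%R.

Definition condA (theta : R) : Prop :=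
  forall eps A : R, 0 < eps -> 0 < A ->
  exists K : R, forall N : nat, (2 <= N)%N ->
    (\sum_(1 <= q < N.+1 | Rleb (INR q) (Rpower (INR N) (theta - eps)))
        \big[Rmax/0]_(a < q | coprime a q) Rabs (prime_AP_error N q a))%R
    <= K * (INR N / Rpower (ln (INR N)) A).

Definition condB (theta : R) : Prop :=
  forall eps A : R, 0 < eps -> 0 < A ->
  exists K : R, forall N : nat, (2 <= N)%N ->
    (\sum_(1 <= q < N.+1 | Rleb (INR q) (Rpower (INR N) (theta - eps)))
        \big[Rmax/0]_(y < N.+1) \big[Rmax/0]_(a < q)
           Rabs (liouville_AP_sum y q a))%R
    <= K * (INR N / Rpower (ln (INR N)) A).

Close Scope R_scope.

(* Main.v *)
(* Fix an admissible tuple [hs] of [k] odd shifts and rho with theta0 < rho < min(theta, 1), and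
   give each [m] in (N, 2N] a Selberg weight w(m): the square of a sum, of level N^(rho/2), over the
   squarefree divisors of the product of the m + h.  Condition (A) evaluates the w-average of the
   number X of prime shifts; condition (B) shows that the Liouville function of a shift has
   w-average o(1), so on average half of the shifts, Y = k/2, have Liouville value -1.  If no m had
   a prime shift and another shift with value -1, then (k - 1) X + Y <= k pointwise, because a prime
   itself has value -1.  Averaging contradicts this as soon as (k - 1) X > k/2 on average, which is
   the numerical inequality that fixes theta0.  The m for which a prime below N^c divides some
   m + h carry only a proportion O(c) of the weight, since the weights restricted to multiples of p
   are differences of neighbouring values of the diagonal variables.  Hence some m has m + h prime,
   m + h' of Liouville value -1, and no prime factor of m + h' below N^c: the number of prime
   factors of m + h' is then odd and bounded, and a pigeonhole over that number and over (h, h')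
   gives infinitely many p = m + h with the same b and d = h' - h.

   No integral occurs: the diagonal variables are a step function of the logarithm with n equal
   steps, and sums over squarefree integers are compared with powers of the logarithm starting from
   harmonic sums over the integers coprime to a primorial.  The final condition is therefore an
   inequality between explicit integers. *)
Require Import Defs.
From Stdlib Require Import Reals.
From mathcomp Require Import all_boot all_order all_algebra.
From mathcomp Require Import Rstruct.
From mathcomp Require Import ring lra zify.
Import Order.TTheory GRing.Theory Num.Theory.
Set Implicit Arguments.
Unset Strict Implicit.
Unset Printing Implicit Defensive.
Bind Scope ring_scope with R.
Local Open Scope ring_scope.

(** * Sums over squarefree products, encoded as finite sets of primes *)

Section SubsetSums.
Variables (R : realFieldType) (T : finType).
Implicit Types (a b s : T -> R) (P Q A B : {set T}) (phi psi : R -> R).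

Lemma finset_ind (Pr : {set T} -> Prop) :
  Pr set0 -> (forall x A, x \notin A -> Pr A -> Pr (x |: A)) -> forall A, Pr A.
Proof.
move=> P0 PS A; elim: {A}_.+1 {-2}A (ltnSn #|A|) => // n IH A hA.
have [->//|[x xA]] := set_0Vmem A.
rewrite -(setD1K xA); apply: PS; first by rewrite !inE eqxx.
by apply: IH; rewrite (cardsD1 x) xA in hA.
Qed.

Lemma sum_powersetU1 (V : nmodType) (f : {set T} -> V) x P : x \notin P ->
  \sum_(A in powerset (x |: P)) f A =
  \sum_(A in powerset P) f A + \sum_(A in powerset P) f (x |: A).
Proof.
move=> xP; rewrite (bigID (fun A : {set T} => x \notin A)) /=; congr (_ + _).
  apply: eq_bigl => A; rewrite !powersetE; apply/andP/idP => [[sA xA]|sA].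
    by rewrite -(setU1K xP) subsetD1 sA.
  by rewrite (subset_trans sA (subsetUr _ _)); split=> //; apply: contra xP; apply: subsetP.
rewrite (reindex_onto (fun A => x |: A) (fun A => A :\ x)) /=; last first.
  by move=> A /andP[_ /negPn xA]; rewrite setD1K.
apply: eq_bigl => A; rewrite !powersetE setU11 andbT.
apply/andP/idP => [[sA /eqP eA]|sA].
  rewrite -(setU1K xP) subsetD1 (subset_trans (subsetUr _ _) sA) -eA.
  by rewrite !inE eqxx.
rewrite setUS //; split=> //; apply/eqP/setU1K.
by apply: contra xP; apply: subsetP.
Qed.

(* With [s = ln], a set [A] of primes stands for the squarefree integer [d = \prod_(p in A) p],
   so this is the sum of [a(d) phi(ln d)] over the [d] composed of primes of [P]. *)
Definition wsum a s P phi : R :=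
  \sum_(A in powerset P) (\prod_(p in A) a p) * phi (\sum_(p in A) s p).

Definition msum a s P (u : R) : R := wsum a s P (fun t => (t <= u)%R%:R).

Lemma wsum0 a s phi : wsum a s set0 phi = phi 0.
Proof. by rewrite /wsum powerset0 big_set1 !big_set0 mul1r. Qed.

Lemma wsumU1 a s p P phi : p \notin P ->
  wsum a s (p |: P) phi = wsum a s P phi + a p * wsum a s P (fun t => phi (s p + t)).
Proof.
move=> pP; rewrite /wsum sum_powersetU1 //; congr (_ + _).
rewrite mulr_sumr; apply: eq_bigr => A; rewrite powersetE => sA.
have pA : p \notin A by apply: contra pP; apply: subsetP.
by rewrite !big_setU1 //= mulrA.
Qed.

Lemma eq_wsum a s P phi psi : phi =1 psi -> wsum a s P phi = wsum a s P psi.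
Proof. by move=> e; apply: eq_bigr => A _; rewrite e. Qed.

Lemma eq_wsuml a b s P phi : {in P, a =1 b} -> wsum a s P phi = wsum b s P phi.
Proof.
move=> e; apply: eq_bigr => A; rewrite powersetE => sA; congr (_ * _).
by apply: eq_bigr => p pA; rewrite e // (subsetP sA).
Qed.

Lemma wsumD a s P phi psi :
  wsum a s P (fun t => phi t + psi t) = wsum a s P phi + wsum a s P psi.
Proof. by rewrite -big_split; apply: eq_bigr => A _; rewrite mulrDr. Qed.

Lemma wsumZ a s P c phi : wsum a s P (fun t => c * phi t) = c * wsum a s P phi.
Proof. by rewrite mulr_sumr; apply: eq_bigr => A _; rewrite mulrCA. Qed.

Lemma wsum_sum (I : Type) (r : seq I) (Pr : pred I) a s P (f : I -> R -> R) :
  wsum a s P (fun t => \sum_(i <- r | Pr i) f i t) =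
  \sum_(i <- r | Pr i) wsum a s P (f i).
Proof.
rewrite [RHS]exchange_big; apply: eq_bigr => A _ /=.
by rewrite mulr_sumr.
Qed.

Lemma wsum_wsumU1 a b s p P (f : R -> R -> R) : p \notin P ->
  wsum a s P (fun t => wsum b s (p |: P) (f t)) =
  wsum a s P (fun t => wsum b s P (f t)) +
  b p * wsum a s P (fun t => wsum b s P (fun t' => f t (s p + t'))).
Proof.
move=> pP; rewrite -wsumZ -wsumD; apply: eq_wsum => t.
by rewrite wsumU1.
Qed.

Lemma prod_in_ge0 a P A : {in P, forall p, 0 <= a p} -> A \subset P ->
  0 <= \prod_(p in A) a p.
Proof. by move=> h sA; apply: prodr_ge0 => p pA; apply: h; apply: (subsetP sA). Qed.

Lemma sum_in_ge0 a P A : {in P, forall p, 0 <= a p} -> A \subset P ->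
  0 <= \sum_(p in A) a p.
Proof. by move=> h sA; apply: sumr_ge0 => p pA; apply: h; apply: (subsetP sA). Qed.

Lemma ler_wsum a s P phi psi : {in P, forall p, 0 <= a p} ->
  {in P, forall p, 0 <= s p} ->
  (forall t, 0 <= t -> phi t <= psi t) -> wsum a s P phi <= wsum a s P psi.
Proof.
move=> a0 s0 h; apply: ler_sum => A; rewrite powersetE => sA.
by apply: ler_wpM2l; [apply: (prod_in_ge0 a0)|apply: h; apply: (sum_in_ge0 s0)].
Qed.

Lemma ler_wsuml a b s P phi : {in P, forall p, 0 <= a p <= b p} ->
  {in P, forall p, 0 <= s p} ->
  (forall t, 0 <= t -> 0 <= phi t) -> wsum a s P phi <= wsum b s P phi.
Proof.
move=> ab s0 h; apply: ler_sum => A; rewrite powersetE => sA.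
apply: ler_wpM2r; first by apply: h; apply: (sum_in_ge0 s0).
by apply: ler_prod => p pA; apply: ab; apply: (subsetP sA).
Qed.

Lemma wsum_ge0 a s P phi : {in P, forall p, 0 <= a p} -> {in P, forall p, 0 <= s p} ->
  (forall t, 0 <= t -> 0 <= phi t) -> 0 <= wsum a s P phi.
Proof.
move=> a0 s0 h; apply: sumr_ge0 => A; rewrite powersetE => sA.
by apply: mulr_ge0; [apply: (prod_in_ge0 a0)|apply: h; apply: (sum_in_ge0 s0)].
Qed.

Lemma wsum1 a s P : wsum a s P (fun=> 1) = \prod_(p in P) (1 + a p).
Proof.
elim/finset_ind: P => [|p P pP IH]; first by rewrite wsum0 big_set0.
by rewrite wsumU1 // IH big_setU1 //= mulrDl mul1r.
Qed.

Lemma msum_lt0 a s P u : {in P, forall p, 0 <= s p} -> u < 0 -> msum a s P u = 0.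
Proof.
move=> s0 u0; apply: big1 => A; rewrite powersetE => sA.
by rewrite leNgt (lt_le_trans u0) ?mulr0 //; apply: (sum_in_ge0 s0).
Qed.

Lemma le_msum a s P u v : {in P, forall p, 0 <= a p} -> {in P, forall p, 0 <= s p} ->
  u <= v -> msum a s P u <= msum a s P v.
Proof.
move=> a0 s0 uv; apply: ler_wsum => // t _; rewrite ler_nat.
by case: (leP t u) => //= /le_trans ->.
Qed.

Lemma msum_ge0 a s P u : {in P, forall p, 0 <= a p} -> {in P, forall p, 0 <= s p} ->
  0 <= msum a s P u.
Proof. by move=> a0 s0; apply: wsum_ge0 => // t _; apply: ler0n. Qed.

Lemma in_setU1_forall (Q : T -> Prop) p P :
  {in p |: P, forall x, Q x} -> Q p /\ {in P, forall x, Q x}.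
Proof. by move=> h; split=> [|x xP]; apply: h; rewrite !inE ?eqxx ?xP ?orbT. Qed.

Lemma wsum_add_le a b s P phi :
  {in P, forall p, 0 <= a p} -> {in P, forall p, 0 <= b p} ->
  {in P, forall p, 0 <= s p} -> (forall t, 0 <= t -> 0 <= phi t) ->
  wsum (fun p => a p + b p) s P phi <=
  wsum a s P (fun t => wsum b s P (fun t' => phi (t + t'))).
Proof.
elim/finset_ind: P phi => [|p P pP IH] phi.
  by move=> *; rewrite !wsum0 add0r.
move=> /in_setU1_forall[ap a0] /in_setU1_forall[bp b0] /in_setU1_forall[sp s0] phi0.
rewrite !wsumU1 //.
rewrite !wsum_wsumU1 //.
have phip t : 0 <= t -> 0 <= phi (s p + t) by move=> t0; apply/phi0/addr_ge0.
have h1 := IH phi a0 b0 s0 phi0.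
have h2 := IH _ a0 b0 s0 phip.
have e : wsum a s P (fun t => wsum b s P (fun t' => phi (t + (s p + t')))) =
   wsum a s P (fun t => wsum b s P (fun t' => phi (s p + (t + t')))).
  by apply: eq_wsum => t; apply: eq_wsum => t'; congr phi; ring.
have e2 : wsum a s P (fun t => wsum b s P (fun t' => phi (s p + t + t'))) =
   wsum a s P (fun t => wsum b s P (fun t' => phi (s p + (t + t')))).
  by apply: eq_wsum => t; apply: eq_wsum => t'; congr phi; ring.
rewrite e e2.
have h3 : 0 <= wsum a s P (fun t => wsum b s P (fun t' => phi (s p + t + (s p + t')))).
  apply: wsum_ge0 => // t t0; apply: wsum_ge0 => // t' t'0.
  by apply: phi0; rewrite !addr_ge0.
have h4 : 0 <= a p * (b p * wsum a s P (fun t => wsum b s P (fun t' => phi (s p + t + (s p + t'))))).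
  by rewrite !mulr_ge0.
have h5 : (a p + b p) * wsum (fun p => a p + b p) s P (fun t => phi (s p + t)) <=
  (a p + b p) * wsum a s P (fun t => wsum b s P (fun t' => phi (s p + (t + t')))).
  by apply: ler_wpM2l => //; apply: addr_ge0.
lra.
Qed.

Lemma wsum_mul_ge a b s P phi :
  {in P, forall p, 0 <= a p} -> {in P, forall p, 0 <= b p} ->
  {in P, forall p, 0 <= s p} -> (forall t, 0 <= t -> 0 <= phi t) ->
  (forall t t', 0 <= t -> t <= t' -> phi t' <= phi t) ->
  wsum a s P (fun t => wsum b s P (fun t' => phi (t + t'))) <=
  wsum (fun p => a p + b p + a p * b p) s P phi.
Proof.
elim/finset_ind: P phi => [|p P pP IH] phi.
  by move=> *; rewrite !wsum0 add0r.
move=> /in_setU1_forall[ap a0] /in_setU1_forall[bp b0] /in_setU1_forall[sp s0] phi0 phid.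
rewrite !wsumU1 //.
rewrite !wsum_wsumU1 //.
have phip t : 0 <= t -> 0 <= phi (s p + t) by move=> t0; apply/phi0/addr_ge0.
have phidp t t' : 0 <= t -> t <= t' -> phi (s p + t') <= phi (s p + t).
  by move=> t0 tt; apply: phid; rewrite ?lerD2l // addr_ge0.
have h1 := IH phi a0 b0 s0 phi0 phid.
have h2 := IH _ a0 b0 s0 phip phidp.
have e : wsum a s P (fun t => wsum b s P (fun t' => phi (t + (s p + t')))) =
   wsum a s P (fun t => wsum b s P (fun t' => phi (s p + (t + t')))).
  by apply: eq_wsum => t; apply: eq_wsum => t'; congr phi; ring.
have e2 : wsum a s P (fun t => wsum b s P (fun t' => phi (s p + t + t'))) =
   wsum a s P (fun t => wsum b s P (fun t' => phi (s p + (t + t')))).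
  by apply: eq_wsum => t; apply: eq_wsum => t'; congr phi; ring.
rewrite e e2.
have h3 : wsum a s P (fun t => wsum b s P (fun t' => phi (s p + t + (s p + t')))) <=
  wsum a s P (fun t => wsum b s P (fun t' => phi (s p + (t + t')))).
  apply: ler_wsum => // t t0; apply: ler_wsum => // t' t'0.
  apply: phid; first by rewrite !addr_ge0.
  by rewrite addrA; apply: lerD => //; rewrite ler_wpDl.
have h4 := ler_wpM2l (mulr_ge0 ap bp) h3.
have h5 := ler_wpM2l (addr_ge0 (addr_ge0 ap bp) (mulr_ge0 ap bp)) h2.
lra.
Qed.

Lemma wsum_setU_le a s P Q phi : [disjoint Q & P] ->
  {in Q :|: P, forall p, 0 <= a p} -> {in Q :|: P, forall p, 0 <= s p} ->
  (forall t, 0 <= t -> 0 <= phi t) ->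
  (forall t t', 0 <= t -> t <= t' -> phi t' <= phi t) ->
  wsum a s (Q :|: P) phi <= (\prod_(p in Q) (1 + a p)) * wsum a s P phi.
Proof.
move=> dQP a0 s0 phi0 phid; elim/finset_ind: Q dQP a0 s0 => [|q Q qQ IH].
  by rewrite set0U big_set0 mul1r.
move=> d a0 s0; have qP : q \notin P by rewrite (disjointFr d) // setU11.
have dQP : [disjoint Q & P] by apply: disjointWl d; apply: subsetUr.
have qQP : q \notin Q :|: P by rewrite inE negb_or qQ.
rewrite -setUA in a0 s0 *.
have {a0} [aq a0] := in_setU1_forall a0; have {s0} [sq s0] := in_setU1_forall s0.
rewrite wsumU1 // big_setU1 //= -mulrA.
have h : wsum a s (Q :|: P) (fun t => phi (s q + t)) <= wsum a s (Q :|: P) phi.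
  by apply: ler_wsum => // t t0; apply: phid => //; rewrite ler_wpDl.
have h1 := ler_wpM2l aq h.
have h2 : 0 <= 1 + a q by rewrite addr_ge0.
have h3 := ler_wpM2l h2 (IH dQP a0 s0).
lra.
Qed.

End SubsetSums.

Section PowerBounds.
Variables (R : archiRealFieldType) (T : finType).
Implicit Types (a b s : T -> R) (P : {set T}).

Lemma sum_telescope (V : zmodType) (f : nat -> V) n :
  \sum_(i < n) (f i - f i.+1) = f 0%N - f n.
Proof.
elim: n => [|n IH]; first by rewrite big_ord0 subrr.
by rewrite big_ord_recr IH /= addrA subrK.
Qed.

Lemma expr_diff_ge (x y : R) n : 0 <= y -> y <= x ->
  n.+1%:R * (x - y) * y ^+ n <= x ^+ n.+1 - y ^+ n.+1.
Proof.
move=> y0 yx; elim: n => [|n IH]; first by rewrite expr0 !expr1 mul1r mulr1.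
have xn : 0 <= x ^+ n.+1 - y ^+ n.+1 by rewrite subr_ge0 lerXn2r // nnegrE (le_trans y0).
have h1 := ler_wpM2l y0 IH.
have h2 := ler_wpM2r xn yx.
have : y * (n.+1%:R * (x - y) * y ^+ n) = n.+1%:R * (x - y) * y ^+ n.+1 by rewrite exprS; ring.
move: h1 h2; rewrite -[n.+2%:R]natr1 !(exprS _ n.+1) => h1 h2 h3.
lra.
Qed.

Lemma expr_diff_le (x y : R) n : 0 <= y -> y <= x ->
  x ^+ n.+1 - y ^+ n.+1 <= n.+1%:R * (x - y) * x ^+ n.
Proof.
move=> y0 yx; have x0 := le_trans y0 yx.
elim: n => [|n IH]; first by rewrite expr0 !expr1 mul1r mulr1.
have h1 := ler_wpM2l x0 IH.
have h2 : (x - y) * y ^+ n.+1 <= (x - y) * x ^+ n.+1.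
  by apply: ler_wpM2l; [rewrite subr_ge0|apply: lerXn2r; rewrite // nnegrE].
have : x * (n.+1%:R * (x - y) * x ^+ n) = n.+1%:R * (x - y) * x ^+ n.+1 by rewrite (exprS x n); ring.
move: h1 h2; rewrite -[n.+2%:R]natr1 !(exprS _ n.+1) => h1 h2 h3.
lra.
Qed.

Lemma unit_steps_ge (v : R) n : v <= n%:R -> v <= \sum_(i < n) (i%:R <= v)%R%:R.
Proof.
elim: n => [|n IH] vn; first by rewrite big_ord0.
have [hv|hv] := leP v n%:R.
  by rewrite big_ord_recr /=; apply: (le_trans (IH hv)); rewrite lerDl ler0n.
rewrite (eq_bigr (fun=> 1)); first by rewrite sumr_const card_ord.
move=> i _; rewrite (le_trans _ (ltW hv)) // ler_nat.
by rewrite -ltnS.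
Qed.

Lemma unit_steps_le (v : R) n : 0 <= v -> \sum_(i < n) (i.+1%:R <= v)%R%:R <= v.
Proof.
move=> v0; elim: n => [|n IH]; first by rewrite big_ord0.
have [hv|hv] := leP n.+1%:R v; last first.
  by rewrite big_ord_recr /= [n.+1%:R <= v]leNgt hv addr0.
apply: le_trans hv; apply: (@le_trans _ _ (\sum_(i < n.+1) 1)); last first.
  by rewrite sumr_const card_ord.
by apply: ler_sum => i _; rewrite -[leRHS]/(1%:R) ler_nat leq_b1.
Qed.

(* Induction on [j]: the weight [j.+1 * b] is dominated by the convolution of [j * b] with [b],
   and [u ^+ j] is summed along unit steps, which replaces integration. *)
Lemma msum_pow_le b s P (al D : R) : {in P, forall p, 0 <= b p} ->
  {in P, forall p, 0 <= s p} -> 0 <= al -> 0 <= D ->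
  (forall u, 0 <= u -> msum b s P u <= al * u + D) ->
  forall j u, 0 <= u ->
    msum (fun p => j%:R * b p) s P u <= (al * u + j%:R * (D + al)) ^+ j / j`!%:R.
Proof.
move=> b0 s0 al0 D0 hb; elim=> [|j IH] u u0.
  rewrite expr0 divr1 /msum.
  rewrite (le_trans (y := wsum (fun p => 0%:R * b p) s P (fun=> 1))) //.
    apply: ler_wsum => // [p pP|t _]; first by rewrite mul0r.
    by rewrite -[leRHS]/(1%:R) ler_nat leq_b1.
  by rewrite wsum1 big1 // => p _; rewrite mul0r addr0.
pose E := j%:R * (D + al).
have E0 : 0 <= E by rewrite mulr_ge0 ?ler0n ?addr_ge0.
have jb0 : {in P, forall p, 0 <= j%:R * b p} by move=> p pP; rewrite mulr_ge0 ?ler0n ?b0.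
pose m := (Num.truncn u).+1.
have /andP[um1 um2] := truncn_itv u0.
have h1 : msum (fun p => j.+1%:R * b p) s P u <=
    al * (\sum_(i < m) msum (fun p => j%:R * b p) s P (u - i%:R)) +
    D * msum (fun p => j%:R * b p) s P u.
  rewrite {1}/msum (eq_wsuml (b := fun p => j%:R * b p + b p)); last first.
    by move=> p _; rewrite -natr1 mulrDl mul1r.
  apply: le_trans (wsum_add_le jb0 b0 s0 _) _; first by move=> t _; apply: ler0n.
  rewrite /msum -wsum_sum -!wsumZ -wsumD; apply: ler_wsum => // t t0.
  have -> : wsum b s P (fun t' => (t + t' <= u)%R%:R) = msum b s P (u - t).
    by apply: eq_wsum => t'; rewrite lerBrDl.
  have [tu|tu] := leP t u; last first.
    rewrite msum_lt0 ?subr_lt0 // mulr0 addr0; apply: mulr_ge0 => //.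
    by apply: sumr_ge0 => i _; apply: ler0n.
  rewrite (_ : D * _ = D) ?mulr1 //; apply: le_trans (hb _ _) _; first by rewrite subr_ge0.
  rewrite lerD2r; apply: ler_wpM2l => //.
  apply: le_trans (unit_steps_ge (n := m) _) _.
    by rewrite (le_trans _ (ltW um2)) // gerBl.
  by apply: ler_sum => i _; rewrite lerBrDr addrC -lerBrDr.
pose X (i : nat) := (al * (u - i%:R) + al + E) ^+ j.+1.
have h2 : \sum_(i < m) (j.+1%:R * al * (al * (u - i%:R) + E) ^+ j) <= X 0%N.
  apply: (@le_trans _ _ (\sum_(i < m) (X i - X i.+1))); last first.
    rewrite sum_telescope gerBl /X exprn_ge0 // addr_ge0 //.
    have -> : al * (u - m%:R) + al = al * (u - (Num.truncn u)%:R) by rewrite /m -natr1; ring.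
    by rewrite mulr_ge0 // subr_ge0.
  apply: ler_sum => i _; rewrite /X.
  have e : al * (u - i.+1%:R) + al + E = al * (u - i%:R) + E by rewrite -natr1; ring.
  have ui : i%:R <= u by apply: le_trans um1; rewrite ler_nat -ltnS.
  rewrite e; set x := al * (u - i%:R) + E.
  have x0 : 0 <= x by rewrite addr_ge0 // mulr_ge0 // subr_ge0.
  have -> : al * (u - i%:R) + al + E = x + al by rewrite /x; ring.
  by apply: le_trans (expr_diff_ge j x0 _); rewrite ?lerDl // addrAC subrr add0r.
have fj : 0 < (j`!)%:R :> R by rewrite ltr0n fact_gt0.
have fj1 : 0 < (j.+1`!)%:R :> R by rewrite ltr0n fact_gt0.
rewrite ler_pdivlMr //.
apply: le_trans (ler_wpM2r (ltW fj1) h1) _.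
have h3 : al * (\sum_(i < m) msum (fun p => j%:R * b p) s P (u - i%:R)) * (j.+1`!)%:R <= X 0%N.
  apply: le_trans h2; rewrite mulr_sumr mulr_suml; apply: ler_sum => i _.
  have ui : i%:R <= u by apply: le_trans um1; rewrite ler_nat -ltnS.
  have h := IH (u - i%:R); rewrite subr_ge0 in h; move/(_ ui): h.
  rewrite ler_pdivlMr // -/E => h.
  rewrite factS natrM.
  have h' := ler_wpM2l (mulr_ge0 (ler0n R j.+1) al0) h.
  by rewrite (le_trans _ h') // le_eqVlt; apply/orP; left; apply/eqP; ring.
have h4 : D * msum (fun p => j%:R * b p) s P u * (j.+1`!)%:R <= j.+1%:R * D * (al * u + E) ^+ j.
  have := IH _ u0; rewrite ler_pdivlMr // -/E => h.
  rewrite factS natrM.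
  have h' := ler_wpM2l (mulr_ge0 (ler0n R j.+1) D0) h.
  by rewrite (le_trans _ h') // le_eqVlt; apply/orP; left; apply/eqP; ring.
have x0 : 0 <= al * u + E by rewrite addr_ge0 // mulr_ge0.
have y0 : al * u + E <= al * u + al + E by rewrite -addrA [al + E]addrC addrA lerDl.
have z0 : al * u + al + E <= al * u + al + E + D by rewrite lerDl.
have h5 := expr_diff_ge j (le_trans x0 y0) z0.
have h6 : (al * u + E) ^+ j <= (al * u + al + E) ^+ j by apply: lerXn2r; rewrite // nnegrE ?(le_trans x0).
have h7 := ler_wpM2l (mulr_ge0 (ler0n R j.+1) D0) h6.
have -> : al * u + j.+1%:R * (D + al) = al * u + al + E + D by rewrite /E -natr1; ring.
have e5 : al * u + al + E + D - (al * u + al + E) = D by ring.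
move: h3 h4 h5; rewrite /X subr0 e5 => h3 h4 h5.
rewrite mulrDl; lra.
Qed.

Lemma msum_pow_ge (g : nat -> T -> R) s P (al U : R) :
  (forall j, {in P, forall p, 0 <= g j p}) -> {in P, forall p, 0 <= s p} -> 0 <= al ->
  (forall u, 0 <= u -> u <= U -> al * u <= msum (g 1%N) s P u) ->
  forall k,
  (forall j, (j < k)%N -> {in P, forall p, g j p + g 1%N p + g j p * g 1%N p <= g j.+1 p}) ->
  forall u, k%:R <= u -> u <= U ->
    (al * (u - k%:R)) ^+ k / k`!%:R <= msum (g k) s P u.
Proof.
move=> g0 s0 al0 hg; elim=> [|j IH] hk u ju uU.
  rewrite expr0 divr1 /msum /wsum (bigD1 set0) ?powersetE ?sub0set //= !big_set0 mul1r ju lerDl.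
  apply: sumr_ge0 => A /andP[]; rewrite powersetE => sA _.
  by apply: mulr_ge0; [apply: (prod_in_ge0 _ sA); apply: g0|apply: ler0n].
have hk' : forall i, (i < j)%N -> {in P, forall p, g i p + g 1%N p + g i p * g 1%N p <= g i.+1 p}.
  by move=> i ij; apply: hk; apply: ltnW.
have {}IH := IH hk'.
have u0 : 0 <= u by apply: le_trans ju; apply: ler0n.
have v0 : 0 <= u - j%:R.
  by rewrite subr_ge0 (le_trans _ ju) // ler_nat.
pose m := Num.truncn (u - j%:R).
have /andP[um1 um2] := truncn_itv v0.
have h1 : al * (\sum_(i < m) msum (g j) s P (u - i.+1%:R)) <= msum (g j.+1) s P u.
  apply: (@le_trans _ _ (wsum (fun p => g j p + g 1%N p + g j p * g 1%N p) s P (fun t => (t <= u)%R%:R))); last first.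
    apply: ler_wsuml => // p pP.
    by rewrite hk // andbT !addr_ge0 ?mulr_ge0 ?g0.
  apply: le_trans (wsum_mul_ge (g0 j) (g0 1%N) s0 _ _); last 2 first.
  - by move=> t _; apply: ler0n.
  - by move=> t t' _ tt; rewrite ler_nat; case: (leP t' u) => //= /(le_trans tt) ->.
  rewrite /msum -wsum_sum -!wsumZ; apply: ler_wsum => // t t0.
  have -> : wsum (g 1%N) s P (fun t' => (t + t' <= u)%R%:R) = msum (g 1%N) s P (u - t).
    by apply: eq_wsum => t'; rewrite lerBrDl.
  have [tu|tu] := leP t u; last first.
    rewrite msum_lt0 ?subr_lt0 // big1 ?mulr0 // => i _.
    by rewrite lerBrDl leNgt (lt_le_trans tu) // ler_wpDl // ler0n.
  apply: le_trans (hg _ _ _); rewrite ?subr_ge0 //; last by rewrite (le_trans _ uU) // gerBl.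
  apply: ler_wpM2l => //; apply: le_trans (unit_steps_le m _); rewrite ?subr_ge0 //.
  by apply: ler_sum => i _; rewrite lerBrDr addrC -lerBrDr.
apply: le_trans h1.
have fj : 0 < (j`!)%:R :> R by rewrite ltr0n fact_gt0.
have fj1 : 0 < (j.+1`!)%:R :> R by rewrite ltr0n fact_gt0.
have h2 : al * (\sum_(i < m) (al * (u - i.+1%:R - j%:R)) ^+ j / j`!%:R) <=
   al * (\sum_(i < m) msum (g j) s P (u - i.+1%:R)).
  apply: ler_wpM2l => //; apply: ler_sum => i _.
  have ui : i.+1%:R <= u - j%:R by apply: le_trans um1; rewrite ler_nat.
  apply: IH; first by rewrite lerBrDl -lerBrDr.
  by rewrite (le_trans _ uU) // gerBl ler0n.
apply: le_trans h2.
rewrite ler_pdivrMr // -mulr_suml factS natrM.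
have -> (x : R) : al * (x / j`!%:R) * (j.+1%:R * j`!%:R) = j.+1%:R * (al * x).
  have h : (j`!)%:R != 0 :> R by rewrite gt_eqF.
  by field.
pose X (i : nat) := (al * (u - i.+1%:R - j%:R)) ^+ j.+1.
have m1 : (0 < m)%N.
  by rewrite /m truncn_gt0 lerBrDl natr1.
have -> : (al * (u - j.+1%:R)) ^+ j.+1 = X 0%N by rewrite /X -natr1 opprD addrA [in RHS]addrAC.
rewrite -(prednK m1) big_ord_recr /= mulrDr mulrDr mulr_sumr mulr_sumr.
have h3 : \sum_(i < m.-1) (X i - X i.+1) <= \sum_(i < m.-1) j.+1%:R * (al * (al * (u - i.+1%:R - j%:R)) ^+ j).
  apply: ler_sum => i _; rewrite /X.
  set x := al * _; set y := al * _.
  have y0 : 0 <= y.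
    rewrite /y mulr_ge0 // addrAC subr_ge0; apply: le_trans um1.
    by rewrite ler_nat; have := ltn_ord i; rewrite -ltnS prednK.
  have xy : x - y = al by rewrite /x /y -[i.+2%:R]natr1; ring.
  have yx : y <= x by rewrite -subr_ge0 xy.
  by have := expr_diff_le j y0 yx; rewrite xy; rewrite mulrA.
have h4 : X m.-1 <= j.+1%:R * (al * (al * (u - m.-1.+1%:R - j%:R)) ^+ j).
  rewrite /X; set x := al * _.
  have x0 : 0 <= x by rewrite /x mulr_ge0 // addrAC subr_ge0 prednK.
  have xal : x <= al.
    rewrite /x -[X in _ <= X]mulr1; apply: ler_wpM2l => //.
    have e : (m.+1%:R : R) = m%:R + 1 by rewrite -natr1.
    move: um2; rewrite -/m prednK // e; lra.
  have h5 : x * x ^+ j <= al * x ^+ j by apply: ler_wpM2r => //; apply: exprn_ge0.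
  rewrite exprS; apply: le_trans h5 _.
  by rewrite ler_peMl ?ler1n // mulr_ge0 // exprn_ge0.
apply: le_trans _ (lerD h3 h4); rewrite sum_telescope.
by rewrite subrK.
Qed.

End PowerBounds.

(** * Diagonalisation of the Selberg quadratic form *)

Section SelbergDiagonalisation.
Variables (R : fieldType) (T : finType).
Implicit Types (f g h a : T -> R) (P A B r u : {set T}) (y lam : {set T} -> R).

Lemma sum_powerset_prod a P :
  \sum_(A in powerset P) \prod_(p in A) a p = \prod_(p in P) (1 + a p).
Proof.
elim/finset_ind: P => [|p P pP IH]; first by rewrite powerset0 big_set1 !big_set0.
rewrite sum_powersetU1 // big_setU1 //= mulrDl mul1r -IH; congr (_ + _).
rewrite mulr_sumr; apply: eq_bigr => A; rewrite powersetE => sA.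
by rewrite big_setU1 //=; apply: contra pP; apply: subsetP.
Qed.

Lemma sum_powerset_above (V : nmodType) (F : {set T} -> V) r P : r \subset P ->
  \sum_(u in powerset P | r \subset u) F u = \sum_(v in powerset (P :\: r)) F (r :|: v).
Proof.
move=> rP; rewrite (reindex_onto (fun v => r :|: v) (fun u => u :\: r)) /=; last first.
  move=> u /andP[_ ru]; apply/setP => x; rewrite !inE.
  have [xr|//] := boolP (x \in r); by rewrite (subsetP ru).
apply: eq_bigl => v; rewrite !powersetE subsetUl andbT subUset rP /= subsetD.
apply/andP/andP => -[vP /eqP e]; split=> //.
  by rewrite -e disjoints_subset; apply/subsetP => x; rewrite !inE => /andP[].
apply/eqP; rewrite setDUl setDv set0U; apply/setDidPl.
by rewrite disjoint_sym disjoint_sym; apply/eqP.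
Qed.

Lemma prod_setU a A B : [disjoint A & B] ->
  \prod_(p in A :|: B) a p = (\prod_(p in A) a p) * \prod_(p in B) a p.
Proof. by move=> d; rewrite -bigU //=; apply: eq_bigl => p; rewrite !inE. Qed.

Lemma prod_setUI a A B :
  (\prod_(p in A :|: B) a p) * \prod_(p in A :&: B) a p =
  (\prod_(p in A) a p) * \prod_(p in B) a p.
Proof.
have -> : A :|: B = A :|: (B :\: A) by apply/setP => x; rewrite !inE; case: (x \in A).
rewrite prod_setU; last first.
  by rewrite disjoint_sym disjoints_subset; apply/subsetP => x; rewrite !inE => /andP[].
rewrite -mulrA; congr (_ * _).
by rewrite [RHS](big_setID A) /= mulrC [B :&: A]setIC.
Qed.

Lemma selberg_diag g lam P : {in P, forall p, g p != 0} ->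
  \sum_(A in powerset P) \sum_(B in powerset P)
    lam A * lam B * \prod_(p in A :|: B) g p =
  \sum_(r in powerset P) (\prod_(p in r) ((g p)^-1 - 1)) *
    (\sum_(A in powerset P | r \subset A) lam A * \prod_(p in A) g p) ^+ 2.
Proof.
move=> g0.
have gU A B : A \subset P -> B \subset P ->
    \prod_(p in A :|: B) g p = (\prod_(p in A) g p) * (\prod_(p in B) g p) *
    \sum_(r in powerset P | (r \subset A) && (r \subset B)) \prod_(p in r) ((g p)^-1 - 1).
  move=> sA sB.
  have -> : \sum_(r in powerset P | (r \subset A) && (r \subset B)) \prod_(p in r) ((g p)^-1 - 1) =
     \sum_(r in powerset (A :&: B)) \prod_(p in r) ((g p)^-1 - 1).
    apply: eq_bigl => r; rewrite !powersetE subsetI.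
    by case rA : (r \subset A); rewrite ?andbF //= (subset_trans rA sA).
  rewrite sum_powerset_prod -prod_setUI -mulrA -big_split /= [X in _ = _ * X]big1 ?mulr1 // => p.
  by rewrite inE => /andP[pA _]; rewrite addrC subrK mulfV // g0 // (subsetP sA).
transitivity (\sum_(A in powerset P) \sum_(B in powerset P)
   \sum_(r in powerset P) \prod_(p in r) ((g p)^-1 - 1) *
    ((if r \subset A then lam A * \prod_(p in A) g p else 0) *
     (if r \subset B then lam B * \prod_(p in B) g p else 0))).
  apply: eq_bigr => A; rewrite powersetE => sA; apply: eq_bigr => B; rewrite powersetE => sB.
  rewrite gU // big_mkcondr /= !mulr_sumr; apply: eq_bigr => r _.
  by case: (r \subset A) => /=; case: (r \subset B) => /=; rewrite ?(mulr0, mul0r) //; ring.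
under eq_bigr do rewrite exchange_big /=.
rewrite exchange_big /=; apply: eq_bigr => r _.
under eq_bigr do rewrite -mulr_sumr.
rewrite -mulr_sumr; congr (_ * _).
by rewrite expr2 big_mkcondr /= big_distrlr.
Qed.

(* The Selberg weights attached to the diagonal variables [y]: with
   [f p = 1 / g p] and [h p = 1 / (f p - 1)] this is the classical inversion. *)
Definition sel f h P y A : R :=
  if A \subset P then
    (\prod_(p in A) - f p) * \sum_(u in powerset P | A \subset u) y u * \prod_(p in u) h p
  else 0.

Lemma sel_dual f h g P y r : r \subset P ->
  \sum_(A in powerset P | r \subset A) sel f h P y A * \prod_(p in A) g p =
  (\prod_(p in r) - (f p * g p * h p)) *
  \sum_(v in powerset (P :\: r)) y (r :|: v) * \prod_(p in v) (h p * (1 - f p * g p)).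
Proof.
move=> rP.
transitivity (\sum_(A in powerset P | r \subset A) \sum_(u in powerset P | A \subset u)
   (y u * \prod_(p in u) h p) * \prod_(p in A) - (f p * g p)).
  apply: eq_bigr => A /andP[]; rewrite powersetE => sA rA.
  rewrite /sel sA mulrAC -big_split /= mulrC mulr_suml; apply: eq_bigr => u _; congr (_ * _).
  by apply: eq_bigr => p _; rewrite mulNr.
rewrite (exchange_big_dep (fun u => (u \in powerset P) && (r \subset u))) /=; last first.
  by move=> A u /andP[_ rA] /andP[-> Au]; rewrite (subset_trans rA).
rewrite sum_powerset_above // mulr_sumr; apply: eq_bigr => v; rewrite powersetE => vP.
have drv : [disjoint r & v].
  by rewrite disjoint_sym; move: vP; rewrite subsetD => /andP[].
have ruP : r :|: v \subset P by rewrite subUset rP (subset_trans vP) ?subsetDl.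
rewrite -mulr_sumr.
rewrite (eq_bigl (fun A => (A \in powerset (r :|: v)) && (r \subset A))); last first.
  move=> A; rewrite !powersetE ruP /= [RHS]andbC -andbA andbCA.
  by case Arv : (A \subset r :|: v); rewrite ?andbF // (subset_trans Arv) ?andbT.
rewrite sum_powerset_above ?subsetUl //.
have -> : (r :|: v) :\: r = v.
  by rewrite setDUl setDv set0U; apply/setDidPl; rewrite disjoint_sym.
have -> : \sum_(A in powerset v) \prod_(p in r :|: A) - (f p * g p) =
    (\prod_(p in r) - (f p * g p)) * \prod_(p in v) (1 - f p * g p).
  rewrite -sum_powerset_prod mulr_sumr; apply: eq_bigr => A; rewrite powersetE => Av.
  by rewrite prod_setU // (disjointWr Av).
rewrite prod_setU //.
rewrite [\prod_(p in v) (h p * _)]big_split /=.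
have -> : \prod_(p in r) - (f p * g p * h p) = (\prod_(p in r) - (f p * g p)) * \prod_(p in r) h p.
  by rewrite -big_split; apply: eq_bigr => p _ /=; rewrite mulNr.
ring.
Qed.

Lemma sel_quadratic f h g P y : {in P, forall p, g p != 0} ->
  \sum_(A in powerset P) \sum_(B in powerset P)
    sel f h P y A * sel f h P y B * \prod_(p in A :|: B) g p =
  \sum_(r in powerset P) (\prod_(p in r) (((g p)^-1 - 1) * (f p * g p * h p) ^+ 2)) *
   (\sum_(v in powerset (P :\: r)) y (r :|: v) * \prod_(p in v) (h p * (1 - f p * g p))) ^+ 2.
Proof.
move=> g0; rewrite selberg_diag //; apply: eq_bigr => r; rewrite powersetE => rP.
rewrite sel_dual // big_split /= exprMn mulrA; congr (_ * _ * _).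
rewrite -prodrXl; apply: eq_bigr => p _; by rewrite sqrrN.
Qed.

Lemma sel_quadratic_dual f h g P y : {in P, forall p, g p != 0} ->
  {in P, forall p, f p * g p = 1} -> {in P, forall p, h p * (f p - 1) = 1} ->
  \sum_(A in powerset P) \sum_(B in powerset P)
    sel f h P y A * sel f h P y B * \prod_(p in A :|: B) g p =
  \sum_(r in powerset P) (\prod_(p in r) h p) * y r ^+ 2.
Proof.
move=> g0 fg hf; rewrite sel_quadratic //; apply: eq_bigr => r; rewrite powersetE => rP.
congr (_ * _ ^+ 2).
  apply: eq_bigr => p /(subsetP rP) pP; rewrite fg // mul1r.
  have -> : (g p)^-1 = f p by apply: (mulIf (g0 p pP)); rewrite mulVf ?g0 ?fg.
  by rewrite expr2 mulrA [(f p - 1) * h p]mulrC hf ?mul1r.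
rewrite (bigD1 set0) ?powersetE ?sub0set //= big_set0 setU0 mulr1 big1 ?addr0 // => v.
rewrite powersetE => /andP[vP /set0Pn[p pv]].
have pP : p \in P by have := subsetP vP p pv; rewrite inE => /andP[].
by rewrite (bigD1 p) //= fg // subrr mulr0 mul0r mulr0.
Qed.

(* Restricted to the [m] divisible by [p], the sieve is again a Selberg sieve, over [P :\ p],
   whose diagonal variables are differences: they are small when [p] is. *)
Lemma sel_shift f h P y p A : p \in P -> p \notin A -> h p * (f p - 1) = 1 ->
  sel f h P y A + sel f h P y (p |: A) =
  sel f h (P :\ p) (fun u => y u - y (p |: u)) A.
Proof.
move=> pP pA hf; rewrite /sel subUset sub1set pP /= subsetD1 pA andbT.
case sA : (A \subset P); last by rewrite addr0.
rewrite !big_mkcondr /=.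
have pP' : p \notin P :\ p by rewrite !inE eqxx.
rewrite -{1 2}(setD1K pP) !sum_powersetU1 // big_setU1 //=.
have e0 : \sum_(u in powerset (P :\ p)) (if p |: A \subset u then y u * \prod_(q in u) h q else 0) = 0.
  rewrite big1 // => u; rewrite powersetE => uP; case: ifP => // /subsetP/(_ p).
  by rewrite setU11 => /(_ isT) /(subsetP uP); rewrite !inE eqxx.
rewrite e0 add0r.
rewrite [- f p * _]mulrC -[_ * - f p * _]mulrA -mulrDr; congr (_ * _).
rewrite -big_split /= mulr_sumr -big_split /=; apply: eq_bigr => u; rewrite powersetE => uP.
have pu : p \notin u by apply/negP => /(subsetP uP); rewrite !inE eqxx.
have -> : (A \subset p |: u) = (A \subset u).
  by rewrite -[in RHS](setU1K pu) subsetD1 pA andbT.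
have -> : (p |: A \subset p |: u) = (A \subset u).
  by rewrite subUset sub1set setU11 /= -[in RHS](setU1K pu) subsetD1 pA andbT.
case: ifP => _; last by rewrite mulr0 !addr0.
rewrite big_setU1 //=.
have -> : f p = (h p)^-1 + 1.
  have h0 : h p != 0 by apply: contra_eq_neq hf => ->; rewrite mul0r eq_sym oner_eq0.
  by apply: (mulfI h0); rewrite mulrDr mulfV // mulr1 -[in RHS]hf; ring.
have h0 : h p != 0 by apply: contra_eq_neq hf => ->; rewrite mul0r eq_sym oner_eq0.
by field.
Qed.

End SelbergDiagonalisation.

(** * Logarithms, primorials and sums over primes *)

Definition lnn (n : nat) : R := ln n%:R%R.

Lemma lnMr (x y : R) : 0 < x -> 0 < y -> ln (x * y)%R = ln x + ln y.
Proof. by move=> /RltP x0 /RltP y0; apply: ln_mult. Qed.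

Lemma ler_expR (x y : R) : x <= y -> exp x <= exp y.
Proof.
rewrite le_eqVlt => /orP[/eqP->//|/RltP xy].
by apply/ltW/RltP/exp_increasing.
Qed.

Lemma ltr_expR (x y : R) : x < y -> exp x < exp y.
Proof. by move=> /RltP xy; apply/RltP/exp_increasing. Qed.

Lemma expR_gt0 (x : R) : 0 < exp x.
Proof. by apply/RltP/exp_pos. Qed.

Lemma expR_add (x y : R) : exp (x + y)%R = exp x * exp y.
Proof. exact: exp_plus. Qed.

Lemma lnK (x : R) : 0 < x -> exp (ln x) = x.
Proof. by move=> /RltP/exp_ln. Qed.

Lemma ler_lnR (x y : R) : 0 < x -> x <= y -> ln x <= ln y.
Proof.
move=> x0; rewrite le_eqVlt => /orP[/eqP->//|/RltP xy].
by apply/ltW/RltP/ln_increasing => //; apply/RltP.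
Qed.

Lemma ltr_lnR (x y : R) : 0 < x -> x < y -> ln x < ln y.
Proof. by move=> /RltP x0 /RltP xy; apply/RltP/ln_increasing. Qed.

Lemma ln_le_subr1 (x : R) : 0 < x -> ln x <= x - 1.
Proof.
move=> x0; have /RleP := exp_ineq1_le (ln x).
by rewrite lnK // RplusE => h; rewrite lerBrDl.
Qed.

Lemma lnR1 : ln (GRing.one R) = 0.
Proof. exact: ln_1. Qed.

Lemma lnn1 : lnn 1 = 0.
Proof. exact: ln_1. Qed.

Lemma lnn_ge0 n : 0 <= lnn n.
Proof.
rewrite /lnn; case: n => [|n]; last by rewrite -lnR1; apply: ler_lnR; rewrite ?ltr01 // ler1n.
rewrite /ln; case: Rlt_dec => // h.
by move/RltP: (h); rewrite ltxx.
Qed.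

Lemma lnn_gt0 n : (1 < n)%N -> 0 < lnn n.
Proof. by move=> n1; rewrite -lnR1 /lnn; apply: ltr_lnR; rewrite ?ltr01 // ltr1n. Qed.

Lemma lnnM m n : (0 < m)%N -> (0 < n)%N -> lnn (m * n)%N = lnn m + lnn n.
Proof. by move=> m0 n0; rewrite /lnn natrM lnMr ?ltr0n. Qed.

Lemma ler_lnn m n : (0 < m)%N -> (m <= n)%N -> lnn m <= lnn n.
Proof. by move=> m0 mn; apply: ler_lnR; rewrite ?ltr0n ?ler_nat. Qed.

Lemma lnnS_diff n : (0 < n)%N -> n.+1%:R^-1 <= lnn n.+1 - lnn n <= n%:R^-1.
Proof.
move=> n0.
have n0r : 0 < n%:R :> R by rewrite ltr0n.
have n1r : 0 < n.+1%:R :> R by rewrite ltr0n.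
have d x y : 0 < x -> 0 < y -> ln x - ln y <= x / y - 1.
  move=> x0 y0; have q0 : 0 < x / y by rewrite divr_gt0.
  have -> : ln x = ln (x / y)%R + ln y by rewrite -lnMr // mulfVK // gt_eqF.
  by rewrite addrK; apply: ln_le_subr1.
apply/andP; split.
  have : lnn n - lnn n.+1 <= n%:R / n.+1%:R - 1 by exact: d.
  have -> : n%:R / n.+1%:R - 1 = - n.+1%:R^-1 :> R.
    by rewrite -[n.+1%:R]natr1; field; rewrite natr1 gt_eqF.
  by rewrite -[X in _ -> _ <= X]opprB lerNr.
have : lnn n.+1 - lnn n <= n.+1%:R / n%:R - 1 by exact: d.
have -> : n.+1%:R / n%:R - 1 = n%:R^-1 :> R.
  by rewrite -[n.+1%:R]natr1; field; rewrite gt_eqF.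
exact.
Qed.

Lemma sum_inv_ge n : lnn n.+1 <= \sum_(1 <= m < n.+1) m%:R^-1.
Proof.
elim: n => [|n IH]; first by rewrite big_geq // lnn1.
rewrite big_nat_recr //=.
have /andP[_ h] := lnnS_diff (ltn0Sn n).
by apply: le_trans (lerD IH h); rewrite addrC subrK.
Qed.

Lemma sum_inv_le n : (0 < n)%N -> \sum_(1 <= m < n.+1) m%:R^-1 <= 1 + lnn n.
Proof.
elim: n => // -[|n] IH _; first by rewrite big_nat1 invr1 lnn1 addr0.
rewrite big_nat_recr //=.
have /andP[h _] := lnnS_diff (ltn0Sn n).
by apply: le_trans (lerD (IH isT) h) _; lra.
Qed.

Lemma sum_inv_window (v u : R) X : 0 <= u -> v <= u ->
  \sum_(1 <= m < X | (v < lnn m) && (lnn m <= u)) m%:R^-1 <= 1 + (u - v).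
Proof.
move=> u0 vu.
have h n : \sum_(1 <= m < n.+1 | v < lnn m) m%:R^-1 <=
    if (0 < n)%N && (v < lnn n) then 1 + (lnn n - v) else 0.
  elim: n => [|n IH]; first by rewrite big_geq.
  rewrite big_mkcond /= big_nat_recr //= -big_mkcond /=.
  have i1 : n.+1%:R^-1 <= 1 :> R by rewrite invf_le1 ?ler1n ?ltr0n.
  have hd : (0 < n)%N -> n.+1%:R^-1 <= lnn n.+1 - lnn n.
    by move=> n0; have /andP[] := lnnS_diff n0.
  have hl : (0 < n)%N -> lnn n <= lnn n.+1 by move=> n0; apply: ler_lnn.
  move: (n.+1%:R^-1) i1 hd => i i1 hd.
  case: ifP => [vn|vn].
    move: IH; case: ifP => [/andP[n0 vn'] IH|_ IH].
      have := hd n0; lra.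
    lra.
  move: IH; case: ifP => [/andP[n0 vn'] _|_ IH]; last by rewrite addr0.
  by move: vn; rewrite (lt_le_trans vn' (hl n0)).
pose X1 := Num.truncn (exp u).
have e0 : 0 <= exp u by apply/ltW/expR_gt0.
have /andP[x1 x2] := truncn_itv e0.
have hm m : (1 <= m)%N -> lnn m <= u -> (m <= X1)%N.
  move=> m1 mu; rewrite truncn_ge_nat // -(lnK (x := m%:R)) ?ltr0n //.
  exact: ler_expR.
have X11 : (0 < X1)%N by apply: hm => //; rewrite lnn1.
apply: (@le_trans _ _ (\sum_(1 <= m < X1.+1 | v < lnn m) m%:R^-1)).
  rewrite (big_nat_widen _ _ (maxn X X1.+1)) ?leq_maxl //.
  rewrite [leRHS](big_nat_widen _ _ (maxn X X1.+1)) ?leq_maxr //.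
  rewrite big_mkcond [leRHS]big_mkcond /= big_nat_cond [leRHS]big_nat_cond /=.
  apply: ler_sum => m /andP[/andP[m1 _] _].
  have : 0 <= m%:R^-1 :> R by rewrite invr_ge0.
  case: (ltP v) => //= _; case mu: (lnn m <= u) => /=; last by case: ifP.
  rewrite ltnS hm //; case: ifP => //.
apply: le_trans (h _) _; case: ifP => [/andP[_ ?]|_]; last by rewrite addr_ge0 // subr_ge0.
rewrite lerD2l lerD2r -[leRHS]ln_exp; apply: ler_lnR => //.
by rewrite ltr0n.
Qed.

Lemma sum_inj_le (K : numDomainType) (I : finType) (Q : pred I) (f : I -> nat) X
  (C : pred nat) (psi : nat -> K) :
  {in Q &, injective f} -> (forall i, Q i -> (f i < X)%N && C (f i)) ->
  (forall m, C m -> 0 <= psi m) ->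
  \sum_(i | Q i) psi (f i) <= \sum_(0 <= m < X | C m) psi m.
Proof.
move=> fi fX p0.
have -> : \sum_(i | Q i) psi (f i) =
    \sum_(i | Q i) \sum_(0 <= m < X | C m) (if f i == m then psi m else 0).
  apply: eq_bigr => i /fX /andP[iX Ci].
  rewrite -big_mkcondr /= big_mkord (eq_bigl (fun m : 'I_X => m == Ordinal iX)) ?big_pred1_eq //.
  by move=> m; rewrite /= -[RHS]val_eqE /= eq_sym; case: eqP => [->|_]; rewrite ?Ci ?andbF.
rewrite exchange_big /=; apply: ler_sum => m Cm.
rewrite -big_mkcondr /= sumr_const -[leRHS]mulr1n.
apply: ler_wpMn2l; first exact: p0.
apply/card_le1_eqP => i j; rewrite !unfold_in => /andP[Qi /eqP fi'] /andP[Qj /eqP fj].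
by apply: fi; rewrite ?fi'.
Qed.

Definition primorial (D : nat) : nat := \prod_(0 <= p < D.+1 | prime p) p.

Definition mertens (D : nat) : R := ((totient (primorial D))%:R / (primorial D)%:R)%R.

Lemma primorial_gt0 D : (0 < primorial D)%N.
Proof. by rewrite /primorial; apply: prodn_cond_gt0 => p /prime_gt0. Qed.

Lemma dvdn_primorial D q : prime q -> (q %| primorial D)%N = (q <= D)%N.
Proof.
move=> pq; rewrite /primorial Euclid_dvd_prod // big_has_cond.
apply/hasP/idP => [[p]|qD].
  rewrite mem_index_iota ltnS => pD /andP[pp].
  by rewrite dvdn_prime2 // => /eqP ->.
by exists q; [rewrite mem_index_iota ltnS leq0n | rewrite /= pq dvdnn].
Qed.

Lemma coprime_primorialP D m : (0 < m)%N ->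
  reflect (forall q, prime q -> (q %| m)%N -> (D < q)%N) (coprime (primorial D) m).
Proof.
move=> m0; apply: (iffP idP) => [h q pq qm|h].
  rewrite ltnNge -dvdn_primorial //; apply/negP => qW.
  have : (q %| gcdn (primorial D) m)%N by rewrite dvdn_gcd qW.
  by rewrite (eqP h) dvdn1 => /eqP q1; rewrite q1 in pq.
rewrite /coprime eqn_leq gcdn_gt0 m0 orbT andbT leqNgt; apply/negP => h1.
have pp := pdiv_prime h1; have := pdiv_dvd (gcdn (primorial D) m).
rewrite dvdn_gcd => /andP[]; rewrite dvdn_primorial // leqNgt => hp pm.
by rewrite h in hp.
Qed.

Lemma mertensE D : mertens D = \prod_(0 <= p < D.+1 | prime p) (1 - p%:R^-1).
Proof.
elim: D => [|D IH]; rewrite /mertens.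
  have -> : primorial 0 = 1%N by rewrite /primorial big_mkcond big_nat1.
  by rewrite [RHS]big_mkcond big_nat1 /= divff ?oner_eq0.
have -> : primorial D.+1 = (primorial D * if prime D.+1 then D.+1 else 1)%N.
  by rewrite /primorial big_mkcond big_nat_recr //= -big_mkcond.
rewrite [RHS]big_mkcond /= [RHS]big_nat_recr //= -[X in _ = X * _]big_mkcond /= -IH.
case: ifP => pD; last by rewrite muln1 mulr1.
have p0 : D.+1%:R != 0 :> R by rewrite pnatr_eq0.
have w0 : (primorial D)%:R != 0 :> R by rewrite pnatr_eq0 -lt0n primorial_gt0.
rewrite totient_coprime; last first.
  by apply/coprime_primorialP => // q pq; rewrite dvdn_prime2 // => /eqP ->.
rewrite [totient D.+1]totient_prime //= /mertens !natrM -[D.+1%:R]natr1.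
by field; rewrite natr1 p0.
Qed.

Lemma mertens_gt0 D : 0 < mertens D.
Proof. by rewrite divr_gt0 // ltr0n ?totient_gt0 primorial_gt0. Qed.

Lemma mertens_le1 D : mertens D <= 1.
Proof.
rewrite ler_pdivrMr ?ltr0n ?primorial_gt0 // mul1r ler_nat totient_count_coprime.
apply: (@leq_trans (\sum_(0 <= d < primorial D) 1)); last by rewrite sum_nat_const_nat subn0 muln1.
by apply: leq_sum => i _; apply: leq_b1.
Qed.

Lemma sum_inv_coprime_block D J :
  \sum_(1 <= m < J.+1 * primorial D | coprime (primorial D) m) m%:R^-1 <=
  (totient (primorial D))%:R + mertens D * \sum_(1 <= j < J.+1) j%:R^-1 :> R.
Proof.
set W := primorial D; have W0 : (0 < W)%N := primorial_gt0 D.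
elim: J => [|J IH].
  rewrite mul1n [X in _ * X]big_geq // mulr0 addr0 totient_count_coprime natr_sum.
  rewrite [leRHS]big_ltn // ler_wpDl ?ler0n // big_mkcond /=.
  rewrite big_nat_cond [leRHS]big_nat_cond; apply: ler_sum => m /andP[/andP[m1 _] _].
  case: coprime => //; rewrite invf_le1 ?ler1n ?ltr0n //.
rewrite (big_cat_nat (n := (J.+1 * W)%N)) //=; last 2 first.
- by rewrite muln_gt0.
- by rewrite leq_mul2r leqnSn orbT.
rewrite [X in _ <= _ + _ * X]big_nat_recr //= mulrDr addrA lerD //.
rewrite -{1}[(J.+1 * W)%N]add0n big_addn -mulnBl subSnn mul1n.
apply: (@le_trans _ _ (\sum_(0 <= d < W | coprime W d) (J.+1 * W)%:R^-1)).
  rewrite (eq_bigl (fun d => coprime W d)); last first.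
    by move=> d; rewrite -coprime_modr addnC modnMDl coprime_modr.
  apply: ler_sum => d _; rewrite lef_pV2 ?posrE ?ltr0n ?addn_gt0 ?muln_gt0 ?W0 ?orbT //.
  by rewrite ler_nat leq_addl.
rewrite big_mkcond /=.
rewrite (eq_bigr (fun d => (coprime W d)%:R * (J.+1 * W)%:R^-1)); last first.
  by move=> d _; case: coprime; rewrite ?mul1r ?mul0r.
rewrite -mulr_suml -natr_sum -totient_count_coprime /mertens -/W natrM.
by rewrite invfM mulrA mulrAC.
Qed.

Lemma sum_inv_coprime_le D X : (0 < X)%N ->
  \sum_(1 <= m < X.+1 | coprime (primorial D) m) m%:R^-1 <=
  mertens D * lnn X + ((totient (primorial D))%:R + 1) :> R.
Proof.
move=> X0; set W := primorial D; have W0 : (0 < W)%N := primorial_gt0 D.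
pose J := (X %/ W)%N.
have XJ : (X.+1 <= J.+1 * W)%N by rewrite -ltn_divLR.
apply: (@le_trans _ _ (\sum_(1 <= m < J.+1 * W | coprime W m) m%:R^-1)).
  rewrite (big_nat_widen _ _ _ _ _ XJ) big_mkcondr /=; apply: ler_sum => m _.
  by case: ifP => // _; rewrite invr_ge0.
apply: le_trans (sum_inv_coprime_block D J) _; rewrite -/W.
rewrite [leRHS]addrCA lerD2l.
have [J0|J0] := posnP J.
  by rewrite J0 big_geq // mulr0 addr_ge0 // mulr_ge0 ?lnn_ge0 // ltW ?mertens_gt0.
apply: (@le_trans _ _ (mertens D * (1 + lnn X))).
  apply: ler_wpM2l; first by rewrite ltW ?mertens_gt0.
  apply: le_trans (sum_inv_le J0) _; rewrite lerD2l; apply: ler_lnn => //.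
  exact: leq_div.
have := mertens_le1 D; rewrite mulrDr mulr1; lra.
Qed.

Section PrimeSets.
Variables (M : nat).
Implicit Types (A B P r : {set 'I_M}).

Definition lns (p : 'I_M) : R := lnn p.
Definition setprod (A : {set 'I_M}) : nat := \prod_(p in A) (p : nat).

Lemma lns_ge0 (p : 'I_M) : 0 <= lns p.
Proof. exact: lnn_ge0. Qed.

Lemma setprod_gt0 A : {in A, forall p : 'I_M, prime p} -> (0 < setprod A)%N.
Proof. by move=> h; apply: prodn_cond_gt0 => p /h /prime_gt0. Qed.

Lemma setprodU1 p A : p \notin A -> setprod (p |: A) = (p * setprod A)%N.
Proof. by move=> pA; rewrite /setprod big_setU1. Qed.

Lemma lnn_setprod A : {in A, forall p : 'I_M, prime p} ->
  lnn (setprod A) = \sum_(p in A) lns p.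
Proof.
elim/finset_ind: A => [|p A pA IH] h; first by rewrite /setprod !big_set0 lnn1.
have [hp {}h] := in_setU1_forall h.
by rewrite setprodU1 // (lnnM (prime_gt0 hp) (setprod_gt0 h)) (IH h) big_setU1.
Qed.

Lemma natr_setprod A : (setprod A)%:R = \prod_(p in A) (p%:R : R).
Proof. exact: natr_prod. Qed.

Lemma dvdn_setprod A q : {in A, forall p : 'I_M, prime p} -> prime q ->
  (q %| setprod A)%N = [exists p in A, val p == q].
Proof.
move=> h pq; rewrite /setprod Euclid_dvd_prod // big_has_cond.
apply/hasP/exists_inP => [[p _ /andP[pA]]|[p pA /eqP <-]].
  by rewrite dvdn_prime2 ?h // => /eqP ->; exists p.
by exists p; [rewrite mem_index_enum | rewrite /= pA dvdnn].
Qed.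

Lemma mem_setprod A (p : 'I_M) : {in A, forall p : 'I_M, prime p} -> prime p ->
  (p %| setprod A)%N = (p \in A).
Proof.
move=> h pp; rewrite dvdn_setprod //; apply/exists_inP/idP => [[q qA /eqP e]|pA].
  by rewrite -(val_inj e).
by exists p.
Qed.

Lemma setprod_inj A B : {in A, forall p : 'I_M, prime p} -> {in B, forall p : 'I_M, prime p} ->
  setprod A = setprod B -> A = B.
Proof.
move=> hA hB e; apply/setP => p; apply/idP/idP => hp.
  by rewrite -mem_setprod // ?hA // -e mem_setprod // hA.
by rewrite -mem_setprod // ?hB // e mem_setprod // hB.
Qed.

Definition prime_range (D : nat) : {set 'I_M} := [set p : 'I_M | prime p && (D < p)%N].

Lemma prime_rangeP D : {in prime_range D, forall p : 'I_M, prime p}.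
Proof. by move=> p; rewrite inE => /andP[]. Qed.

Lemma wsum_inv_le D phi : (forall t, 0 <= phi t) ->
  forall X, (forall m, (X < m)%N -> phi (lnn m) = 0) -> (0 < X)%N ->
  wsum (fun p : 'I_M => p%:R^-1) lns (prime_range D) phi <=
  \sum_(1 <= m < X.+1 | coprime (primorial D) m) m%:R^-1 * phi (lnn m).
Proof.
move=> phi0 X hX X0; rewrite /wsum.
rewrite (bigID (fun A => (setprod A <= X)%N)) /= [X in _ + X]big1 ?addr0; last first.
  move=> A /andP[]; rewrite powersetE => sA; rewrite -ltnNge => XA.
  have hA : {in A, forall p : 'I_M, prime p} by move=> p /(subsetP sA)/prime_rangeP.
  by rewrite -lnn_setprod // hX ?mulr0.
rewrite (eq_bigr (fun A => (setprod A)%:R^-1 * phi (lnn (setprod A)))); last first.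
  move=> A /andP[]; rewrite powersetE => sA _.
  have hA : {in A, forall p : 'I_M, prime p} by move=> p /(subsetP sA)/prime_rangeP.
  by rewrite lnn_setprod // natr_setprod prodfV.
pose C := fun m => (1 <= m)%N && coprime (primorial D) m.
apply: (@le_trans _ _ (\sum_(0 <= m < X.+1 | C m) m%:R^-1 * phi (lnn m))).
  apply: (sum_inj_le (psi := fun m => m%:R^-1 * phi (lnn m))).
  - move=> A B /andP[+ _] /andP[+ _]; rewrite !powersetE => sA sB.
    by apply: setprod_inj => p; [move/(subsetP sA)|move/(subsetP sB)] => /prime_rangeP.
  - move=> A /andP[]; rewrite powersetE => sA AX; rewrite ltnS AX /C.
    have hA : {in A, forall p : 'I_M, prime p} by move=> p /(subsetP sA)/prime_rangeP.
    rewrite setprod_gt0 //=; apply/coprime_primorialP; first exact: setprod_gt0.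
    move=> q pq; rewrite dvdn_setprod // => /exists_inP[p /(subsetP sA)].
    by rewrite inE => /andP[_ h] /eqP <-.
  - by move=> m _; rewrite mulr_ge0 ?invr_ge0.
rewrite [leLHS]big_mkcond /= [leLHS]big_ltn //= add0r [leRHS]big_mkcond /=.
rewrite [leLHS]big_nat_cond [leRHS]big_nat_cond; apply: ler_sum => m /andP[/andP[m1 _] _].
by rewrite /C m1.
Qed.

End PrimeSets.

Lemma msumU1 (K : realFieldType) (T : finType) (a s : T -> K) p (P : {set T}) u :
  p \notin P -> msum a s (p |: P) u = msum a s P u + a p * msum a s P (u - s p).
Proof.
move=> pP; rewrite /msum wsumU1 //; congr (_ + _ * _).
by apply: eq_wsum => t; rewrite lerBrDl.
Qed.

Lemma trunc_expRP (u : R) m : (0 < m)%N -> (m <= Num.truncn (exp u))%N = (lnn m <= u).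
Proof.
move=> m0; rewrite truncn_ge_nat; last by apply/ltW/expR_gt0.
apply/idP/idP => h.
  by rewrite -[leRHS]ln_exp; apply: ler_lnR; rewrite ?ltr0n.
by rewrite -(lnK (x := m%:R)) ?ltr0n //; apply: ler_expR.
Qed.

Section PrimeSums.
Variables (M : nat).
Implicit Types (A B P r : {set 'I_M}).

Let inv (p : 'I_M) : R := (p%:R^-1)%R.
Let inv1 (p : 'I_M) : R := ((p%:R - 1)^-1)%R.

Lemma prime_sum_le D (u : R) : 0 <= u ->
  msum inv (@lns M) (prime_range M D) u <=
  mertens D * u + ((totient (primorial D))%:R + 1).
Proof.
move=> u0; pose X := Num.truncn (exp u).
have X0 : (0 < X)%N by rewrite /X trunc_expRP // lnn1.
apply: (le_trans (@wsum_inv_le M D _ _ X _ X0)) => //.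
- move=> m Xm; have m0 : (0 < m)%N by apply: leq_trans Xm.
  by rewrite -trunc_expRP // leqNgt Xm.
- apply: (@le_trans _ _ (\sum_(1 <= m < X.+1 | coprime (primorial D) m) m%:R^-1)).
    by apply: ler_sum => m _; rewrite -[leRHS]mulr1 ler_wpM2l ?invr_ge0 // -[leRHS]/(1%:R) ler_nat leq_b1.
  apply: le_trans (sum_inv_coprime_le D X0) _.
  rewrite lerD2r; apply: ler_wpM2l; first exact/ltW/mertens_gt0.
  by rewrite -trunc_expRP.
Qed.

Lemma prime_window_le D (u v : R) : v <= u ->
  wsum inv (@lns M) (prime_range M D) (fun t => ((v < t) && (t <= u))%R%:R) <= 1 + (u - v).
Proof.
move=> vu.
have [u0|u0] := boolP (u < 0); last rewrite -leNgt in u0.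
  apply: (@le_trans _ _ 0); last by rewrite addr_ge0 ?subr_ge0.
  rewrite /wsum big1 // => A _.
  suff -> : (\sum_(p in A) lns p <= u) = false by rewrite andbF mulr0.
  apply/negbTE; rewrite -ltNge; apply: (lt_le_trans u0).
  by apply: sumr_ge0 => p _; apply: lns_ge0.
pose X := Num.truncn (exp u).
have X0 : (0 < X)%N by rewrite /X trunc_expRP // lnn1.
apply: (le_trans (@wsum_inv_le M D _ _ X _ X0)) => //.
- move=> m Xm; have m0 : (0 < m)%N by apply: leq_trans Xm.
  by rewrite -trunc_expRP // leqNgt Xm andbF.
- apply: le_trans (sum_inv_window X.+1 u0 vu).
  rewrite [leLHS]big_mkcond [leRHS]big_mkcond /=; apply: ler_sum => m _.
  case: ifP => _; last by case: ifP => // _; rewrite invr_ge0.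
  by case: ifP => _; rewrite ?mulr1 ?mulr0.
Qed.

Definition smooth_over P (m : nat) := all (fun q => [exists p in P, val p == q]) (primes m).

Lemma sum_inv_smooth_le P : {in P, forall p : 'I_M, prime p} ->
  forall x (u : R), (forall m, (0 < m)%N -> (m <= x)%N -> lnn m <= u) ->
  \sum_(1 <= m < x.+1 | smooth_over P m) m%:R^-1 <= msum inv1 (@lns M) P u.
Proof.
elim/finset_ind: P => [_ x u hu|p P pP IHP hP].
  rewrite /msum wsum0.
  case: x hu => [|x] hu; first by rewrite big_geq.
  have -> : (0 <= u) = true by rewrite -[0]lnn1 hu.
  rewrite big_mkcond big_ltn //= big_nat_cond big1 ?addr0.
    by rewrite invr1.
  move=> m /andP[/andP[m1 _] _]; case: ifP => // /allP h.
  have /h /existsP[p] : pdiv m \in primes m.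
    by rewrite mem_primes pdiv_prime // (ltnW m1) pdiv_dvd.
  by rewrite inE.
have [pp {}hP] := in_setU1_forall hP; have {}IHP := IHP hP.
have i10 : {in P, forall p, 0 <= inv1 p}.
  by move=> q /hP /prime_gt1 q1; rewrite invr_ge0 subr_ge0 ler1n ltnW.
have p1 : 1 < p%:R :> R by rewrite ltr1n prime_gt1.
have p0 : 0 < p%:R :> R by rewrite ltr0n prime_gt0.
have ip : 0 <= inv1 p by rewrite invr_ge0 subr_ge0 ltW.
move=> x; elim: x {-2}x (leqnn x) => [|n IH] x xn u hu.
  move: xn; rewrite leqn0 => /eqP ->; rewrite big_geq //; apply: msum_ge0 => q; last by rewrite lns_ge0.
  by rewrite !inE => /orP[/eqP->|/i10].
rewrite (bigID (fun m => p %| m)%N) /= addrC msumU1 //; apply: lerD.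
  apply: le_trans (IHP x u hu); rewrite [leLHS]big_mkcond [leRHS]big_mkcond /=.
  apply: ler_sum => m _; case: ifP => [/andP[/allP sm pm]|_]; last first.
    by case: ifP => // _; rewrite invr_ge0.
  suff -> : smooth_over P m by [].
  apply/allP => q qm; have /exists_inP[p' p'P /eqP e] := sm q qm.
  apply/exists_inP; exists p'; last by apply/eqP.
  move: p'P; rewrite !inE => /orP[/eqP pp'|//].
  by move: qm; rewrite mem_primes -e pp' (negbTE pm) !andbF.
have le1 : \sum_(1 <= i < x.+1 | smooth_over (p |: P) i && (p %| i)%N) i%:R^-1 <=
    p%:R^-1 * \sum_(1 <= i < (x %/ p).+1 | smooth_over (p |: P) i) i%:R^-1 :> R.
  rewrite mulr_sumr.
  pose C := fun m => (0 < m)%N && smooth_over (p |: P) m.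
  apply: (@le_trans _ _ (\sum_(0 <= i < (x %/ p).+1 | C i) p%:R^-1 * i%:R^-1)).
    apply: (@le_trans _ _ (\sum_(i < x.+1 | [&& (0 < i)%N, smooth_over (p |: P) i & (p %| i)%N]) p%:R^-1 * (i %/ p)%:R^-1)).
      rewrite -(big_mkord (fun i => [&& (0 < i)%N, smooth_over (p |: P) i & (p %| i)%N]) (fun i => p%:R^-1 * (i %/ p)%:R^-1)).
      rewrite [leRHS]big_mkcond /= [leRHS]big_ltn //= add0r [leLHS]big_mkcond /=.
      rewrite [leLHS]big_nat_cond [leRHS]big_nat_cond; apply: ler_sum => i /andP[/andP[i1 _] _].
      rewrite i1 /=; case: ifP => // /andP[_ pi].
      by rewrite -invfM -natrM mulnC divnK.
    apply: (sum_inj_le (f := fun i : 'I_x.+1 => (i %/ p)%N) (psi := fun i => p%:R^-1 * i%:R^-1)).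
    - move=> i j /and3P[_ _ pi] /and3P[_ _ pj] e; apply: val_inj.
      by rewrite /= -(divnK pi) -(divnK pj) e.
    - move=> i /and3P[i0 si pi]; rewrite ltnS leq_div2r ?(ltnW (ltn_ord i)) -1?ltnS ?ltn_ord //=.
      have id0 : (0 < i %/ p)%N by rewrite divn_gt0 ?prime_gt0 // dvdn_leq.
      rewrite /C id0 /=; apply/allP => q; rewrite mem_primes => /and3P[pq _ qi].
      apply: (allP si); rewrite mem_primes pq i0 /=.
      by rewrite -(divnK pi) dvdn_mulr.
    - by move=> m _; rewrite mulr_ge0 ?invr_ge0 // ltW.
  rewrite [leLHS]big_mkcond /= [leLHS]big_ltn //= add0r [leRHS]big_mkcond /=.
  rewrite [leLHS]big_nat_cond [leRHS]big_nat_cond; apply: ler_sum => m /andP[/andP[m1 _] _].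
  by rewrite /C m1.
apply: le_trans le1 _.
have s0 : {in P, forall p, 0 <= lns p} by move=> q _; apply: lns_ge0.
have le2 : \sum_(1 <= i < (x %/ p).+1 | smooth_over (p |: P) i) i%:R^-1 <=
   msum inv1 (@lns M) (p |: P) (u - lns p).
  apply: IH.
    have [x0|x0] := posnP x; first by rewrite x0 div0n.
    by rewrite -ltnS (leq_trans _ xn) // ltn_Pdiv // prime_gt1.
  move=> m m0 mx; rewrite lerBrDl /lns -(lnnM (prime_gt0 pp) m0); apply: hu.
    by rewrite muln_gt0 prime_gt0.
  by rewrite mulnC -leq_divRL ?prime_gt0.
have le3 := ler_wpM2l (_ : 0 <= p%:R^-1) le2.
apply: le_trans (le3 _) _; first by rewrite invr_ge0 ltW.
rewrite msumU1 //.
have le4 : msum inv1 (@lns M) P (u - lns p - lns p) <= msum inv1 (@lns M) P (u - lns p).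
  by apply: le_msum => //; rewrite gerBl lns_ge0.
have e : inv1 p = p%:R^-1 * (1 + inv1 p).
  by rewrite /inv1; field; rewrite subr_eq0 !gt_eqF.
rewrite [X in _ <= X * _]e -mulrA; apply: ler_wpM2l; first by rewrite invr_ge0 ltW.
by rewrite mulrDl mul1r lerD2l; apply: ler_wpM2l.
Qed.

Lemma prod_small_primes D : (D < M)%N ->
  \prod_(p in prime_range M 0 :\: prime_range M D) (1 + inv1 p) = (mertens D)^-1.
Proof.
move=> DM; rewrite mertensE -prodfV.
rewrite (big_nat_widen _ _ M) // big_mkord.
apply: eq_big => p.
  rewrite !inE ltnS; case pp: (prime p) => //=.
  by rewrite prime_gt0 // andbT -leqNgt.
rewrite !inE => /andP[_ /andP[/prime_gt1 p1 _]].
have p1' : 1 < p%:R :> R by rewrite ltr1n.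
have p0' : 0 < p%:R :> R by rewrite ltr0n ltnW.
rewrite /inv1; field.
by rewrite subr_eq0 !gt_eqF //= subr_gt0.
Qed.

Lemma prime_sum_ge D r (u : R) : (D < M)%N -> (Num.truncn (exp u) < M)%N -> 0 <= u ->
  r \subset prime_range M D ->
  (\prod_(p in r) (1 - inv p)) * (mertens D * u) <=
  msum inv1 (@lns M) (prime_range M D :\: r) u.
Proof.
move=> DM uM u0 rP; set P := prime_range M D; set Pa := prime_range M 0.
have hPa : {in Pa, forall p : 'I_M, prime p} by apply: prime_rangeP.
have i10 : {in Pa, forall p, 0 <= inv1 p}.
  by move=> q /hPa /prime_gt1 q1; rewrite invr_ge0 subr_ge0 ler1n ltnW.
have s0 : {in Pa, forall p, 0 <= lns p} by move=> q _; apply: lns_ge0.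
have PPa : P \subset Pa.
  by apply/subsetP => p; rewrite !inE => /andP[pp _]; rewrite pp prime_gt0.
have h1 : u <= msum inv1 (@lns M) Pa u.
  apply: (@le_trans _ _ (lnn (Num.truncn (exp u)).+1)).
    have e0 : 0 <= exp u by apply/ltW/expR_gt0.
    have /andP[_ x2] := truncn_itv e0.
    rewrite -[leLHS]ln_exp; apply: ler_lnR; [exact: expR_gt0|exact: ltW].
  apply: le_trans (sum_inv_ge _) _.
  apply: le_trans (sum_inv_smooth_le hPa (x := Num.truncn (exp u)) _); last first.
    by move=> m m0; rewrite trunc_expRP.
  rewrite [leRHS]big_mkcond /= big_nat_cond [leRHS]big_nat_cond; apply: ler_sum => m /andP[/andP[m1 mx] _].
  suff -> : smooth_over Pa m by [].
  apply/allP => q; rewrite mem_primes => /and3P[pq _ qm].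
  have qM : (q < M)%N by apply: leq_ltn_trans (dvdn_leq m1 qm) (leq_ltn_trans _ uM).
  by apply/exists_inP; exists (Ordinal qM); rewrite ?inE /= ?pq ?prime_gt0.
have d1 : [disjoint (Pa :\: P) :|: r & P :\: r].
  rewrite disjoint_subset; apply/subsetP => p; rewrite !inE.
  by case: (p \in r); rewrite ?orbF //=; case: (prime p) => //=; case: (D < p)%N; rewrite ?andbF.
have e1 : Pa = ((Pa :\: P) :|: r) :|: (P :\: r).
  apply/setP => p; have := subsetP PPa p; have := subsetP rP p; rewrite -/P.
  rewrite [in RHS]in_setU [in RHS]in_setU [in RHS]in_setD [in RHS]in_setD.
  case: (p \in r); case: (p \in P); case: (p \in Pa) => //= h h';
    by [have := h isT | have := h' isT].
have h2 : msum inv1 (@lns M) Pa u <=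
    (\prod_(p in (Pa :\: P) :|: r) (1 + inv1 p)) * msum inv1 (@lns M) (P :\: r) u.
  rewrite [X in msum _ _ X _]e1; apply: wsum_setU_le => //; rewrite -?e1 //.
  by move=> t t' _ tt; rewrite ler_nat; case: (leP t' u) => //= /(le_trans tt) ->.
rewrite prod_setU in h2; last first.
  by rewrite disjoint_subset; apply/subsetP => p; rewrite inE => /andP[pP _]; rewrite inE; apply: contra pP; apply/subsetP.
rewrite prod_small_primes // in h2.
have h3 := le_trans h1 h2.
have m0 := mertens_gt0 D.
have hr : {in r, forall p : 'I_M, 1 < p%:R :> R}.
  by move=> p /(subsetP rP)/(subsetP PPa)/hPa/prime_gt1 p1; rewrite ltr1n.
have r0 : 0 < \prod_(p in r) (1 - inv p).
  by apply: prodr_gt0 => p /hr p1; rewrite subr_gt0 /inv invf_lt1 // (lt_trans ltr01).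
have h4 := ler_wpM2l (ltW (mulr_gt0 r0 m0)) h3.
rewrite mulrA; apply: le_trans h4 _.
have AB : (\prod_(p in r) (1 - inv p)) * (\prod_(p in r) (1 + inv1 p)) = 1.
  rewrite -big_split big1 // => p /hr p1 /=; have p0 := lt_trans ltr01 p1.
  by rewrite /inv /inv1; field; rewrite subr_eq0 !gt_eqF.
set S := msum _ _ _ _; move: AB; set A := \prod_(p in r) _; set B := \prod_(p in r) _ => AB.
suff -> : A * mertens D * ((mertens D)^-1 * B * S) = S by [].
by rewrite -[RHS]mul1r -AB; field; rewrite gt_eqF.
Qed.

End PrimeSums.

(** * Main terms *)

Section StepFunctions.
Variable (K : realFieldType).
Implicit Types (F : nat -> K) (del t : K).

Definition step F n del t : K :=
  \sum_(i < n) (F i - F i.+1) * (t <= i.+1%:R * del)%R%:R.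

Lemma step_jump n del t : 0 <= del -> exists2 j, (j <= n)%N &
  (forall F, step F n del t = F j - F n) /\
  (forall i, (i < n)%N -> (t <= i.+1%:R * del) = (j <= i)%N).
Proof.
move=> d0; elim: n => [|n [j jn [hF hj]]].
  by exists 0%N => //; split=> [F|//]; rewrite /step big_ord0 subrr.
have [tn|tn] := boolP (t <= n.+1%:R * del).
  exists j; first exact: leqW.
  split=> [F|i]; first by rewrite /step big_ord_recr /= tn -/(step F n del t) hF mulr1 addrA subrK.
  rewrite ltnS leq_eqVlt => /orP[/eqP->|]; last exact: hj.
  by rewrite tn jn.
exists n.+1 => //; split=> [F|i].
  rewrite /step big_ord_recr /= (negbTE tn) mulr0 addr0 subrr big1 // => i _.
  rewrite [_ <= _](_ : _ = false) ?mulr0 //; apply: contraNF tn => /le_trans; apply.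
  by apply: ler_wpM2r => //; rewrite ler_nat ltnS ltnW.
rewrite ltnS => ile; apply/idP/idP => [h|]; last by rewrite leqNgt ltnS ile.
exfalso; move/negP: tn; apply; apply: le_trans h _.
by apply: ler_wpM2r => //; rewrite ler_nat.
Qed.

Lemma step_sqr F n del t : 0 <= del -> F n = 0 ->
  step F n del t ^+ 2 = step (fun i => F i ^+ 2) n del t.
Proof.
move=> d0 Fn; have [j _ [hF _]] := step_jump n t d0.
by rewrite !hF Fn expr0n /= !subr0.
Qed.

Lemma step_ge0 F n del t : (forall i, F i.+1 <= F i) -> 0 <= step F n del t.
Proof. by move=> hF; apply: sumr_ge0 => i _; rewrite mulr_ge0 ?ler0n ?subr_ge0. Qed.

Lemma step_le F n del t : (forall i, F i.+1 <= F i) -> F n = 0 -> step F n del t <= F 0%N.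
Proof.
move=> hF Fn; rewrite -[leRHS]subr0 -Fn -(sum_telescope F); apply: ler_sum => i _.
by rewrite ler_piMr ?subr_ge0 // -[leRHS]/(1%:R) ler_nat leq_b1.
Qed.

Lemma step_gt F n del t : n%:R * del < t -> 0 <= del -> step F n del t = 0.
Proof.
move=> tn d0; apply: big1 => i _; rewrite leNgt (le_lt_trans _ tn) ?mulr0 //.
by apply: ler_wpM2r => //; rewrite ler_nat.
Qed.

Lemma wsum_step (T : finType) (a s : T -> K) P F n del (v : K) :
  wsum a s P (fun t => step F n del (v + t)) =
  \sum_(i < n) (F i - F i.+1) * msum a s P (i.+1%:R * del - v).
Proof.
rewrite /step wsum_sum; apply: eq_bigr => i _; rewrite wsumZ; congr (_ * _).
by apply: eq_wsum => t; rewrite lerBrDl.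
Qed.

Lemma sum_tail_abel F n j : F n = 0 -> (j < n)%N ->
  \sum_(j.+1 <= i < n) (F i - F i.+1) * (i%:R - j%:R) = \sum_(j.+1 <= i < n) F i.
Proof.
move=> Fn jn.
suff h m : (j.+1 <= m)%N -> \sum_(j.+1 <= i < m) (F i - F i.+1) * (i%:R - j%:R) =
    \sum_(j.+1 <= i < m) F i - F m * (m%:R - 1 - j%:R).
  by rewrite h // Fn mul0r subr0.
elim: m => // m IH; rewrite ltnS leq_eqVlt => /orP[/eqP<-|jm].
  by rewrite !big_geq // -natr1 addrK subrr mulr0 subrr.
by rewrite !big_nat_recr //= IH // -natr1; ring.
Qed.

End StepFunctions.

Section EulerFactors.
Variables (M k D : nat) (k1 : (1 < k)%N) (kD : (2 * k <= D)%N).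
Local Notation P := (prime_range M D).
Implicit Types (p : 'I_M).

(* [sg p] is the density of [p] dividing one of the [m + h]; [sf = 1 / sg] and [sh = 1 / (sf - 1)].
   [sg' p] is the same density among the [m] for which a fixed [m + h] is prime.  Since
   [sh p = k / p + se p], the convergent product of the [1 + se p] bounds the cost of replacing
   [sh p] by [k / p]. *)
Definition sf p : R := (p%:R / k%:R)%R.
Definition sg p : R := (k%:R / p%:R)%R.
Definition sh p : R := (k%:R / (p%:R - k%:R))%R.
Definition sg' p : R := ((k%:R - 1) / (p%:R - 1))%R.
Definition se p : R := (k%:R ^+ 2 / (p%:R * (p%:R - k%:R)))%R.

Let k0 : 1 < k%:R :> R. Proof. by rewrite ltr1n. Qed.
Let pk : {in P, forall p, 1 < k%:R :> R /\ 2 * k%:R < p%:R :> R}.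
Proof.
move=> p; rewrite inE => /andP[_ Dp]; split; first exact: k0.
by rewrite -natrM ltr_nat; apply: leq_ltn_trans kD Dp.
Qed.

Lemma sfg : {in P, forall p, sf p * sg p = 1}.
Proof. by move=> p /pk[k1' h]; rewrite /sf /sg; field; rewrite !gt_eqF //; lra. Qed.

Lemma sg_neq0 : {in P, forall p, sg p != 0}.
Proof. by move=> p /pk[k1' h]; rewrite /sg mulf_neq0 ?invr_eq0 // gt_eqF //; lra. Qed.

Lemma sg'_neq0 : {in P, forall p, sg' p != 0}.
Proof. by move=> p /pk[k1' h]; rewrite /sg' mulf_neq0 ?invr_eq0 // gt_eqF //; lra. Qed.

Lemma shf : {in P, forall p, sh p * (sf p - 1) = 1}.
Proof.
move=> p /pk[k1' h]; rewrite /sf /sh; field.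
by rewrite subr_eq0 !gt_eqF //; lra.
Qed.

Lemma sh_ge0 : {in P, forall p, 0 <= sh p}.
Proof. by move=> p /pk[k1' h]; rewrite /sh divr_ge0 //; lra. Qed.

Lemma se_ge0 : {in P, forall p, 0 <= se p}.
Proof. by move=> p /pk[k1' h]; rewrite /se divr_ge0 ?exprn_ge0 ?mulr_ge0 //; lra. Qed.

Lemma she : {in P, forall p, sh p = se p + k%:R * p%:R^-1}.
Proof.
move=> p /pk[k1' h]; rewrite /sh /se; field.
by rewrite subr_eq0 !gt_eqF //; lra.
Qed.

Lemma sh_sg' : {in P, forall p, sh p * (1 - sf p * sg' p) = (p%:R - 1)^-1}.
Proof.
move=> p /pk[k1' h]; rewrite /sh /sf /sg'; field.
by rewrite !subr_eq0 !gt_eqF //; lra.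
Qed.

Lemma sg'_factor : {in P, forall p,
  ((sg' p)^-1 - 1) * (sf p * sg' p * sh p) ^+ 2 * (1 - p%:R^-1) ^+ 2 =
  (k%:R - 1) / (p%:R - k%:R)}.
Proof.
move=> p /pk[k1' h]; rewrite /sh /sf /sg'; field.
by rewrite !subr_eq0 !gt_eqF //; lra.
Qed.

Lemma sg'_ge0 : {in P, forall p, 0 <= ((sg' p)^-1 - 1) * (sf p * sg' p * sh p) ^+ 2}.
Proof.
move=> p pP; have [k1' h] := pk pP; rewrite mulr_ge0 ?sqr_ge0 // /sg' invf_div subr_ge0 ler_pdivlMr; lra.
Qed.

Lemma sfh_le2 : {in P, forall p, 0 <= sf p * sh p <= 2}.
Proof.
move=> p /pk[k1' h]; have -> : sf p * sh p = p%:R / (p%:R - k%:R).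
  by rewrite /sf /sh; field; rewrite subr_eq0 !gt_eqF //; lra.
apply/andP; split; first by rewrite divr_ge0 //; lra.
rewrite ler_pdivrMr; lra.
Qed.

Definition euler_excess : R := \prod_(p in P) (1 + se p).

Lemma euler_excess_ge1 : 1 <= euler_excess.
Proof.
rewrite /euler_excess; elim/big_rec: _ => // p x pP x1.
have := se_ge0 pP => e0; rewrite -[leLHS]mulr1; apply: ler_pM => //.
by rewrite lerDl.
Qed.

Lemma sum_inv_sqr_le : \sum_(p in P) (p%:R * (p%:R - 1))^-1 <= D%:R^-1 :> R.
Proof.
pose psi (m : nat) : R := if (D < m)%N then ((m%:R * (m%:R - 1))^-1)%R else 0%R.
apply: (@le_trans _ _ (\sum_(i < M) psi i)).
  rewrite big_mkcond; apply: ler_sum => p _; rewrite /psi inE.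
  case: ifP => [/andP[_ ->]//|_]; case: ifP => // Dp.
  rewrite invr_ge0 mulr_ge0 // subr_ge0 ler1n.
  exact: leq_ltn_trans Dp.
have D0 : (0 < D)%N by apply: leq_trans kD; rewrite muln_gt0 /= ltnW.
have h n : \sum_(i < n) psi i <= if (D < n)%N then D%:R^-1 - (n%:R - 1)^-1 else 0.
  elim: n => [|n IH]; first by rewrite big_ord0.
  rewrite big_ord_recr /= [psi n]/psi ltnS.
  move: IH; rewrite [(D <= n)%N]leq_eqVlt; case: ltnP => [Dn IH|nD IH].
    rewrite orbT; apply: le_trans (lerD IH (lexx _)) _; rewrite -natr1 addrK.
    have n1 : 1 < n%:R :> R by rewrite ltr1n (leq_ltn_trans D0).
    have d0 : 0 < D%:R :> R by rewrite ltr0n.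
    rewrite le_eqVlt; apply/orP; left; apply/eqP; field.
    by rewrite !gt_eqF //; lra.
  rewrite orbF addr0; case: eqP => // ->; rewrite -natr1 addrK subrr.
  exact: IH.
apply: le_trans (h M) _; case: ifP => DM; last by rewrite invr_ge0.
rewrite gerBl invr_ge0 subr_ge0 ler1n.
exact: leq_ltn_trans DM.
Qed.

Lemma euler_excess_le : euler_excess * (1 - 2 * k%:R ^+ 2 / D%:R) <= 1.
Proof.
have sse : \sum_(p in P) se p <= 2 * k%:R ^+ 2 / D%:R.
  apply: (@le_trans _ _ (2 * k%:R ^+ 2 * \sum_(p in P) (p%:R * (p%:R - 1))^-1)); last first.
    by apply: ler_wpM2l; [rewrite mulr_ge0 ?exprn_ge0|exact: sum_inv_sqr_le].
  rewrite mulr_sumr; apply: ler_sum => p pP; have [k1' h] := pk pP.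
  have -> : 2 * k%:R ^+ 2 * (p%:R * (p%:R - 1))^-1 = k%:R ^+ 2 * (2 / (p%:R * (p%:R - 1))) :> R.
    by ring.
  apply: ler_wpM2l; first by rewrite exprn_ge0.
  rewrite ler_pdivlMr; last by rewrite mulr_gt0; lra.
  rewrite mulrC ler_pdivrMr; last by rewrite mulr_gt0; lra.
  rewrite mulrCA; apply: ler_wpM2l; lra.
have h : euler_excess * (1 - \sum_(p in P) se p) <= 1.
  rewrite /euler_excess; have : {subset P <= P} by [].
  move: {1 3 4}P => A; elim/finset_ind: A => [|p A pA IH] hA.
    by rewrite !big_set0 subr0 mulr1.
  have pP : p \in P by apply: hA; rewrite setU11.
  have {}IH : (\prod_(p in A) (1 + se p)) * (1 - \sum_(p in A) se p) <= 1.
    by apply: IH => q qA; apply: hA; rewrite inE qA orbT.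
  rewrite !big_setU1 //=; set x := \prod_(q in A) _ in IH *; set y := \sum_(q in A) _ in IH *.
  have x0 : 0 <= x by apply: prodr_ge0 => q qA; rewrite addr_ge0 // se_ge0 // hA // inE qA orbT.
  have y0 : 0 <= y by apply: sumr_ge0 => q qA; rewrite se_ge0 // hA // inE qA orbT.
  have e0 := se_ge0 pP.
  apply: le_trans IH; have : 0 <= x * (se p * (se p + y)).
    by apply: mulr_ge0 => //; apply: mulr_ge0 => //; apply: addr_ge0.
  lra.
apply: le_trans h; apply: ler_wpM2l; first by rewrite (le_trans _ euler_excess_ge1).
by rewrite lerD2l lerN2.
Qed.

End EulerFactors.

Section MainTerms.
Variables (M k D : nat) (k1 : (1 < k)%N) (kD : (2 * k <= D)%N) (DM : (D < M)%N).
Variables (L : R) (L0 : 0 <= L) (LM : (Num.truncn (exp L) < M)%N).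
Variables (n : nat) (F : nat -> R) (del : R).
Hypotheses (F_dec : forall i, F i.+1 <= F i) (Fn0 : F n = 0) (del0 : 0 <= del)
  (ndel : n%:R * del = L).
Local Notation P := (prime_range M D).
Local Notation E := (euler_excess M k D).
Local Notation al := (mertens D).
Implicit Types (p : 'I_M) (r u v : {set 'I_M}).

Definition dim_const : R := ((totient (primorial D))%:R + 1 + mertens D)%R.
Local Notation C := dim_const.

Let al0 : 0 <= al := ltW (mertens_gt0 D).
Let C0 : 0 <= C. Proof. by rewrite /dim_const !addr_ge0. Qed.
Let s0 (A : {set 'I_M}) : {in A, forall p, 0 <= lns p}.
Proof. by move=> p _; apply: lns_ge0. Qed.
Let E1 : 1 <= E := euler_excess_ge1 M k1 kD.
Let iv0 (A : {set 'I_M}) (j : nat) : {in A, forall p, 0 <= j%:R * p%:R^-1 :> R}.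
Proof. by move=> p _; rewrite mulr_ge0 ?invr_ge0. Qed.

Let F_ge0 i : (i <= n)%N -> 0 <= F i.
Proof.
move=> iln; have h m : F (m + i)%N <= F i.
  by elim: m => // m; apply: le_trans; apply: F_dec.
by rewrite -Fn0 -{1}(subnK iln).
Qed.

Let sqF_dec i : (i < n)%N -> 0 <= F i ^+ 2 - F i.+1 ^+ 2.
Proof.
move=> iln; rewrite subr_ge0; apply: lerXn2r; rewrite ?nnegrE ?F_ge0 //.
exact: ltnW.
Qed.

Definition yv u : R := step F n del (\sum_(p in u) lns p).

Lemma yv_ge0 u : 0 <= yv u. Proof. exact: step_ge0. Qed.
Lemma yv_le u : yv u <= F 0%N. Proof. exact: step_le. Qed.
Lemma yv_eq0 u : L < \sum_(p in u) lns p -> yv u = 0.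
Proof. by rewrite -ndel => h; apply: step_gt. Qed.

Lemma msum_inv_pow_le j (u : R) : 0 <= u ->
  msum (fun p => j%:R * p%:R^-1) (@lns M) P u <= (al * u + j%:R * C) ^+ j / j`!%:R.
Proof.
have D0 : 0 <= (totient (primorial D))%:R + 1 :> R by rewrite addr_ge0.
apply: (msum_pow_le (b := fun p : 'I_M => p%:R^-1)) => //.
- by move=> p _; rewrite invr_ge0.
- by move=> v v0; apply: prime_sum_le.
Qed.

Lemma msum_se_le j (u : R) : 0 <= u ->
  msum (fun p => se k p + j%:R * p%:R^-1) (@lns M) P u <=
  E * ((al * u + j%:R * C) ^+ j / j`!%:R).
Proof.
move=> u0; have e0 := @se_ge0 M k D k1 kD.
have b0 := iv0 (A := P) j.
apply: le_trans (wsum_add_le e0 b0 (@s0 P) _) _; first by move=> t _; apply: ler0n.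
apply: (@le_trans _ _ (wsum (se k) (@lns M) P (fun=> (al * u + j%:R * C) ^+ j / j`!%:R * 1))).
  apply: ler_wsum => // t t0; rewrite mulr1.
  apply: le_trans (msum_inv_pow_le j u0).
  apply: ler_wsum => // t' t'0; rewrite ler_nat; case: (leP (t + t') u) => //= h.
  by rewrite (le_trans _ h) // lerDr.
by rewrite wsumZ wsum1 mulrC.
Qed.

Lemma msum_sh_le (u : R) : 0 <= u ->
  msum (sh k) (@lns M) P u <= E * ((al * u + k%:R * C) ^+ k / k`!%:R).
Proof.
move=> u0; apply: le_trans (msum_se_le k u0).
by rewrite /msum (eq_wsuml _ _ (she k1 kD)).
Qed.

Lemma main_upper :
  \sum_(r in powerset P) (\prod_(p in r) sh k p) * yv r ^+ 2 <=
  E / k`!%:R * \sum_(i < n) (F i ^+ 2 - F i.+1 ^+ 2) * (al * (i.+1%:R * del) + k%:R * C) ^+ k.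
Proof.
have -> : \sum_(r in powerset P) (\prod_(p in r) sh k p) * yv r ^+ 2 =
    wsum (sh k) (@lns M) P (fun t => step (fun i => F i ^+ 2) n del (0 + t)).
  by apply: eq_bigr => r _; rewrite /yv step_sqr // add0r.
rewrite wsum_step mulr_sumr; apply: ler_sum => i _.
rewrite [leRHS]mulrCA; apply: ler_wpM2l; first exact: sqF_dec.
rewrite subr0; have u0 : 0 <= i.+1%:R * del by rewrite mulr_ge0.
by apply: le_trans (msum_sh_le u0) _; rewrite mulrA mulrAC.
Qed.

Lemma wsum_subset_le a phi (A B : {set 'I_M}) : A \subset B -> {in B, forall p, 0 <= a p} ->
  (forall t, 0 <= t -> 0 <= phi t) ->
  wsum a (@lns M) A phi <= wsum a (@lns M) B phi.
Proof.
move=> AB a0 phi0; rewrite /wsum [leRHS](bigID (fun r => r \subset A)) /=.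
rewrite -[leLHS]addr0; apply: lerD.
  rewrite [leRHS](eq_bigl (fun r => r \in powerset A)) // => r; rewrite !powersetE.
  by case rA : (r \subset A); rewrite ?andbF // (subset_trans rA).
apply: sumr_ge0 => r /andP[]; rewrite powersetE => rB _.
apply: mulr_ge0; first exact: (prod_in_ge0 a0).
by apply: phi0; apply: sumr_ge0 => p _; apply: lns_ge0.
Qed.

Lemma sh_window_le (u l : R) : 0 <= u -> 0 <= l ->
  wsum (sh k) (@lns M) P (fun t => ((u - l < t) && (t <= u))%R%:R) <=
  (1 + l) * (E * ((al * u + k.-1%:R * C) ^+ k.-1 / k.-1`!%:R)).
Proof.
move=> u0 l0; have e0 := @se_ge0 M k D k1 kD.
have a0 : {in P, forall p, 0 <= se k p + k.-1%:R * p%:R^-1 :> R}.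
  by move=> p pP; rewrite addr_ge0 ?e0 // mulr_ge0 ?invr_ge0.
have b0 : {in P, forall p : 'I_M, 0 <= p%:R^-1 :> R} by move=> p _; rewrite invr_ge0.
rewrite (eq_wsuml (b := fun p => (se k p + k.-1%:R * p%:R^-1) + p%:R^-1)); last first.
  move=> p pP; rewrite (she k1 kD) // -addrA; congr (_ + _).
  by rewrite -{1}(prednK (ltnW k1)) -natr1 mulrDl mul1r.
apply: le_trans (wsum_add_le a0 b0 (@s0 P) _) _; first by move=> t _; apply: ler0n.
apply: (@le_trans _ _ (wsum (fun p => se k p + k.-1%:R * p%:R^-1) (@lns M) P
   (fun t => (1 + l) * (t <= u)%R%:R))); last first.
  rewrite wsumZ; apply: ler_wpM2l; first by rewrite addr_ge0.
  exact: msum_se_le.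
apply: ler_wsum => // t t0.
have [tu|tu] := leP t u; last first.
  rewrite mulr0 /wsum big1 // => A _; rewrite [_ <= u](_ : _ = false) ?andbF ?mulr0 //.
  apply/negbTE; rewrite -ltNge; apply: (lt_le_trans tu); rewrite lerDl.
  by apply: sumr_ge0 => p _; apply: lns_ge0.
rewrite mulr1.
rewrite (eq_wsum _ _ _ (psi := fun t' => ((u - l - t < t') && (t' <= u - t))%R%:R)); last first.
  by move=> t' /=; rewrite [in RHS]ltrBlDl [in RHS]lerBrDl.
apply: (le_trans (@prime_window_le M D (u - t) (u - l - t) _)); first by rewrite lerD2r gerBl.
by have -> : u - t - (u - l - t) = l by ring.
Qed.

Lemma main_shift p0 : p0 \in P ->
  \sum_(r in powerset (P :\ p0)) (\prod_(p in r) sh k p) * (yv r - yv (p0 |: r)) ^+ 2 <=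
  F 0%N ^+ 2 * ((1 + lns p0) * (E * ((al * L + k.-1%:R * C) ^+ k.-1 / k.-1`!%:R))).
Proof.
move=> p0P.
have sP : P :\ p0 \subset P by apply: subsetDl.
have sh0 := @sh_ge0 M k D k1 kD.
pose G := fun i => F i ^+ 2.
have h1 : \sum_(r in powerset (P :\ p0)) (\prod_(p in r) sh k p) * (yv r - yv (p0 |: r)) ^+ 2 <=
   wsum (sh k) (@lns M) (P :\ p0) (fun t => \sum_(i < n) (G i - G i.+1) *
     ((i.+1%:R * del - lns p0 < t) && (t <= i.+1%:R * del))%R%:R).
  apply: ler_sum => r; rewrite powersetE => rP.
  apply: ler_wpM2l; first by apply: (prod_in_ge0 sh0); apply: subset_trans sP.
  have p0r : p0 \notin r by apply/negP => /(subsetP rP); rewrite !inE eqxx.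
  have yy : yv (p0 |: r) <= yv r.
    rewrite /yv big_setU1 //=; apply: ler_sum => i _.
    apply: ler_wpM2l; first by rewrite subr_ge0.
    rewrite ler_nat; case: leP => //= h; rewrite (le_trans _ h) // lerDr.
    exact: lns_ge0.
  apply: (@le_trans _ _ (yv r ^+ 2 - yv (p0 |: r) ^+ 2)).
    have := yv_ge0 (p0 |: r) => y0.
    have : 0 <= (yv r - yv (p0 |: r)) * yv (p0 |: r) by rewrite mulr_ge0 // subr_ge0.
    rewrite !expr2; lra.
  rewrite /yv !step_sqr // big_setU1 //= /step -sumrB.
  apply: ler_sum => i _; rewrite -mulrBr; apply: ler_wpM2l; first exact: sqF_dec.
  set t := \sum_(p in r) _.
  set u := i.+1%:R * del.
  case: (leP (lns p0 + t) u) => h1; case: (leP t u) => h2.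
  - by rewrite subrr.
  - by rewrite sub0r andbF lerN10.
  - by rewrite subr0 ltrBlDl h1.
  - by rewrite subr0.
apply: le_trans h1 _; rewrite wsum_sum.
have -> : F 0%N ^+ 2 = \sum_(i < n) (G i - G i.+1).
  by rewrite sum_telescope /G Fn0 expr0n subr0.
rewrite mulr_suml; apply: ler_sum => i _; rewrite wsumZ; apply: ler_wpM2l; first exact: sqF_dec.
have uL : i.+1%:R * del <= L by rewrite -ndel; apply: ler_wpM2r => //; rewrite ler_nat.
have u0 : 0 <= i.+1%:R * del by rewrite mulr_ge0.
apply: le_trans (wsum_subset_le sP sh0 _) _; first by move=> t _; apply: ler0n.
apply: le_trans (sh_window_le u0 (lns_ge0 p0)) _.
apply: ler_wpM2l; first by rewrite addr_ge0 ?lns_ge0.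
apply: ler_wpM2l; first by rewrite (le_trans _ E1).
apply: ler_wpM2r; first by rewrite invr_ge0.
by apply: lerXn2r; [| |rewrite lerD2r; apply: ler_wpM2l];
  rewrite ?nnegrE //; apply: addr_ge0; apply: mulr_ge0.
Qed.

Definition tailF j : R := \sum_(j.+1 <= i < n) F i.

Lemma tailF_dec j : tailF j.+1 <= tailF j.
Proof.
rewrite /tailF; have [jn|nj] := ltnP j.+1 n.
  by rewrite [leRHS]big_ltn // lerDr F_ge0 // ltnW.
by rewrite !big_geq // (leq_trans nj).
Qed.

Lemma tailF_ge0 j : 0 <= tailF j.
Proof.
rewrite /tailF big_nat_cond; apply: sumr_ge0 => i /andP[/andP[_ h] _].
exact/F_ge0/ltnW.
Qed.

Lemma inner_ge r j : r \subset P -> (j < n)%N -> \sum_(p in r) lns p <= j.+1%:R * del ->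
  (\prod_(p in r) (1 - p%:R^-1)) * (al * (del * tailF j)) <=
  \sum_(v in powerset (P :\: r)) yv (r :|: v) *
     \prod_(p in v) (sh k p * (1 - sf k p * sg' k p)).
Proof.
move=> rP jn; set t := \sum_(p in r) lns p => tj.
have -> : \sum_(v in powerset (P :\: r)) yv (r :|: v) *
     \prod_(p in v) (sh k p * (1 - sf k p * sg' k p)) =
   wsum (fun p => (p%:R - 1)^-1) (@lns M) (P :\: r) (fun t' => step F n del (t + t')).
  apply: eq_bigr => v; rewrite powersetE => vP; rewrite mulrC; congr (_ * _).
    apply: eq_bigr => p /(subsetP vP); rewrite inE => /andP[_ pP].
    exact: sh_sg' pP.
  rewrite /yv; congr step; rewrite /t -bigU /=; last first.
    by move: vP; rewrite subsetD disjoint_sym => /andP[].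
  by apply: eq_bigl => p; rewrite !inE.
rewrite wsum_step.
set A := \prod_(p in r) _.
have A0 : 0 <= A.
  apply: prodr_ge0 => p /(subsetP rP); rewrite inE => /andP[/prime_gt0 pp _].
  by rewrite subr_ge0 invf_le1 ?ler1n ?ltr0n.
have hi i : (i < n)%N -> t <= i.+1%:R * del ->
   A * (al * (i.+1%:R * del - t)) <=
   msum (fun p => (p%:R - 1)^-1) (@lns M) (P :\: r) (i.+1%:R * del - t).
  move=> iln ti; apply: prime_sum_ge => //; last by rewrite subr_ge0.
  apply: leq_ltn_trans LM; apply: le_truncn; apply: ler_expR.
  rewrite -ndel; apply: (@le_trans _ _ (i.+1%:R * del)).
    by rewrite gerBl; apply: sumr_ge0 => p _; apply: lns_ge0.
  by apply: ler_wpM2r => //; rewrite ler_nat.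
have m0 (u : R) : 0 <= msum (fun p : 'I_M => (p%:R - 1)^-1) (@lns M) (P :\: r) u.
  apply: msum_ge0 => // p; rewrite !inE => /and3P[_ /prime_gt0 pp _].
  by rewrite invr_ge0 subr_ge0 ler1n.
rewrite -(big_mkord xpredT (fun i => (F i - F i.+1) * msum (fun p : 'I_M => (p%:R - 1)^-1) (@lns M) (P :\: r) (i.+1%:R * del - t))).
rewrite (big_cat_nat (n := j.+1)) //=; apply: ler_wpDl.
  by apply: sumr_ge0 => i _; rewrite mulr_ge0 ?subr_ge0.
rewrite /tailF -(sum_tail_abel Fn0 jn) !mulr_sumr [leLHS]big_nat_cond [leRHS]big_nat_cond.
apply: ler_sum => i /andP[/andP[ji iln] _].
have ti : t <= i.+1%:R * del.
  by apply: le_trans tj _; apply: ler_wpM2r => //; rewrite ler_nat ltnS ltnW.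
have -> : A * (al * (del * ((F i - F i.+1) * (i%:R - j%:R)))) =
   (F i - F i.+1) * (A * (al * (del * (i%:R - j%:R)))) by ring.
apply: ler_wpM2l; first by rewrite subr_ge0.
apply: le_trans (hi i iln ti); apply: ler_wpM2l => //; apply: ler_wpM2l => //.
rewrite lerBrDr; apply: (@le_trans _ _ (del * (i%:R - j%:R) + j.+1%:R * del)).
  by rewrite lerD2l.
rewrite -!natr1; lra.
Qed.

Lemma msum_dual_ge (u : R) : u <= L ->
  (al * Num.max 0 (u - k.-1%:R)) ^+ k.-1 / k.-1`!%:R <=
  msum (fun p => (k%:R - 1) / (p%:R - k%:R)) (@lns M) P u.
Proof.
move=> uL.
have hp : {in P, forall p, 2 * k%:R < p%:R :> R}.
  by move=> p; rewrite inE => /andP[_ Dp]; rewrite -natrM ltr_nat; apply: leq_ltn_trans kD Dp.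
have hk : 1 < k%:R :> R by rewrite ltr1n.
have a0 : {in P, forall p : 'I_M, 0 <= (k%:R - 1) / (p%:R - k%:R) :> R}.
  by move=> p /hp h; rewrite divr_ge0 //; lra.
have [hu|hu] := leP k.-1%:R u; last first.
  rewrite max_l; last by rewrite subr_le0 ltW.
  have kj : k.-1 = k.-2.+1 by move: k1; case: (k) => [|[|m]].
  by rewrite [in X in _ ^+ X]kj mulr0 exprS !mul0r; apply: msum_ge0.
rewrite max_r ?subr_ge0 //.
pose g (j : nat) (p : 'I_M) : R := if (j < k)%N then (j%:R / (p%:R - j%:R))%R else 0%R.
have g0 j : {in P, forall p, 0 <= g j p}.
  move=> p /hp h; rewrite /g; case: ifP => // jk.
  have : j%:R <= k%:R :> R by rewrite ler_nat ltnW.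
  by move=> jk'; rewrite divr_ge0 //; lra.
apply: (@le_trans _ _ (msum (g k.-1) (@lns M) P u)); last first.
  apply: ler_wsuml => // p pP; rewrite (g0 k.-1 p pP) /= /g.
  rewrite prednK ?leqnn ?(ltnW k1) //.
  have -> : k.-1%:R = k%:R - 1 :> R by rewrite -[in RHS](prednK (ltnW k1)) -natr1 addrK.
  have h := hp _ pP; apply: ler_wpM2l; first lra.
  by rewrite lef_pV2 ?posrE; lra.
apply: (msum_pow_ge (g := g) (U := L)) => //.
  move=> v v0 vL.
  have := prime_sum_ge DM (leq_ltn_trans (le_truncn (ler_expR vL)) LM) v0 (sub0set _).
  rewrite big_set0 mul1r setD0 => h; apply: le_trans h _.
  rewrite le_eqVlt; apply/orP; left; apply/eqP; apply: eq_wsuml => p pP.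
  by rewrite /g k1 mul1r.
move=> j jk p pP; have h := hp _ pP.
have jk' : (j.+1 < k)%N by rewrite -ltn_predRL.
have jk2 : j.+1%:R <= k%:R :> R by rewrite ler_nat ltnW.
rewrite /g jk' (ltnW jk') k1; rewrite -natr1 in jk2 *.
have j0 : 0 <= j%:R :> R by [].
have -> : j%:R / (p%:R - j%:R) + 1 / (p%:R - 1) + j%:R / (p%:R - j%:R) * (1 / (p%:R - 1)) =
  ((j%:R + 1) * p%:R - j%:R) / ((p%:R - j%:R) * (p%:R - 1)) :> R.
  by field; rewrite !gt_eqF //; lra.
rewrite ler_pdivrMr; last by rewrite mulr_gt0; lra.
rewrite mulrAC ler_pdivlMr; last by lra.
have := mulr_ge0 j0 j0; nra.
Qed.

Lemma main_lower :
  al ^+ 2 * del ^+ 2 * (\sum_(j < n) (tailF j ^+ 2 - tailF j.+1 ^+ 2) *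
     ((al * Num.max 0 (j.+1%:R * del - k.-1%:R)) ^+ k.-1 / k.-1`!%:R)) <=
  \sum_(r in powerset P)
    (\prod_(p in r) (((sg' k p)^-1 - 1) * (sf k p * sg' k p * sh k p) ^+ 2)) *
    (\sum_(v in powerset (P :\: r)) yv (r :|: v) *
       \prod_(p in v) (sh k p * (1 - sf k p * sg' k p))) ^+ 2.
Proof.
pose G := fun j => tailF j ^+ 2.
have Gd j : 0 <= G j - G j.+1.
  by rewrite subr_ge0; apply: lerXn2r; rewrite ?nnegrE ?tailF_ge0 ?tailF_dec.
pose hs (p : 'I_M) : R := ((k%:R - 1) / (p%:R - k%:R))%R.
apply: (@le_trans _ _ (al ^+ 2 * del ^+ 2 * wsum hs (@lns M) P (fun t => step G n del (0 + t)))).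
  apply: ler_wpM2l; first by rewrite mulr_ge0 ?exprn_ge0.
  rewrite wsum_step; apply: ler_sum => j _; apply: ler_wpM2l; first exact: Gd.
  rewrite subr0; apply: msum_dual_ge.
  by rewrite -ndel; apply: ler_wpM2r => //; rewrite ler_nat.
rewrite /wsum mulr_sumr; apply: ler_sum => r; rewrite powersetE => rP.
have -> : \prod_(p in r) hs p = (\prod_(p in r) (((sg' k p)^-1 - 1) * (sf k p * sg' k p * sh k p) ^+ 2)) *
    (\prod_(p in r) (1 - p%:R^-1)) ^+ 2.
  rewrite -prodrXl -big_split; apply: eq_bigr => p /(subsetP rP) pP /=.
  by rewrite (sg'_factor k1 kD pP).
set B := \prod_(p in r) (_ * _); set A := \prod_(p in r) _; set S := \sum_(v in _) _.
have B0 : 0 <= B by apply: prodr_ge0 => p /(subsetP rP); apply: sg'_ge0.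
have -> : al ^+ 2 * del ^+ 2 * (B * A ^+ 2 * step G n del (0 + \sum_(p in r) lns p)) =
  B * (al ^+ 2 * del ^+ 2 * A ^+ 2 * step G n del (0 + \sum_(p in r) lns p)) by ring.
apply: ler_wpM2l => //; rewrite add0r.
have [j jn [hG hj]] := step_jump n (\sum_(p in r) lns p) del0.
rewrite hG.
have Gn : G n = 0 by rewrite /G /tailF big_geq // expr0n.
rewrite Gn subr0.
move: jn; rewrite leq_eqVlt => /orP[/eqP->|jn]; first by rewrite Gn mulr0 sqr_ge0.
have tj : \sum_(p in r) lns p <= j.+1%:R * del by rewrite hj.
have h := inner_ge rP jn tj; rewrite -/A -/S in h.
have A0 : 0 <= A.
  apply: prodr_ge0 => p /(subsetP rP); rewrite inE => /andP[/prime_gt0 pp _].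
  by rewrite subr_ge0 invf_le1 ?ler1n ?ltr0n.
have h0 : 0 <= A * (al * (del * tailF j)) by do 3!(apply: mulr_ge0 => //); apply: tailF_ge0.
have -> : al ^+ 2 * del ^+ 2 * A ^+ 2 * G j = (A * (al * (del * tailF j))) ^+ 2.
  by rewrite /G; ring.
by apply: lerXn2r => //; rewrite nnegrE //; apply: le_trans h.
Qed.

End MainTerms.

(** * Residue classes and error terms *)

Lemma count_le1 (T : eqType) (a : pred T) (s : seq T) : uniq s ->
  {in s &, forall x y, a x -> a y -> x = y} -> count a s = has a s :> nat.
Proof.
elim: s => //= x s IH /andP[xs us] h.
have h' : {in s &, forall x y, a x -> a y -> x = y}.
  by move=> y z ys zs; apply: h; rewrite inE ?ys ?zs orbT.
rewrite IH //; case ax: (a x) => //=.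
suff -> : has a s = false by [].
apply/negP => /hasP[y ys ay]; move: xs.
by rewrite (h x y _ _ ax ay) ?ys // inE ?eqxx // ys orbT.
Qed.

Lemma residue_classes M (W v0 : nat) (hs : seq nat) (U : {set 'I_M}) :
  uniq hs -> (0 < W)%N ->
  {in U, forall p : 'I_M, prime p} -> {in U, forall p : 'I_M, coprime W p} ->
  {in U, forall p : 'I_M, {in hs &, forall h h', h = h' %[mod p] -> h = h'}} ->
  exists As : seq nat, size As = (size hs ^ #|U|)%N /\
   forall n, count (fun a => n == a %[mod W * setprod U]) As =
     (n == v0 %[mod W]) && [forall p in U, has (fun h => p %| n + h)%N hs] :> nat.
Proof.
move=> uh W0; elim/finset_ind: U => [|p U pU IH] hp hc hd.
  exists [:: v0]; rewrite cards0 expn0; split=> // n.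
  rewrite /setprod big_set0 muln1 /= addn0; congr (nat_of_bool _).
  have -> : [forall p in (set0 : {set 'I_M}), has (fun h => (p %| n + h)%N) hs].
    by apply/forall_inP => p; rewrite inE.
  by rewrite andbT.
have [pp {}hp] := in_setU1_forall hp; have [cp {}hc] := in_setU1_forall hc.
have [dp {}hd] := in_setU1_forall hd.
have [As [sA hA]] := IH hp hc hd.
set q := (W * setprod U)%N in hA.
have cq : coprime q p.
  rewrite coprimeMl cp /= coprime_sym prime_coprime //.
  by rewrite mem_setprod.
exists [seq chinese q p a (p - h %% p)%N | a <- As, h <- hs].
rewrite size_allpairs sA cardsU1 pU expnS mulnC; split=> // n.
rewrite setprodU1 // mulnCA mulnC -/q.
have hc2 h : (n == p - h %% p %[mod p])%N = (p %| n + h)%N.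
  rewrite -(eqn_modDr (h %% p)) subnK ?modnn; last by rewrite ltnW // ltn_mod prime_gt0.
  by rewrite modnDmr /dvdn.
rewrite -sum1_count big_mkcond /= big_allpairs_dep /=.
under eq_bigr => a _ do under eq_bigr => h _ do
  rewrite chinese_remainder // chinese_modl // chinese_modr // hc2.
transitivity (\sum_(a <- As) (n == a %[mod q]) * \sum_(h <- hs) (p %| n + h))%N.
  apply: eq_bigr => a _; rewrite big_distrr /=; apply: eq_bigr => h _.
  by case: (_ == _ %[mod q]); case: (_ %| _)%N.
rewrite -big_distrl /=.
have -> : (\sum_(a <- As) (n == a %[mod q]) = count (fun a => n == a %[mod q]) As)%N.
  by rewrite -sum1_count [RHS]big_mkcond; apply: eq_bigr => a _; case: (_ == _).
rewrite hA.
have -> : (\sum_(h <- hs) (p %| n + h) = has (fun h => p %| n + h) hs)%N.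
  rewrite -(count_le1 uh) -?sum1_count ?[RHS]big_mkcond.
    by apply: eq_bigr => h _; case: (_ %| _)%N.
  move=> h h' hh hh' d1 d2; apply: dp => //.
  by apply/eqP; rewrite -(eqn_modDl n) (eqP d1) (eqP d2).
rewrite mulnb -andbA; congr (nat_of_bool (_ && _)).
apply/andP/forall_inP => [[/forall_inP h1 h2] p'|h].
  by rewrite !inE => /orP[/eqP->|/h1].
split; last by apply: h; rewrite setU11.
by apply/forall_inP => p' p'U; apply: h; rewrite inE p'U orbT.
Qed.

Lemma sum_count_exchange (K : pzRingType) (r : seq nat) (psi : nat -> K) (q : nat) (As : seq nat)
  (c : pred nat) :
  (forall n, count (fun a => n == a %[mod q]) As = c n :> nat) ->
  \sum_(n <- r | c n) psi n = \sum_(a <- As) \sum_(n <- r | n == a %[mod q]) psi n.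
Proof.
move=> h; rewrite (exchange_big_dep xpredT) //= big_mkcond /=; apply: eq_bigr => n _.
rewrite -(big_filter _ (fun a => n == a %[mod q])) big_const_seq count_predT size_filter h.
by case: (c n) => //=; rewrite addr0.
Qed.

Lemma count_progression (x N q a : nat) : (0 < q)%N ->
  `| \sum_(x <= n < x + N | n == a %[mod q]) 1 - N%:R / q%:R | <= 1 :> R.
Proof.
move=> q0; pose c := (q.-1 - a %% q)%N.
have aq : (a %% q < q)%N by rewrite ltn_mod.
have h m : (\sum_(x <= n < x + m | n == a %[mod q]) 1 = (x + m + c) %/ q - (x + c) %/ q)%N.
  elim: m => [|m IH]; first by rewrite addn0 big_geq // subnn.
  rewrite big_mkcond addnS big_nat_recr ?leq_addr //= -big_mkcond IH addSn divnS //.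
  have e : (q %| (x + m + c).+1)%N = (x + m == a %[mod q]).
    have -> : (x + m + c).+1 = (x + m + (q - a %% q))%N by rewrite /c; lia.
    by rewrite -[in RHS](eqn_modDr (q - a %% q)) -[in X in _ = (_ == X)]modnDml subnKC ?(ltnW aq) // modnn.
  rewrite e; have le : ((x + c) %/ q <= (x + m + c) %/ q)%N.
    by apply: leq_div2r; rewrite leq_add2r leq_addr.
  by case: (_ == _) => /=; rewrite ?addn0 ?add0n // addnBAC // addnC.
have -> : \sum_(x <= n < x + N | n == a %[mod q]) 1 = ((x + N + c) %/ q)%:R - ((x + c) %/ q)%:R :> R.
  have le : ((x + c) %/ q <= (x + N + c) %/ q)%N.
    by apply: leq_div2r; rewrite leq_add2r leq_addr.
  by rewrite -natrB // -h natr_sum.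
have q0' : 0 < q%:R :> R by rewrite ltr0n.
have fl m : (m %/ q)%:R <= m%:R / q%:R :> R /\ m%:R / q%:R < (m %/ q)%:R + 1 :> R.
  rewrite ler_pdivlMr // ltr_pdivrMr // natr1 -!natrM ler_nat ltr_nat leq_trunc_div.
  by rewrite -ltn_divLR // ltnS.
have [f1 f2] := fl (x + N + c)%N; have [f3 f4] := fl (x + c)%N.
have e : (x + N + c)%:R / q%:R = N%:R / q%:R + (x + c)%:R / q%:R :> R.
  by rewrite -mulrDl -natrD; congr (_%:R / _); lia.
rewrite ler_norml; apply/andP; split; lra.
Qed.

Section QuadraticSieve.
Variables (M : nat) (P : {set 'I_M}).
Implicit Types (A B U u v : {set 'I_M}) (lam g Er : {set 'I_M} -> R).

Lemma sieve_expand (r : seq nat) (psi : nat -> R) (Dn : nat -> {set 'I_M}) lam :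
  \sum_(n <- r) psi n * (\sum_(A in powerset P | A \subset Dn n) lam A) ^+ 2 =
  \sum_(A in powerset P) \sum_(B in powerset P)
     lam A * lam B * \sum_(n <- r | A :|: B \subset Dn n) psi n.
Proof.
transitivity (\sum_(n <- r) \sum_(A in powerset P) \sum_(B in powerset P)
    lam A * lam B * (if A :|: B \subset Dn n then psi n else 0)).
  apply: eq_bigr => n _; rewrite expr2 big_mkcondr big_distrlr mulr_sumr /=.
  apply: eq_bigr => A _; rewrite mulr_sumr; apply: eq_bigr => B _.
  rewrite subUset; case: (A \subset _); case: (B \subset _); rewrite /= ?(mulr0, mul0r) //.
  by rewrite mulrC.
rewrite exchange_big /=; apply: eq_bigr => A _.
rewrite exchange_big /=; apply: eq_bigr => B _.
by rewrite -mulr_sumr -big_mkcond.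
Qed.

Lemma sieve_error lam g Er S (X B0 L : R) : {in P, forall p : 'I_M, 0 <= lns p} -> 0 <= B0 ->
  (forall A, A \subset P -> `|lam A| <= B0 * 2 ^+ #|A| * (\sum_(p in A) lns p <= L)%R%:R) ->
  (forall U, 0 <= Er U) ->
  (forall A B, A \subset P -> B \subset P -> lam A != 0 -> lam B != 0 ->
     `|S (A :|: B) - X * g (A :|: B)| <= Er (A :|: B)) ->
  `| \sum_(A in powerset P) \sum_(B in powerset P) lam A * lam B * S (A :|: B) -
     X * \sum_(A in powerset P) \sum_(B in powerset P) lam A * lam B * g (A :|: B) | <=
  B0 ^+ 2 * \sum_(U in powerset P | \sum_(p in U) lns p <= 2 * L) 16 ^+ #|U| * Er U.
Proof.
move=> s0 B00 hlam Er0 hS.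
rewrite [X * _]mulr_sumr -sumrB.
apply: (@le_trans _ _ (\sum_(A in powerset P) \sum_(B in powerset P)
   \sum_(U in powerset P | \sum_(p in U) lns p <= 2 * L)
    if (A \subset U) && (B \subset U) then B0 ^+ 2 * 4 ^+ #|U| * Er U else 0)); last first.
  under eq_bigr do rewrite exchange_big /=.
  rewrite exchange_big /= mulr_sumr; apply: ler_sum => U /andP[]; rewrite powersetE => UP _.
  have -> : \sum_(A in powerset P) \sum_(B in powerset P)
      (if (A \subset U) && (B \subset U) then B0 ^+ 2 * 4 ^+ #|U| * Er U else 0) =
      \sum_(A in powerset U) \sum_(B in powerset U) (B0 ^+ 2 * 4 ^+ #|U| * Er U).
    have hP (f : {set 'I_M} -> R) : \sum_(A in powerset U) f A =
        \sum_(A in powerset P) (if A \subset U then f A else 0).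
      rewrite -big_mkcondr; apply: eq_bigl => A; rewrite !powersetE.
      by case AU : (A \subset U); rewrite ?andbF // (subset_trans AU).
    rewrite hP; apply: eq_bigr => A _; case: (A \subset U) => /=; first by rewrite hP.
    by rewrite big1.
  have hc (x : R) c : x *+ c *+ c = x * c%:R * c%:R by rewrite !mulr_natr.
  rewrite !sumr_const card_powerset hc natrX.
  have -> : 16 ^+ #|U| = 4 ^+ #|U| * (2 ^+ #|U| * 2 ^+ #|U|) :> R.
    by rewrite -!exprMn; congr (_ ^+ _); ring.
  by rewrite le_eqVlt; apply/orP; left; apply/eqP; ring.
apply: le_trans (ler_norm_sum _ _ _) _; apply: ler_sum => A; rewrite powersetE => AP.
rewrite [X * _]mulr_sumr -sumrB.
apply: le_trans (ler_norm_sum _ _ _) _; apply: ler_sum => B; rewrite powersetE => BP.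
have nn U : 0 <= (if (A \subset U) && (B \subset U) then B0 ^+ 2 * 4 ^+ #|U| * Er U else 0).
  by case: ifP => // _; rewrite !mulr_ge0 ?exprn_ge0.
have [->|lA] := eqVneq (lam A) 0; first by rewrite !mul0r mulr0 subrr normr0 sumr_ge0.
have [->|lB] := eqVneq (lam B) 0; first by rewrite !mulr0 !mul0r mulr0 subrr normr0 sumr_ge0.
have sup A' : A' \subset P -> lam A' != 0 -> \sum_(p in A') lns p <= L.
  move=> A'P l0; rewrite leNgt; apply/negP => hL; have := hlam A' A'P.
  by rewrite [_ <= L]leNgt hL mulr0 normr_le0 (negbTE l0).
have sU : \sum_(p in A :|: B) lns p <= 2 * L.
  apply: (@le_trans _ _ (\sum_(p in A) lns p + \sum_(p in B) lns p)).
    rewrite [leLHS](big_setID A) /= setIUl setIid setDUl setDv set0U.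
    have -> : A :|: B :&: A = A by apply/setUidPl; apply: subsetIr.
    rewrite lerD2l [leRHS](big_setID A) /= lerDr; apply: sumr_ge0 => p.
    by rewrite inE => /andP[/(subsetP BP)/s0].
  have := sup A AP lA; have := sup B BP lB; lra.
have UP : A :|: B \in powerset P by rewrite powersetE subUset AP.
rewrite (bigD1 (A :|: B)) /=; last by rewrite UP sU.
rewrite subsetUl subsetUr /= -[leLHS]addr0; apply: lerD; last by apply: sumr_ge0.
have -> : lam A * lam B * S (A :|: B) - X * (lam A * lam B * g (A :|: B)) =
   (lam A * lam B) * (S (A :|: B) - X * g (A :|: B)) by ring.
rewrite !normrM; apply: ler_pM => //; first by rewrite mulr_ge0.
  have h A' : A' \subset P -> `|lam A'| <= B0 * 2 ^+ #|A'|.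
    move=> A'P; apply: le_trans (hlam A' A'P) _; rewrite ler_piMr ?mulr_ge0 ?exprn_ge0 //.
    by rewrite -[leRHS]/(1%:R) ler_nat leq_b1.
  have c A' : A' \subset A :|: B -> 2 ^+ #|A'| <= 2 ^+ #|A :|: B| :> R.
    by move=> sA; rewrite ler_weXn2l ?ler1n //; apply: subset_leq_card.
  apply: (@le_trans _ _ ((B0 * 2 ^+ #|A|) * (B0 * 2 ^+ #|B|))).
    by apply: ler_pM => //; apply: h.
  have -> : 4 ^+ #|A :|: B| = 2 ^+ #|A :|: B| * 2 ^+ #|A :|: B| :> R.
    by rewrite -exprMn; congr (_ ^+ _); ring.
  have -> : B0 * 2 ^+ #|A| * (B0 * 2 ^+ #|B|) = B0 ^+ 2 * (2 ^+ #|A| * 2 ^+ #|B|) :> R by ring.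
  apply: ler_wpM2l; first by rewrite exprn_ge0.
  by apply: ler_pM; rewrite ?exprn_ge0 ?c ?subsetUl ?subsetUr.
exact: hS.
Qed.

Lemma sel_bound (f h : 'I_M -> R) (y : {set 'I_M} -> R) (Y L : R) A :
  {in P, forall p, 0 <= h p} -> {in P, forall p, 0 <= f p * h p <= 2} ->
  0 <= Y -> (forall u, u \subset P -> 0 <= y u <= Y * (\sum_(p in u) lns p <= L)%R%:R) ->
  A \subset P ->
  `|sel f h P y A| <= Y * msum h (@lns M) P L * 2 ^+ #|A| * (\sum_(p in A) lns p <= L)%R%:R.
Proof.
move=> h0 fh Y0 hy AP; rewrite /sel AP.
have s0 (B : {set 'I_M}) : 0 <= \sum_(p in B) lns p by apply: sumr_ge0 => p _; apply: lns_ge0.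
have m0 : 0 <= msum h (@lns M) P L by apply: msum_ge0 => // p _; apply: lns_ge0.
rewrite sum_powerset_above //.
set S := \sum_(v in _) _.
have S0 : 0 <= S.
  apply: sumr_ge0 => v; rewrite powersetE => vP.
  have uP : A :|: v \subset P by rewrite subUset AP (subset_trans vP) ?subsetDl.
  by have /andP[y0 _] := hy _ uP; rewrite mulr_ge0 //; apply: (prod_in_ge0 h0).
have hA0 : 0 <= \prod_(p in A) h p by apply: (prod_in_ge0 h0).
have S1 : S <= (\prod_(p in A) h p) * (Y * msum h (@lns M) P L * (\sum_(p in A) lns p <= L)%R%:R).
  rewrite /S /msum /wsum.
  have : (\sum_(v in powerset (P :\: A)) (\prod_(p in v) h p) * (\sum_(p in v) lns p <= L)%R%:R) <=
      \sum_(v in powerset P) (\prod_(p in v) h p) * (\sum_(p in v) lns p <= L)%R%:R.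
    apply: (wsum_subset_le (phi := fun t => (t <= L)%R%:R)) => //; exact: subsetDl.
  set w1 := \sum_(v in powerset (P :\: A)) _; set w2 := \sum_(v in powerset P) _ => w12.
  apply: (@le_trans _ _ ((\prod_(p in A) h p) * (Y * w1 * (\sum_(p in A) lns p <= L)%R%:R))); last first.
    by apply: ler_wpM2l => //; apply: ler_wpM2r => //; apply: ler_wpM2l.
  rewrite /w1 [Y * _]mulr_sumr mulr_suml mulr_sumr; apply: ler_sum => v; rewrite powersetE => vP.
  have uP : A :|: v \subset P by rewrite subUset AP (subset_trans vP) ?subsetDl.
  have dAv : [disjoint A & v] by move: vP; rewrite subsetD disjoint_sym => /andP[].
  have hv0 : 0 <= \prod_(p in v) h p by apply: (prod_in_ge0 h0); apply: subset_trans vP (subsetDl _ _).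
  rewrite prod_setU // mulrCA; apply: ler_wpM2l => //.
  have /andP[_ y1] := hy _ uP.
  have e : \sum_(p in A :|: v) lns p = \sum_(p in A) lns p + \sum_(p in v) lns p.
    by rewrite -bigU //=; apply: eq_bigl => p; rewrite !inE.
  rewrite e in y1.
  have := s0 A; have := s0 v; move: y1.
  set a := \sum_(p in A) _; set b := \sum_(p in v) _ => y1 b0 a0.
  have [h1|h1] := leP (a + b) L.
    have -> : (a <= L) by apply: le_trans h1; rewrite lerDl.
    have -> : (b <= L) by apply: le_trans h1; rewrite lerDr.
    rewrite !mulr1; apply: ler_wpM2r => //.
    by apply: le_trans y1 _; rewrite h1 mulr1.
  rewrite [_ <= L]leNgt h1 mulr0 in y1.
  apply: (@le_trans _ _ 0); last by rewrite !mulr_ge0.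
  exact: mulr_le0_ge0.
rewrite normrM (ger0_norm S0) normr_prod.
under eq_bigr do rewrite normrN.
apply: (@le_trans _ _ ((\prod_(p in A) `|f p|) * ((\prod_(p in A) h p) *
   (Y * msum h (@lns M) P L * (\sum_(p in A) lns p <= L)%R%:R)))).
  by apply: ler_wpM2l => //; apply: prodr_ge0.
have efh : (\prod_(p in A) `|f p|) * (\prod_(p in A) h p) = \prod_(p in A) (`|f p| * h p).
  by rewrite big_split.
rewrite [leLHS]mulrA efh.
have -> : Y * msum h (@lns M) P L * 2 ^+ #|A| * (\sum_(p in A) lns p <= L)%R%:R =
  2 ^+ #|A| * (Y * msum h (@lns M) P L * (\sum_(p in A) lns p <= L)%R%:R) by ring.
apply: ler_wpM2r; first by rewrite !mulr_ge0.
rewrite -prodr_const; apply: ler_prod => p pA.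
have pP := subsetP AP p pA; have /andP[fh0 fh2] := fh p pP.
have e : `|f p| * h p = f p * h p.
  by rewrite -{1}(ger0_norm (h0 p pP)) -normrM ger0_norm.
by rewrite e fh0.
Qed.

End QuadraticSieve.

Lemma bigRmax_ge0 (I : Type) (r : seq I) (Q : pred I) (f : I -> R) :
  0 <= \big[Rmax/0]_(i <- r | Q i) f i.
Proof.
elim: r => [|i r IH]; first by rewrite big_nil.
by rewrite big_cons; case: (Q i) => //; rewrite RmaxE le_max IH orbT.
Qed.

Lemma le_bigRmax (I : eqType) (r : seq I) (Q : pred I) (f : I -> R) i :
  i \in r -> Q i -> f i <= \big[Rmax/0]_(j <- r | Q j) f j.
Proof.
move=> + Qi; elim: r => // j r IH; rewrite inE big_cons => /orP[/eqP<-|ir].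
  by rewrite Qi RmaxE le_max lexx.
by case: (Q j); rewrite ?RmaxE ?le_max ?IH ?orbT.
Qed.

Lemma bigRmax_le (I : Type) (r : seq I) (Q : pred I) (f : I -> R) (c : R) :
  0 <= c -> (forall i, Q i -> f i <= c) -> \big[Rmax/0]_(i <- r | Q i) f i <= c.
Proof.
move=> c0 h; elim: r => [|i r IH]; first by rewrite big_nil.
by rewrite big_cons; case: ifP => // Qi; rewrite RmaxE ge_max h.
Qed.

Lemma prime_AP_errorE X q a :
  prime_AP_error X q a =
  \sum_(0 <= p < X.+1 | prime p && (p == a %[mod q])) lnn p - X%:R / (totient q)%:R.
Proof.
rewrite /prime_AP_error !INRE RdivE RminusE; congr (_ - _).
by rewrite big_mkord; apply: eq_bigr => p _; rewrite /lnn INRE.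
Qed.

Lemma liouville_AP_sumE X q a :
  liouville_AP_sum X q a = \sum_(1 <= m < X.+1 | m == a %[mod q]) liouville m.
Proof. by []. Qed.

Lemma norm_liouville m : `|liouville m| = 1.
Proof. by rewrite /liouville RpowE normrX RoppE normrN INRE normr1 expr1n. Qed.

Definition prime_AP_max X q : R :=
  \big[Rmax/0%R]_(a < q | coprime a q) Rabs (prime_AP_error X q a).
Definition liouville_AP_max X q : R :=
  \big[Rmax/0%R]_(y < X.+1) \big[Rmax/0%R]_(a < q) Rabs (liouville_AP_sum y q a).

Lemma prime_AP_max_ge0 X q : 0 <= prime_AP_max X q.
Proof. exact: bigRmax_ge0. Qed.

Lemma liouville_AP_max_ge0 X q : 0 <= liouville_AP_max X q.
Proof. exact: bigRmax_ge0. Qed.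

Lemma prime_AP_error_le X q a : (0 < q)%N -> coprime a q ->
  `|prime_AP_error X q a| <= prime_AP_max X q.
Proof.
move=> q0 aq; have h : (a %% q < q)%N by rewrite ltn_mod.
have -> : prime_AP_error X q a = prime_AP_error X q (Ordinal h).
  by rewrite !prime_AP_errorE /= modn_mod.
rewrite -RabsE; apply: (le_bigRmax (fun i : 'I_q => Rabs (prime_AP_error X q i))).
  by rewrite mem_index_enum.
by rewrite /= coprime_modl.
Qed.

Lemma liouville_AP_sum_le X y q a : (0 < q)%N -> (y <= X)%N ->
  `|liouville_AP_sum y q a| <= liouville_AP_max X q.
Proof.
move=> q0 yX; have h : (a %% q < q)%N by rewrite ltn_mod.
have -> : liouville_AP_sum y q a = liouville_AP_sum y q (Ordinal h).
  by rewrite !liouville_AP_sumE /= modn_mod.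
have h' : (y < X.+1)%N by [].
rewrite -RabsE.
apply: (@le_trans _ _ (\big[Rmax/0]_(a < q) Rabs (liouville_AP_sum y q a))).
  apply: (le_bigRmax (fun i : 'I_q => Rabs (liouville_AP_sum y q i))) => //.
  by rewrite mem_index_enum.
apply: (le_bigRmax (fun i : 'I_X.+1 => \big[Rmax/0]_(a < q) Rabs (liouville_AP_sum i q a)) (i := Ordinal h')) => //.
by rewrite mem_index_enum.
Qed.

Lemma count_progression_le X q a : (0 < q)%N -> (q <= X)%N ->
  \sum_(0 <= m < X.+1 | m == a %[mod q]) 1 <= 3 * X%:R / q%:R :> R.
Proof.
move=> q0 qX; have := count_progression 0 X.+1 a q0; rewrite add0n ler_norml => /andP[_].
have q0' : 0 < q%:R :> R by rewrite ltr0n.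
have h1 : 1 <= X%:R / q%:R :> R by rewrite ler_pdivlMr // mul1r ler_nat.
have h2 : X.+1%:R / q%:R <= 2 * (X%:R / q%:R) :> R.
  rewrite mulrA ler_pM2r ?invr_gt0 // -natrM ler_nat.
  have : (0 < X)%N by apply: leq_trans qX.
  lia.
rewrite -mulrA; lra.
Qed.

Lemma prime_AP_max_le X q : (0 < q)%N -> (q <= X)%N ->
  prime_AP_max X q <= 3 * X%:R / q%:R * lnn X + X%:R / (totient q)%:R.
Proof.
move=> q0 qX.
have c0 : 0 <= X%:R / (totient q)%:R :> R by rewrite divr_ge0.
have c1 : 0 <= 3 * X%:R / q%:R * lnn X by rewrite mulr_ge0 ?lnn_ge0 // divr_ge0 ?mulr_ge0.
apply: bigRmax_le; first by rewrite addr_ge0.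
move=> a _; rewrite RabsE prime_AP_errorE.
apply: le_trans (ler_normB _ _) _; rewrite (ger0_norm c0) lerD2r ger0_norm; last first.
  by apply: sumr_ge0 => p _; apply: lnn_ge0.
apply: (@le_trans _ _ (\sum_(0 <= m < X.+1 | m == a %[mod q]) 1 * lnn X)); last first.
  by rewrite -mulr_suml; apply: ler_wpM2r; [exact: lnn_ge0|exact: count_progression_le].
rewrite [leLHS]big_mkcond [leRHS]big_mkcond /= [leLHS]big_nat_cond [leRHS]big_nat_cond.
apply: ler_sum => p /andP[/andP[_ pX] _]; case pp : (prime p) => /=; last first.
  by case: ifP => // _; rewrite mul1r lnn_ge0.
case: ifP => // _; rewrite mul1r; apply: ler_lnn => //; exact: prime_gt0.
Qed.

Lemma liouville_AP_max_le X q : (0 < q)%N -> (q <= X)%N ->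
  liouville_AP_max X q <= 3 * X%:R / q%:R.
Proof.
move=> q0 qX; have c1 : 0 <= 3 * X%:R / q%:R :> R by rewrite divr_ge0 ?mulr_ge0.
apply: bigRmax_le => // y _; apply: bigRmax_le => // a _.
rewrite RabsE liouville_AP_sumE.
apply: le_trans (ler_norm_sum _ _ _) _.
apply: le_trans (count_progression_le a q0 qX).
have yX : (y.+1 <= X.+1)%N by [].
under eq_bigr do rewrite norm_liouville.
rewrite [leRHS]big_ltn_cond //=.
rewrite (big_nat_widen _ _ _ _ _ yX) big_mkcondr /=.
apply: (@le_trans _ _ (\sum_(1 <= m < X.+1 | m == a %[mod q]) 1)).
  by apply: ler_sum => m _; case: ifP.
by case: ifP => // _; rewrite lerDr.
Qed.

Section LocalSums.
Variables (D v0 M N : nat).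
Local Notation P := (prime_range M D).
Local Notation W := (primorial D).
Implicit Types (U : {set 'I_M}) (gs : seq nat) (psi : nat -> R).

Definition divset gs m : {set 'I_M} := [set p in P | has (fun h => p %| m + h)%N gs].

Definition dyadic := index_iota N.+1 (N.+1 + N).

Lemma class_sum gs U psi (X e : R) : uniq gs -> {in gs, forall h, (h <= D)%N} -> U \subset P ->
  (forall a, a = v0 %[mod W] -> {in U, forall p : 'I_M, has (fun h => p %| a + h)%N gs} ->
     `|\sum_(m <- dyadic | m == a %[mod W * setprod U]) psi m - X| <= e) ->
  `|\sum_(m <- dyadic | (m == v0 %[mod W]) && (U \subset divset gs m)) psi m -
      (size gs)%:R ^+ #|U| * X| <= (size gs)%:R ^+ #|U| * e.
Proof.
move=> ugs gD UP hX.
have hp : {in U, forall p : 'I_M, prime p} by move=> p /(subsetP UP)/prime_rangeP.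
have hc : {in U, forall p : 'I_M, coprime W p}.
  move=> p pU; apply/coprime_primorialP; first by rewrite prime_gt0 ?hp.
  move=> q pq; rewrite dvdn_prime2 ?hp // => /eqP ->.
  by have := subsetP UP p pU; rewrite inE => /andP[].
have hd : {in U, forall p : 'I_M, {in gs &, forall h h', h = h' %[mod p] -> h = h'}}.
  move=> p /(subsetP UP); rewrite inE => /andP[_ Dp] h h' hh hh'.
  by rewrite !modn_small // (leq_ltn_trans _ Dp) ?gD.
have [As [sA hA]] := residue_classes v0 ugs (primorial_gt0 D) hp hc hd.
have hA' m : count (fun a => m == a %[mod W * setprod U]) As =
    (m == v0 %[mod W]) && (U \subset divset gs m) :> nat.
  rewrite hA; congr (nat_of_bool (_ && _)); apply/forall_inP/subsetP => h p pU.
    by rewrite inE (subsetP UP) //= h.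
  by have := h p pU; rewrite inE => /andP[].
rewrite (sum_count_exchange _ _ hA').
have sAr : (size gs)%:R ^+ #|U| = (size As)%:R :> R by rewrite sA natrX.
have -> : (size gs)%:R ^+ #|U| * X = \sum_(a <- As) X.
  by rewrite sAr big_const_seq count_predT iter_addr_0 mulr_natl.
have -> : (size gs)%:R ^+ #|U| * e = \sum_(a <- As) e.
  by rewrite sAr big_const_seq count_predT iter_addr_0 mulr_natl.
rewrite -sumrB; apply: le_trans (ler_norm_sum _ _ _) _.
rewrite [leLHS]big_seq [leRHS]big_seq; apply: ler_sum => a aA.
have : (0 < count (fun b => a == b %[mod W * setprod U]) As)%N.
  by rewrite -has_count; apply/hasP; exists a.
rewrite hA lt0b => /andP[/eqP av /forall_inP ha].
exact: hX.
Qed.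

Variables (k : nat) (hs : seq nat).
Hypotheses (k1 : (1 < k)%N) (kD : (2 * k <= D)%N) (uhs : uniq hs) (shs : size hs = k).
Hypotheses (hsD : {in hs, forall h, (h <= D)%N}).
Hypotheses (hv0 : {in hs, forall h, coprime W (v0 + h)}) (MN : (M <= N.+1)%N).

Let W0 : 0 < W%:R :> R. Proof. by rewrite ltr0n primorial_gt0. Qed.

Lemma setprod_natr_neq0 U : U \subset P -> (setprod U)%:R != 0 :> R.
Proof.
move=> UP; rewrite pnatr_eq0 -lt0n; apply: setprod_gt0 => p /(subsetP UP).
exact: prime_rangeP.
Qed.

Lemma count_sum U : U \subset P ->
  `|\sum_(m <- dyadic | (m == v0 %[mod W]) && (U \subset divset hs m)) 1 -
     N%:R / W%:R * \prod_(p in U) sg k p| <= k%:R ^+ #|U|.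
Proof.
move=> UP; have q0 : (0 < W * setprod U)%N.
  by rewrite muln_gt0 primorial_gt0 lt0n -(pnatr_eq0 R) setprod_natr_neq0.
have := class_sum (psi := fun=> 1) (X := N%:R / (W * setprod U)%:R) (e := 1) uhs hsD UP.
rewrite shs mulr1.
have -> : k%:R ^+ #|U| * (N%:R / (W * setprod U)%:R) = N%:R / W%:R * \prod_(p in U) sg k p.
  rewrite /sg big_split /= prodr_const prodfV -natr_setprod natrM invfM.
  ring.
by apply=> a _ _; apply: count_progression.
Qed.

Lemma count_sum_shift U p0 : p0 |: U \subset P -> p0 \notin U ->
  `|\sum_(m <- dyadic | (m == v0 %[mod W]) && (p0 \in divset hs m) && (U \subset divset hs m)) 1 -
     N%:R / W%:R * sg k p0 * \prod_(p in U) sg k p| <= k%:R ^+ #|U|.+1.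
Proof.
move=> UP p0U; have := count_sum UP; rewrite big_setU1 //= cardsU1 p0U mulrA.
by under eq_bigl do rewrite subUset sub1set andbA.
Qed.

Lemma sum_dyadic_shift (f : nat -> R) h q a :
  \sum_(m <- dyadic | m == a %[mod q]) f (m + h)%N =
  \sum_((N + h).+1 <= m < (N + N + h).+1 | m == a + h %[mod q]) f m.
Proof.
have -> : (N + N + h).+1 = (N.+1 + N + h)%N by lia.
rewrite -addSn big_addn addnK; apply: eq_bigl => m.
by rewrite eqn_modDr.
Qed.

Lemma liouville_class_sum U h : U \subset P -> h \in hs ->
  `|\sum_(m <- dyadic | (m == v0 %[mod W]) && (U \subset divset hs m)) liouville (m + h)| <=
    k%:R ^+ #|U| * (2 * liouville_AP_max (N + N + h) (W * setprod U)).
Proof.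
move=> UP hh; have q0 : (0 < W * setprod U)%N.
  by rewrite muln_gt0 primorial_gt0 lt0n -(pnatr_eq0 R) setprod_natr_neq0.
set q := (W * setprod U)%N in q0 *.
have := class_sum (psi := fun m => liouville (m + h)) (X := 0)
  (e := 2 * liouville_AP_max (N + N + h) q) uhs hsD UP.
rewrite shs mulr0 subr0; apply=> a _ _; rewrite subr0 -/q.
rewrite (sum_dyadic_shift liouville).
have -> : \sum_((N + h).+1 <= m < (N + N + h).+1 | m == a + h %[mod q]) liouville m =
    liouville_AP_sum (N + N + h) q (a + h) - liouville_AP_sum (N + h) q (a + h).
  rewrite !liouville_AP_sumE [X in X - _](big_cat_nat (n := (N + h).+1)) //=; last lia.
  by rewrite addrAC subrr add0r.
apply: le_trans (ler_normB _ _) _.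
have h1 := @liouville_AP_sum_le (N + N + h) (N + N + h) q (a + h) q0 (leqnn _).
have h2 := @liouville_AP_sum_le (N + N + h) (N + h) q (a + h) q0 ltac:(lia).
by rewrite mulr_natl mulr2n; apply: lerD.
Qed.

Lemma prime_class_sum U h : U \subset P -> h \in hs ->
  `|\sum_(m <- dyadic | (m == v0 %[mod W]) && (U \subset divset hs m))
       (if prime (m + h) then lnn (m + h) else 0) -
     N%:R / (totient W)%:R * \prod_(p in U) sg' k p| <=
    k%:R ^+ #|U| * (prime_AP_max (N + N + h) (W * setprod U) + prime_AP_max (N + h) (W * setprod U)).
Proof.
move=> UP hh; have q0 : (0 < W * setprod U)%N.
  by rewrite muln_gt0 primorial_gt0 lt0n -(pnatr_eq0 R) setprod_natr_neq0.
set q := (W * setprod U)%N in q0 *.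
pose gs := rem h hs.
have ugs : uniq gs by apply: rem_uniq.
have gsub g : g \in gs -> g \in hs by apply: mem_rem.
have sgs : size gs = k.-1 by rewrite size_rem // shs.
set psi := fun m : nat => if prime (m + h) then lnn (m + h) else 0.
set Er := prime_AP_max _ _ + prime_AP_max _ _.
have Er0 : 0 <= Er by apply: addr_ge0; apply: prime_AP_max_ge0.
have -> : \sum_(m <- dyadic | (m == v0 %[mod W]) && (U \subset divset hs m)) psi m =
   \sum_(m <- dyadic | (m == v0 %[mod W]) && (U \subset divset gs m)) psi m.
  rewrite big_mkcond [RHS]big_mkcond /= big_seq [RHS]big_seq; apply: eq_bigr => m.
  rewrite mem_index_iota => /andP[Nm _]; rewrite /psi.
  case pmh : (prime (m + h)); last by case: ifP; case: ifP.
  suff -> : divset hs m = divset gs m by [].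
  apply/setP => p; rewrite !inE.
  case: (boolP (prime p && (D < p)%N)) => //= /andP[pp _].
  have pm : (p %| m + h)%N = false.
    apply/negP; rewrite dvdn_prime2 // => /eqP e.
    by have := ltn_ord p; rewrite e ltnNge (leq_trans MN) // (leq_trans Nm) // leq_addr.
  by rewrite (perm_has _ (perm_to_rem hh)) /= pm.
have bound a : a = v0 %[mod W] -> {in U, forall p : 'I_M, has (fun g => p %| a + g)%N gs} ->
    `|\sum_(m <- dyadic | m == a %[mod q]) psi m - N%:R / (totient q)%:R| <= Er.
  move=> av ha.
  have cq : coprime (a + h) q.
    rewrite coprime_sym coprimeMl; apply/andP; split.
      rewrite -coprime_modr -modnDml av modnDml coprime_modr; exact: hv0.
    rewrite /setprod; elim/big_rec: _ => [|p x pU cx]; first exact: coprime1n.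
    have pP := subsetP UP p pU; have pp := prime_rangeP pP.
    rewrite coprimeMl cx andbT prime_coprime //; apply/negP => ph.
    have /hasP[g gg pg] := ha p pU.
    have : g == h %[mod p] by rewrite -(eqn_modDl a) (eqP pg) (eqP ph).
    move: pP; rewrite inE => /andP[_ Dp].
    have gp : (g < p)%N by apply: leq_ltn_trans Dp; apply/hsD/gsub.
    have hp : (h < p)%N by apply: leq_ltn_trans Dp; apply: hsD.
    rewrite !modn_small // => /eqP e.
    by move: gg; rewrite e /gs mem_rem_uniq // inE eqxx.
  rewrite (sum_dyadic_shift (fun m => if prime m then lnn m else 0)).
  have -> : \sum_((N + h).+1 <= m < (N + N + h).+1 | m == a + h %[mod q]) (if prime m then lnn m else 0) =
    prime_AP_error (N + N + h) q (a + h) - prime_AP_error (N + h) q (a + h) + N%:R / (totient q)%:R.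
    rewrite !prime_AP_errorE.
    rewrite [X in _ = X - _ - _ + _](big_cat_nat (n := (N + h).+1)) //=; last lia.
    have -> : (N + N + h)%:R / (totient q)%:R = N%:R / (totient q)%:R + (N + h)%:R / (totient q)%:R :> R.
      by rewrite -mulrDl -natrD addnA.
    rewrite -big_mkcondr /=; under eq_bigl do rewrite andbC.
    ring.
  rewrite addrK; apply: le_trans (ler_normB _ _) _.
  by apply: lerD; apply: prime_AP_error_le.
have := class_sum (psi := psi) ugs (fun g gg => hsD (gsub g gg)) UP bound.
rewrite sgs => hc.
have -> : N%:R / (totient W)%:R * \prod_(p in U) sg' k p = k.-1%:R ^+ #|U| * (N%:R / (totient q)%:R).
  have -> : (totient q)%:R = (totient W)%:R * \prod_(p in U) (p%:R - 1) :> R.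
    rewrite /q; have : {subset U <= P} by apply/subsetP.
    elim/finset_ind: {+}U => [|p A pA IH] hA; first by rewrite /setprod !big_set0 muln1 mulr1.
    have pP : p \in P by apply: hA; rewrite setU11.
    have hAP : {subset A <= P} by move=> x xA; apply: hA; rewrite inE xA orbT.
    have pp := prime_rangeP pP.
    rewrite setprodU1 // big_setU1 //= mulnCA totient_coprime; last first.
      rewrite prime_coprime // Euclid_dvdM // dvdn_primorial // mem_setprod //; last first.
        by move=> x /hAP/prime_rangeP.
      by rewrite negb_or pA andbT -ltnNge; move: pP; rewrite inE => /andP[].
    rewrite natrM IH // totient_prime // mulrCA; congr (_ * _).
    by rewrite -[in RHS](prednK (prime_gt0 pp)) -natr1 addrK.
  have e1 : k%:R - 1 = k.-1%:R :> R by rewrite -[in LHS](prednK (ltnW k1)) -natr1 addrK.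
  rewrite /sg' big_split /= prodr_const prodfV e1 invfM; ring.
apply: le_trans hc _; apply: ler_wpM2r => //.
by apply: lerXn2r; rewrite ?nnegrE // ler_nat leq_pred.
Qed.

End LocalSums.

(** * Sieve sums *)

Section SieveSums.
Variables (D v0 M N k : nat) (hs : seq nat).
Local Notation P := (prime_range M D).
Local Notation W := (primorial D).
Hypotheses (k1 : (1 < k)%N) (kD : (2 * k <= D)%N) (uhs : uniq hs) (shs : size hs = k).
Hypotheses (hsD : {in hs, forall h, (h <= D)%N}).
Hypotheses (hv0 : {in hs, forall h, coprime W (v0 + h)}) (MN : (M <= N.+1)%N).
Hypothesis (DM : (D < M)%N).
Variables (L : R) (L0 : 0 <= L) (LM : (Num.truncn (exp L) < M)%N).
Variables (n : nat) (F : nat -> R) (del : R).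
Hypotheses (F_dec : forall i, F i.+1 <= F i) (Fn0 : F n = 0) (del0 : 0 <= del)
  (ndel : n%:R * del = L).
Implicit Types (A B U u : {set 'I_M}) (p : 'I_M) (psi : nat -> R).

Definition weight A : R := sel (sf k) (sh k) P (yv n F del) A.
Definition sieve m : R := (\sum_(A in powerset P | A \subset divset D M hs m) weight A) ^+ 2.
Definition B0 : R := F 0%N * msum (sh k) (@lns M) P L.
(* [16 = 4 * 4]: at most [3 ^ #|U|] pairs [(A, B)] have union [U], and the weights of such a pair
   contribute at most [4 ^ #|U|]. *)
Definition errsum (Er : {set 'I_M} -> R) : R :=
  \sum_(U in powerset P | \sum_(p in U) lns p <= 2 * L) 16 ^+ #|U| * Er U.

Let F0 : 0 <= F 0%N.
Proof. exact: le_trans (yv_ge0 n del F_dec (set0 : {set 'I_M})) (yv_le del F_dec Fn0 _). Qed.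

Let lns0 (A : {set 'I_M}) : {in A, forall p, 0 <= lns p}.
Proof. by move=> p _; apply: lns_ge0. Qed.

Lemma B0_ge0 : 0 <= B0.
Proof. by rewrite mulr_ge0 // msum_ge0 //; apply: sh_ge0. Qed.

Lemma sieve_ge0 m : 0 <= sieve m.
Proof. exact: sqr_ge0. Qed.

Lemma weight_bound A : A \subset P ->
  `|weight A| <= B0 * 2 ^+ #|A| * (\sum_(p in A) lns p <= L)%R%:R.
Proof.
move=> AP; apply: sel_bound => //; first exact: sh_ge0 k1 kD.
  exact: sfh_le2.
move=> u uP; rewrite (yv_ge0 _ _ F_dec) /=; have [h|h] := leP (\sum_(p in u) lns p) L.
  by rewrite mulr1 (yv_le _ F_dec).
by rewrite mulr0 (yv_eq0 F del0 ndel).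
Qed.

Lemma sieve_sum psi (g : 'I_M -> R) (X : R) (Er : {set 'I_M} -> R) :
  (forall U, 0 <= Er U) ->
  (forall U, U \subset P ->
    `|\sum_(m <- dyadic N | (m == v0 %[mod W]) && (U \subset divset D M hs m)) psi m -
      X * \prod_(p in U) g p| <= Er U) ->
  `|\sum_(m <- dyadic N | m == v0 %[mod W]) psi m * sieve m -
    X * \sum_(A in powerset P) \sum_(B in powerset P) weight A * weight B * \prod_(p in A :|: B) g p| <=
  B0 ^+ 2 * errsum Er.
Proof.
move=> Er0 hS.
have -> : \sum_(m <- dyadic N | m == v0 %[mod W]) psi m * sieve m =
   \sum_(m <- dyadic N) (if m == v0 %[mod W] then psi m else 0) * sieve m.
  by rewrite big_mkcond; apply: eq_bigr => m _; case: ifP; rewrite ?mul0r.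
rewrite sieve_expand.
apply: (sieve_error (S := fun U => \sum_(m <- dyadic N | U \subset divset D M hs m)
    (if m == v0 %[mod W] then psi m else 0)) (g := fun U => \prod_(p in U) g p)) => //.
- exact: B0_ge0.
- exact: weight_bound.
move=> A B AP BP _ _; have UP : A :|: B \subset P by rewrite subUset AP.
by rewrite -big_mkcondr /=; under eq_bigl do rewrite andbC; apply: hS.
Qed.

Lemma sieve_total_le :
  \sum_(m <- dyadic N | m == v0 %[mod W]) sieve m <=
  N%:R / W%:R * (\sum_(r in powerset P) (\prod_(p in r) sh k p) * yv n F del r ^+ 2) +
  B0 ^+ 2 * errsum (fun U => k%:R ^+ #|U|).
Proof.
have Er0 U : 0 <= k%:R ^+ #|U| :> R by rewrite exprn_ge0.
have := sieve_sum (psi := fun=> 1) Er0 (count_sum v0 N uhs shs hsD).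
rewrite /weight (sel_quadratic_dual _ (sg_neq0 k1 kD) (sfg k1 kD) (shf k1 kD)).
under eq_bigr do rewrite mul1r.
by rewrite ler_norml => /andP[_]; rewrite lerBlDl.
Qed.

Lemma sieve_prime_ge h : h \in hs ->
  N%:R / (totient W)%:R * (\sum_(r in powerset P)
    (\prod_(p in r) (((sg' k p)^-1 - 1) * (sf k p * sg' k p * sh k p) ^+ 2)) *
    (\sum_(v in powerset (P :\: r)) yv n F del (r :|: v) *
       \prod_(p in v) (sh k p * (1 - sf k p * sg' k p))) ^+ 2) -
  B0 ^+ 2 * errsum (fun U => k%:R ^+ #|U| *
     (prime_AP_max (N + N + h) (W * setprod U) + prime_AP_max (N + h) (W * setprod U))) <=
  \sum_(m <- dyadic N | m == v0 %[mod W]) (if prime (m + h) then lnn (m + h) else 0) * sieve m.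
Proof.
move=> hh.
have Er0 U : 0 <= k%:R ^+ #|U| *
     (prime_AP_max (N + N + h) (W * setprod U) + prime_AP_max (N + h) (W * setprod U)).
  by rewrite mulr_ge0 ?exprn_ge0 // addr_ge0 // prime_AP_max_ge0.
have := sieve_sum Er0 (fun U UP => prime_class_sum k1 kD uhs shs hsD hv0 MN UP hh).
rewrite /weight (sel_quadratic _ _ _ (sg'_neq0 k1 kD)).
by rewrite ler_norml => /andP[]; rewrite lerBrDl.
Qed.

Lemma sieve_liouville_le h : h \in hs ->
  `|\sum_(m <- dyadic N | m == v0 %[mod W]) liouville (m + h) * sieve m| <=
  B0 ^+ 2 * errsum (fun U => k%:R ^+ #|U| * (2 * liouville_AP_max (N + N + h) (W * setprod U))).
Proof.
move=> hh.
have Er0 U : 0 <= k%:R ^+ #|U| * (2 * liouville_AP_max (N + N + h) (W * setprod U)).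
  by rewrite !mulr_ge0 ?exprn_ge0 // liouville_AP_max_ge0.
have := sieve_sum (psi := fun m => liouville (m + h)) (g := fun=> 0) (X := 0) Er0.
rewrite mul0r subr0; apply=> U UP; rewrite mul0r subr0.
exact: (liouville_class_sum v0 k1 kD uhs shs hsD).
Qed.

Lemma divset_sub gs m : divset D M gs m \subset P.
Proof. by apply/subsetP => p; rewrite inE => /andP[]. Qed.

Lemma sieve_small_le p0 : p0 \in P ->
  \sum_(m <- dyadic N | (m == v0 %[mod W]) && (p0 \in divset D M hs m)) sieve m <=
  N%:R / W%:R * sg k p0 * (\sum_(r in powerset (P :\ p0)) (\prod_(p in r) sh k p) *
     (yv n F del r - yv n F del (p0 |: r)) ^+ 2) +
  B0 ^+ 2 * errsum (fun U => k%:R ^+ #|U|.+1).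
Proof.
move=> p0P; pose P' := P :\ p0.
have sP : P' \subset P by apply: subsetDl.
pose y' u := yv n F del u - yv n F del (p0 |: u).
pose lam' := sel (sf k) (sh k) P' y'.
have p0P' : p0 \notin P' by rewrite !inE eqxx.
have lam'0 A : ~~ (A \subset P') -> lam' A = 0 by rewrite /lam' /sel => /negbTE ->.
have sieveE m : p0 \in divset D M hs m ->
    sieve m = (\sum_(A in powerset P | A \subset divset D M hs m) lam' A) ^+ 2.
  move=> p0D; congr (_ ^+ 2); have DP := divset_sub hs m.
  have e (f : {set 'I_M} -> R) : \sum_(A in powerset P | A \subset divset D M hs m) f A =
      \sum_(A in powerset (p0 |: (divset D M hs m :\ p0))) f A.
    rewrite setD1K //; apply: eq_bigl => A; rewrite !powersetE.
    by case AD : (A \subset divset D M hs m); rewrite ?andbF // (subset_trans AD).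
  have p0D' : p0 \notin divset D M hs m :\ p0 by rewrite !inE eqxx.
  rewrite !e !sum_powersetU1 // -big_split /= -big_split /=.
  apply: eq_bigr => A; rewrite powersetE => AD.
  have p0A : p0 \notin A by apply: contra p0D'; apply: subsetP.
  rewrite [lam' (p0 |: A)]lam'0 ?addr0; last first.
    by apply: contra p0P' => /subsetP; apply; rewrite setU11.
  by rewrite /weight sel_shift // (shf k1 kD).
have -> : \sum_(m <- dyadic N | (m == v0 %[mod W]) && (p0 \in divset D M hs m)) sieve m =
    \sum_(m <- dyadic N) (if (m == v0 %[mod W]) && (p0 \in divset D M hs m) then 1 else 0) *
      (\sum_(A in powerset P | A \subset divset D M hs m) lam' A) ^+ 2.
  rewrite big_mkcond; apply: eq_bigr => m _; case: ifP => [/andP[_ h]|_]; last by rewrite mul0r.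
  by rewrite mul1r sieveE.
rewrite sieve_expand.
pose S U := \sum_(m <- dyadic N | U \subset divset D M hs m)
    (if (m == v0 %[mod W]) && (p0 \in divset D M hs m) then 1 else 0) : R.
have Er0 U : 0 <= k%:R ^+ #|U|.+1 :> R by rewrite exprn_ge0.
have yb u : u \subset P' -> 0 <= y' u <= F 0%N * (\sum_(p in u) lns p <= L)%R%:R.
  move=> uP'; have p0u : p0 \notin u by apply: contra p0P'; apply: subsetP.
  have le1 : yv n F del (p0 |: u) <= yv n F del u.
    rewrite /yv big_setU1 //=; apply: ler_sum => i _.
    apply: ler_wpM2l; first by rewrite subr_ge0.
    rewrite ler_nat; case: leP => //= h; rewrite (le_trans _ h) // lerDr.
    exact: lns_ge0.
  have y0 := yv_ge0 n del F_dec (p0 |: u).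
  rewrite /y' subr_ge0 le1 /=.
  have le2 : yv n F del u <= F 0%N * (\sum_(p in u) lns p <= L)%R%:R.
    have [h|h] := leP (\sum_(p in u) lns p) L; first by rewrite mulr1 (yv_le _ F_dec).
    by rewrite mulr0 (yv_eq0 F del0 ndel).
  by apply: le_trans le2; rewrite gerBl.
have lb A : A \subset P -> `|lam' A| <= B0 * 2 ^+ #|A| * (\sum_(p in A) lns p <= L)%R%:R.
  move=> AP; have [AP'|AP'] := boolP (A \subset P'); last first.
    rewrite lam'0 // normr0; apply: mulr_ge0 => //.
    by apply: mulr_ge0; [exact: B0_ge0|rewrite exprn_ge0].
  have hsub : {in P', forall p, p \in P} by apply/subsetP.
  have h0 : {in P', forall p, 0 <= sh k p} by move=> p /hsub; apply: sh_ge0 k1 kD p.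
  have h2 : {in P', forall p, 0 <= sf k p * sh k p <= 2} by move=> p /hsub; apply: sfh_le2 k1 kD p.
  apply: le_trans (sel_bound h0 h2 F0 yb AP') _.
  apply: ler_wpM2r => //; apply: ler_wpM2r; first by rewrite exprn_ge0.
  apply: ler_wpM2l => //.
  apply: (wsum_subset_le (phi := fun t => (t <= L)%R%:R)) => //; exact: sh_ge0 k1 kD.
have := @sieve_error M P lam' (fun U => \prod_(p in U) sg k p) _ S
  (N%:R / W%:R * sg k p0) B0 L (lns0 (A := P)) B0_ge0 lb Er0.
have -> : \sum_(A in powerset P) \sum_(B in powerset P) lam' A * lam' B * \prod_(p in A :|: B) sg k p =
   \sum_(r in powerset P') (\prod_(p in r) sh k p) * y' r ^+ 2.
  have hsub : {in P', forall p, p \in P} by apply/subsetP.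
  rewrite -(@sel_quadratic_dual _ _ (sf k) (sh k) (sg k)); last first.
  - by move=> p /hsub; apply: shf k1 kD p.
  - by move=> p /hsub; apply: sfg k1 kD p.
  - by move=> p /hsub; apply: sg_neq0 k1 kD p.
  have hP (f : {set 'I_M} -> R) : (forall A, ~~ (A \subset P') -> f A = 0) ->
      \sum_(A in powerset P) f A = \sum_(A in powerset P') f A.
    move=> f0; rewrite (bigID (fun A => A \subset P')) /= [X in _ + X]big1 ?addr0.
      apply: eq_bigl => A; rewrite !powersetE.
      by case AP' : (A \subset P'); rewrite ?andbF // (subset_trans AP').
    by move=> A /andP[_ /f0].
  rewrite hP; last by move=> A nA; rewrite big1 // => B _; rewrite lam'0 // !mul0r.
  apply: eq_bigr => A _; rewrite hP // => B nB.
  by rewrite [lam' B]lam'0 // mulr0 mul0r.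
move=> h; have {}h := h _; rewrite ler_norml in h.
suff hS : forall A B, A \subset P -> B \subset P -> lam' A != 0 -> lam' B != 0 ->
   `|S (A :|: B) - N%:R / W%:R * sg k p0 * \prod_(p in A :|: B) sg k p| <= k%:R ^+ #|A :|: B|.+1.
  by have /andP[_] := h hS; rewrite lerBlDl.
move=> A B AP BP lA lB.
have AP' : A \subset P' by apply: contraNT lA => /lam'0 ->.
have BP' : B \subset P' by apply: contraNT lB => /lam'0 ->.
have UP' : A :|: B \subset P' by rewrite subUset AP'.
have p0U : p0 \notin A :|: B by apply: contra p0P'; apply: subsetP.
have UP : p0 |: (A :|: B) \subset P by rewrite subUset sub1set p0P (subset_trans UP').
have := count_sum_shift v0 N uhs shs hsD UP p0U.
by rewrite /S -big_mkcondr /=; under eq_bigl do rewrite andbC.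
Qed.

Definition good_at (z : R) m := exists h h', [/\ h \in hs, h' \in hs, h != h',
  prime (m + h) & liouville (m + h') = -1 /\
  (forall p, p \in P -> lns p <= z -> p \notin divset D M hs m)].

Lemma liouvilleE m : liouville m = (-1) ^+ bigOmega m.
Proof. by rewrite /liouville RpowE RoppE INRE. Qed.

Lemma liouville_prime (q : nat) : prime q -> liouville q = -1.
Proof.
move=> pp; rewrite liouvilleE /bigOmega (primes_prime pp) big_seq1.
by rewrite logn_prime // eqxx expr1.
Qed.

Lemma liouville_cases m : liouville m = 1 \/ liouville m = -1.
Proof. by rewrite liouvilleE -signr_odd; case: (odd _); [right|left]. Qed.

(* A prime shift has Liouville value -1.  So when [m] is not good and no small prime divides any
   shift, a prime shift is the only one with Liouville value -1, and the left side is at most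
   [(k - 1) + 1 - k]; without prime shifts it is at most [k - k]. *)
Lemma pigeonhole (z : R) m : ~ good_at z m ->
  (k%:R - 1) * \sum_(h <- hs) (prime (m + h))%:R + \sum_(h <- hs) (1 - liouville (m + h)) / 2 - k%:R <=
  k%:R ^+ 2 * \sum_(p in P | lns p <= z) (p \in divset D M hs m)%:R.
Proof.
move=> ng.
have k0 : 1 < k%:R :> R by rewrite ltr1n.
have sum1 : \sum_(h <- hs) 1 = k%:R :> R by rewrite big_const_seq count_predT iter_addr_0 shs.
have odd_le h : (1 - liouville (m + h)) / 2 <= 1.
  by case: (liouville_cases (m + h)) => ->; lra.
have sodd : \sum_(h <- hs) (1 - liouville (m + h)) / 2 <= k%:R.
  by rewrite -sum1; apply: ler_sum => h _.
have [/existsP[p /and3P[pP pz pD]]|nex] :=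
    boolP [exists p : 'I_M, [&& p \in P, lns p <= z & p \in divset D M hs m]].
  have h1 : 1 <= \sum_(p in P | lns p <= z) (p \in divset D M hs m)%:R :> R.
    by rewrite (bigD1 p) ?pP //= pD lerDl sumr_ge0.
  have h2 : \sum_(h <- hs) (prime (m + h))%:R <= k%:R :> R.
    by rewrite -sum1; apply: ler_sum => h _; rewrite -[leRHS]/(1%:R) ler_nat leq_b1.
  have h3 : (k%:R - 1) * \sum_(h <- hs) (prime (m + h))%:R <= (k%:R - 1) * k%:R :> R.
    by apply: ler_wpM2l => //; rewrite subr_ge0 ltW.
  have h4 : k%:R ^+ 2 <= k%:R ^+ 2 * \sum_(p in P | lns p <= z) (p \in divset D M hs m)%:R :> R.
    by rewrite ler_peMr ?exprn_ge0.
  have h5 : (k%:R - 1) * k%:R <= k%:R ^+ 2 :> R by rewrite expr2; lra.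
  lra.
have -> : \sum_(p in P | lns p <= z) (p \in divset D M hs m)%:R = 0 :> R.
  rewrite big1 // => p /andP[pP pz]; case pD : (p \in _) => //.
  by case/negP: nex; apply/existsP; exists p; rewrite pP pz pD.
rewrite mulr0.
have [/hasP[h hh ph]|nh] := boolP (has (fun h => prime (m + h)) hs); last first.
  rewrite big1_seq ?mulr0 ?add0r ?subr_le0 // => h /= hh.
  by case ph : (prime (m + h)) => //; case/negP: nh; apply/hasP; exists h.
have nz p : p \in P -> lns p <= z -> p \notin divset D M hs m.
  by move=> pP pz; apply/negP => pD; case/negP: nex; apply/existsP; exists p; rewrite pP pz pD.
have other h' : h' \in hs -> h != h' -> liouville (m + h') = 1.
  move=> hh' ne; have [//|e] := liouville_cases (m + h').
  by case: ng; exists h, h'; split.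
have np h' : h' \in hs -> h != h' -> prime (m + h') = false.
  move=> hh' ne; apply/negP => pmh'; have := liouville_prime pmh'.
  by rewrite other // => e; have : (1 : R) = -1 := e; lra.
have lh : liouville (m + h) = -1 by apply: liouville_prime.
rewrite !(big_rem h hh) /= ph lh.
have hr' h' : h' \in rem h hs -> h != h'.
  by move=> hr; apply: contraTneq hr => <-; rewrite mem_rem_uniq // inE eqxx.
rewrite [\sum_(y <- rem h hs) (prime _)%:R]big1_seq; last first.
  by move=> h' /= hr; rewrite np ?hr' ?(mem_rem hr).
rewrite [\sum_(y <- rem h hs) _]big1_seq; last first.
  by move=> h' /= hr; rewrite other ?subrr ?mul0r ?hr' ?(mem_rem hr).
have -> : (true%:R : R) = 1 by [].
lra.
Qed.

Lemma sieve_conclusion (z : R) : (0 < N)%N ->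
  (forall m, (N < m)%N -> (m <= N + N)%N -> m = v0 %[mod W] -> ~ good_at z m) ->
  (k%:R - 1) * \sum_(h <- hs) (\sum_(m <- dyadic N | m == v0 %[mod W])
      (if prime (m + h) then lnn (m + h) else 0) * sieve m) <=
  lnn (N + N + D) *
   (k%:R / 2 * (\sum_(m <- dyadic N | m == v0 %[mod W]) sieve m) +
    (\sum_(h <- hs) `|\sum_(m <- dyadic N | m == v0 %[mod W]) liouville (m + h) * sieve m|) / 2 +
    k%:R ^+ 2 * \sum_(p in P | lns p <= z)
      \sum_(m <- dyadic N | (m == v0 %[mod W]) && (p \in divset D M hs m)) sieve m).
Proof.
move=> N0 ng; set lX := lnn _.
have k0 : 1 < k%:R :> R by rewrite ltr1n.
have lX0 : 0 < lX by apply: lnn_gt0; lia.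
have pw : \sum_(m <- dyadic N | m == v0 %[mod W]) (((k%:R - 1) *
     \sum_(h <- hs) (prime (m + h))%:R + \sum_(h <- hs) (1 - liouville (m + h)) / 2 - k%:R) * sieve m) <=
   \sum_(m <- dyadic N | m == v0 %[mod W])
     (k%:R ^+ 2 * \sum_(p in P | lns p <= z) (p \in divset D M hs m)%:R) * sieve m.
  rewrite big_seq_cond [leRHS]big_seq_cond; apply: ler_sum => m /andP[].
  rewrite mem_index_iota => /andP[Nm mN] /eqP mv; apply: ler_wpM2r; first exact: sieve_ge0.
  by apply: pigeonhole; apply: ng.
have eR : \sum_(m <- dyadic N | m == v0 %[mod W])
     (k%:R ^+ 2 * \sum_(p in P | lns p <= z) (p \in divset D M hs m)%:R) * sieve m =
   k%:R ^+ 2 * \sum_(p in P | lns p <= z)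
      \sum_(m <- dyadic N | (m == v0 %[mod W]) && (p \in divset D M hs m)) sieve m.
  rewrite [in RHS](eq_bigr (fun p => \sum_(m <- dyadic N | m == v0 %[mod W]) (p \in divset D M hs m)%:R * sieve m)).
    rewrite exchange_big /= mulr_sumr; apply: eq_bigr => m _.
    by rewrite -mulrA -mulr_suml.
  move=> p _; rewrite big_mkcondr; apply: eq_bigr => m _.
  by case: (p \in _); rewrite ?mul1r ?mul0r.
rewrite eR in pw.
set T := \sum_(m <- _ | _) sieve m; set S4 := k%:R ^+ 2 * _ in pw *.
pose S3 h := \sum_(m <- dyadic N | m == v0 %[mod W]) liouville (m + h) * sieve m.
pose S2 h := \sum_(m <- dyadic N | m == v0 %[mod W]) (prime (m + h))%:R * sieve m.
have eL : \sum_(m <- dyadic N | m == v0 %[mod W]) (((k%:R - 1) *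
     \sum_(h <- hs) (prime (m + h))%:R + \sum_(h <- hs) (1 - liouville (m + h)) / 2 - k%:R) * sieve m) =
   (k%:R - 1) * (\sum_(h <- hs) S2 h) + (k%:R * T - \sum_(h <- hs) S3 h) / 2 - k%:R * T.
  rewrite /T /S2 /S3 [\sum_(h <- hs) \sum_(m <- _ | _) (prime _)%:R * _]exchange_big /=.
  rewrite [\sum_(h <- hs) \sum_(m <- _ | _) liouville _ * _]exchange_big /=.
  rewrite !mulr_sumr -sumrB mulr_suml -big_split -sumrB /=; apply: eq_bigr => m _.
  rewrite -!mulr_suml sumrB big_const_seq count_predT iter_addr_0 shs; ring.
rewrite eL in pw.
have h3 : \sum_(h <- hs) S3 h <= \sum_(h <- hs) `|S3 h| by apply: ler_sum => h _; apply: ler_norm.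
have h2 : \sum_(h <- hs) \sum_(m <- dyadic N | m == v0 %[mod W])
    (if prime (m + h) then lnn (m + h) else 0) * sieve m <= lX * \sum_(h <- hs) S2 h.
  rewrite mulr_sumr big_seq [leRHS]big_seq; apply: ler_sum => h hh; rewrite /S2 mulr_sumr.
  rewrite big_seq_cond [leRHS]big_seq_cond; apply: ler_sum => m /andP[].
  rewrite mem_index_iota => /andP[Nm mN] _; rewrite mulrA; apply: ler_wpM2r; first exact: sieve_ge0.
  case ph : (prime (m + h)); rewrite ?mulr1 ?mulr0 //; apply: ler_lnn; first exact: prime_gt0.
  have := hsD hh; lia.
have h4 : (k%:R - 1) * \sum_(h <- hs) \sum_(m <- dyadic N | m == v0 %[mod W])
    (if prime (m + h) then lnn (m + h) else 0) * sieve m <= (k%:R - 1) * (lX * \sum_(h <- hs) S2 h).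
  by apply: ler_wpM2l => //; rewrite subr_ge0 ltW.
apply: le_trans h4 _; rewrite mulrCA; apply: ler_wpM2l; first exact: ltW.
rewrite -/S4; move: pw h3; rewrite /S3.
lra.
Qed.

End SieveSums.

Lemma expR_expn (x : R) m : exp (m%:R * x) = exp x ^+ m.
Proof.
elim: m => [|m IH]; first by rewrite mul0r expr0; apply: exp_0.
by rewrite -natr1 mulrDl mul1r expR_add IH exprSr.
Qed.

Lemma expR_ge1Dx (x : R) : 1 + x <= exp x.
Proof. by apply/RleP/exp_ineq1_le. Qed.

Lemma poly_le_exp (K eta : R) m : 0 < eta ->
  exists2 u0 : R, 0 < u0 & forall u, u0 <= u -> K * u ^+ m <= exp (eta * u).
Proof.
move=> eta0; pose c : R := (eta / m.+1%:R) ^+ m.+1.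
have m0 : 0 < m.+1%:R :> R by rewrite ltr0n.
have c0 : 0 < c by rewrite exprn_gt0 // divr_gt0.
exists (Num.max 1 (K / c)); first by rewrite lt_max ltr01.
move=> u; rewrite ge_max => /andP[u1 uK].
have u0 : 0 < u := lt_le_trans ltr01 u1.
have -> : eta * u = m.+1%:R * (eta * u / m.+1%:R) by rewrite [RHS]mulrC divfK // gt_eqF.
rewrite expR_expn; apply: (@le_trans _ _ ((eta * u / m.+1%:R) ^+ m.+1)); last first.
  have h0 : 0 <= eta * u / m.+1%:R by rewrite divr_ge0 ?mulr_ge0 ?ltW.
  apply: lerXn2r; rewrite ?nnegrE //; first exact/ltW/expR_gt0.
  by apply: le_trans (expR_ge1Dx _); rewrite lerDr.
have -> : (eta * u / m.+1%:R) ^+ m.+1 = c * u * u ^+ m.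
  by rewrite /c mulrAC exprMn -mulrA -exprS.
apply: ler_wpM2r; first by rewrite exprn_ge0 // ltW.
by rewrite mulrC -ler_pdivrMr.
Qed.

Lemma totient_setprod_ge D M (U : {set 'I_M}) : U \subset prime_range M D ->
  (setprod U)%:R <= 2 ^+ #|U| * (totient (primorial D * setprod U))%:R :> R.
Proof.
elim/finset_ind: U => [|p U pU IH] UP.
  by rewrite /setprod big_set0 cards0 expr0 mul1r ler_nat totient_gt0 muln1 primorial_gt0.
have pP : p \in prime_range M D by apply: (subsetP UP); rewrite setU11.
have UP' : U \subset prime_range M D by apply: subset_trans UP; apply: subsetUr.
have pp := prime_rangeP pP.
rewrite setprodU1 // mulnCA totient_coprime; last first.
  rewrite prime_coprime // Euclid_dvdM // dvdn_primorial // mem_setprod //; last first.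
    by move=> x /(subsetP UP')/prime_rangeP.
  by rewrite negb_or pU andbT -ltnNge; move: pP; rewrite inE => /andP[].
rewrite totient_prime // cardsU1 pU exprS !natrM.
have -> : 2 * 2 ^+ #|U| * (p.-1%:R * (totient (primorial D * setprod U))%:R) =
   (2 * p.-1%:R) * (2 ^+ #|U| * (totient (primorial D * setprod U))%:R) :> R by ring.
apply: ler_pM => //; last exact: IH.
by rewrite -natrM ler_nat; have := prime_gt1 pp; lia.
Qed.

Section ErrorSums.
Variables (D M k : nat).
Local Notation P := (prime_range M D).
Local Notation W := (primorial D).
Local Notation C := (dim_const D).
Local Notation al := (mertens D).
Variables (L : R) (L0 : 0 <= L).
Implicit Types (U : {set 'I_M}).

Lemma setprod_le_exp U : U \subset P -> \sum_(p in U) lns p <= 2 * L ->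
  (setprod U)%:R <= exp (2 * L).
Proof.
move=> UP sU; have hp : {in U, forall p : 'I_M, prime p} by move=> p /(subsetP UP)/prime_rangeP.
rewrite -lnn_setprod // in sU.
rewrite -[leLHS]lnK ?ltr0n ?setprod_gt0 //.
exact: ler_expR.
Qed.

Lemma errsum_pow_le :
  errsum D L (fun U => k%:R ^+ #|U|) <=
  exp (2 * L) * ((al * (2 * L) + (16 * k)%:R * C) ^+ (16 * k) / (16 * k)`!%:R).
Proof.
have L2 : 0 <= 2 * L by rewrite mulr_ge0.
apply: (@le_trans _ _ (exp (2 * L) * msum (fun p : 'I_M => (16 * k)%:R * p%:R^-1) (@lns M) P (2 * L))); last first.
  by apply: ler_wpM2l; [apply/ltW/expR_gt0|apply: msum_inv_pow_le].
rewrite /errsum /msum /wsum big_mkcondr mulr_sumr; apply: ler_sum => U; rewrite powersetE => UP.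
case: ifP => sU; last by rewrite mulr0 mulr0.
rewrite -exprMn -natrM mulr1 big_split /= prodr_const prodfV -natr_setprod mulrCA.
apply: ler_peMr; first by rewrite exprn_ge0.
have h := setprod_le_exp UP sU; rewrite ler_pdivlMr ?mul1r //.
rewrite ltr0n; apply: setprod_gt0 => p /(subsetP UP); exact: prime_rangeP.
Qed.

(* Instead of Cauchy--Schwarz: [a * g <= (a ^+ 2 / Y + Y) * g], with the trivial bound for [g] used in the
   first term and its bound on average in the second. *)
Lemma errsum_mean_le (G : nat -> R) (Z Y T : R) : 0 < Y ->
  (forall q, 0 <= G q) ->
  (forall U, U \subset P -> \sum_(p in U) lns p <= 2 * L ->
     G (W * setprod U)%N <= Z * 2 ^+ #|U| / (setprod U)%:R) ->
  \sum_(U in powerset P | \sum_(p in U) lns p <= 2 * L) G (W * setprod U)%N <= T ->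
  errsum D L (fun U => k%:R ^+ #|U| * G (W * setprod U)%N) <=
  Z / Y * ((al * (2 * L) + (2 * (16 * k) ^ 2)%:R * C) ^+ (2 * (16 * k) ^ 2) /
     (2 * (16 * k) ^ 2)`!%:R) + Y * T.
Proof.
move=> Y0 G0 hZ hT; have L2 : 0 <= 2 * L by rewrite mulr_ge0.
have Z0 : 0 <= Z.
  have := hZ set0 (sub0set _); rewrite big_set0 cards0 /setprod big_set0 => /(_ L2).
  by rewrite expr0 mulr1 divr1; apply: le_trans.
set J := (2 * (16 * k) ^ 2)%N.
have h1 : Z / Y * msum (fun p : 'I_M => J%:R * p%:R^-1) (@lns M) P (2 * L) <=
    Z / Y * ((al * (2 * L) + J%:R * C) ^+ J / J`!%:R).
  by apply: ler_wpM2l; [rewrite divr_ge0 // ltW|apply: msum_inv_pow_le].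
have h2 := ler_wpM2l (ltW Y0) hT.
apply: le_trans (lerD h1 h2); rewrite /errsum /msum /wsum mulr_sumr mulr_sumr.
rewrite [leLHS]big_mkcondr [X in _ <= _ + X]big_mkcondr -big_split /=.
apply: ler_sum => U; rewrite powersetE => UP.
case: ifP => sU; last by rewrite mulr0 mulr0 addr0.
rewrite mulr1 mulrA -exprMn -natrM.
set a : R := (16 * k)%:R ^+ #|U|; set g := G _.
have g0 : 0 <= g by apply: G0.
have a0 : 0 <= a by rewrite exprn_ge0.
have le1 : a * g <= a ^+ 2 / Y * g + Y * g.
  rewrite -mulrDl; apply: ler_wpM2r => //.
  have : 0 <= (a - Y) ^+ 2 / Y by rewrite divr_ge0 ?sqr_ge0 // ltW.
  have -> : (a - Y) ^+ 2 / Y = a ^+ 2 / Y + Y - 2 * a by field; rewrite gt_eqF.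
  lra.
apply: le_trans le1 _; rewrite lerD2r.
have le2 := hZ U UP sU; rewrite -/g in le2.
have ay : 0 <= a ^+ 2 / Y by rewrite divr_ge0 ?exprn_ge0 // ltW.
apply: le_trans (ler_wpM2l ay le2) _.
rewrite big_split /= prodr_const prodfV -natr_setprod.
have -> : J%:R ^+ #|U| = 2 ^+ #|U| * a ^+ 2 :> R.
  by rewrite /J natrM natrX exprMn /a -!exprM [(2 * #|_|)%N]mulnC.
rewrite le_eqVlt; apply/orP; left; apply/eqP; ring.
Qed.

Lemma sum_moduli_le (G : nat -> R) X (b : pred nat) : (forall q, 0 <= G q) ->
  (forall U, U \subset P -> \sum_(p in U) lns p <= 2 * L ->
     (W * setprod U <= X)%N && b (W * setprod U)%N) ->
  \sum_(U in powerset P | \sum_(p in U) lns p <= 2 * L) G (W * setprod U)%N <=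
  \sum_(1 <= q < X.+1 | b q) G q.
Proof.
move=> G0 hX.
have hp U : U \subset P -> {in U, forall p : 'I_M, prime p}.
  by move=> UP p /(subsetP UP)/prime_rangeP.
pose c q := (0 < q)%N && b q.
apply: (@le_trans _ _ (\sum_(0 <= q < X.+1 | c q) G q)).
  apply: (sum_inj_le (f := fun U => (W * setprod U)%N) (psi := G)) => //.
  - move=> U V /andP[+ _] /andP[+ _]; rewrite !powersetE => UP VP /eqP.
    rewrite eqn_pmul2l ?primorial_gt0 // => /eqP.
    by apply: setprod_inj; apply: hp.
  - move=> U /andP[]; rewrite powersetE => UP sU; have /andP[h1 h2] := hX U UP sU.
    by rewrite ltnS h1 /c h2 muln_gt0 primorial_gt0 setprod_gt0 //; apply: hp.
rewrite [leLHS]big_mkcond /= [leLHS]big_ltn //= add0r [leRHS]big_mkcond /=.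
rewrite [leLHS]big_nat_cond [leRHS]big_nat_cond; apply: ler_sum => m /andP[/andP[m1 _] _].
by rewrite /c m1.
Qed.

End ErrorSums.

Lemma RlebE (q N : nat) (x : R) : (0 < q)%N ->
  Defs.Rleb (INR q) (Rpower N%:R x) = (lnn q <= x * lnn N).
Proof.
move=> q0; have q0' : 0 < q%:R :> R by rewrite ltr0n.
rewrite /Defs.Rleb !INRE /Rpower; case: Rle_dec => h; apply/esym.
  have {}h : q%:R <= exp (x * lnn N) by apply/RleP.
  by rewrite -[leRHS]ln_exp; apply: ler_lnR.
apply/negbTE/negP => hq; apply: h; apply/RleP.
by rewrite -[leLHS]lnK //; apply: ler_expR.
Qed.

Lemma level_A theta (eps : R) a : condA theta -> 0 < eps -> (0 < a)%N ->
  exists2 K : R, 0 <= K & forall N, (2 <= N)%N ->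
    \sum_(1 <= q < N.+1 | lnn q <= (theta - eps) * lnn N) prime_AP_max N q <=
    K * (N%:R / lnn N ^+ a).
Proof.
move=> hA /RltP e0 a0; have /RltP a0' : 0 < INR a by rewrite INRE ltr0n.
have [K hK] := hA eps (INR a) e0 a0'.
exists (Num.max 0 K) => [|N N2]; first by rewrite le_max lexx.
have l0 : 0 < lnn N by apply: lnn_gt0.
have /RleP := hK N N2; rewrite Rpower_pow; last by apply/RltP; rewrite INRE.
rewrite INRE RpowE => h.
apply: (@le_trans _ _ (K * (N%:R / lnn N ^+ a))); last first.
  by apply: ler_wpM2r; [rewrite divr_ge0 ?exprn_ge0 // ltW|rewrite le_max lexx orbT].
apply: le_trans h; rewrite le_eqVlt; apply/orP; left; apply/eqP.
rewrite [LHS]big_nat_cond [RHS]big_nat_cond; apply: eq_bigl => q.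
by case: (ltnP 0 q) => [q0|_] //; congr (_ && _); symmetry; exact: (@RlebE q N (theta - eps) q0).
Qed.

Lemma level_B theta (eps : R) a : condB theta -> 0 < eps -> (0 < a)%N ->
  exists2 K : R, 0 <= K & forall N, (2 <= N)%N ->
    \sum_(1 <= q < N.+1 | lnn q <= (theta - eps) * lnn N) liouville_AP_max N q <=
    K * (N%:R / lnn N ^+ a).
Proof.
move=> hB /RltP e0 a0; have /RltP a0' : 0 < INR a by rewrite INRE ltr0n.
have [K hK] := hB eps (INR a) e0 a0'.
exists (Num.max 0 K) => [|N N2]; first by rewrite le_max lexx.
have l0 : 0 < lnn N by apply: lnn_gt0.
have /RleP := hK N N2; rewrite Rpower_pow; last by apply/RltP; rewrite INRE.
rewrite INRE RpowE => h.
apply: (@le_trans _ _ (K * (N%:R / lnn N ^+ a))); last first.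
  by apply: ler_wpM2r; [rewrite divr_ge0 ?exprn_ge0 // ltW|rewrite le_max lexx orbT].
apply: le_trans h; rewrite le_eqVlt; apply/orP; left; apply/eqP.
rewrite [LHS]big_nat_cond [RHS]big_nat_cond; apply: eq_bigl => q.
by case: (ltnP 0 q) => [q0|_] //; congr (_ && _); symmetry; exact: (@RlebE q N (theta - eps) q0).
Qed.

Lemma chebyshev_of_condA theta : condA theta -> 0 < theta ->
  exists2 K : R, 0 <= K & forall X, (2 <= X)%N ->
    \sum_(0 <= p < X.+1 | prime p) lnn p <= K * X%:R.
Proof.
move=> hA t0; have e0 : 0 < theta / 2 by rewrite divr_gt0.
have [K K0 hK] := level_A hA e0 (ltn0Sn 0).
have l2 : 0 < lnn 2 by apply: lnn_gt0.
exists (1 + K / lnn 2) => [|X X2]; first by rewrite addr_ge0 // divr_ge0 // ltW.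
have lX : lnn 2 <= lnn X by apply: ler_lnn.
have lX0 := lt_le_trans l2 lX.
have h1 : prime_AP_max X 1 <= K * (X%:R / lnn X ^+ 1).
  apply: le_trans (hK X X2); rewrite big_ltn_cond; last by lia.
  have -> : (lnn 1 <= (theta - theta / 2) * lnn X) by rewrite lnn1 mulr_ge0 ?ltW //; lra.
  by rewrite lerDl; apply: sumr_ge0 => q _; apply: prime_AP_max_ge0.
have h2 := @prime_AP_error_le X 1 0 isT (coprimen1 0).
have := le_trans h2 h1; rewrite expr1 prime_AP_errorE /= divr1 => h3.
have h4 : K * (X%:R / lnn X) <= K * (X%:R / lnn 2).
  by apply: ler_wpM2l => //; apply: ler_wpM2l => //; rewrite lef_pV2.
have := le_trans (ler_norm _) (le_trans h3 h4).
have -> : \sum_(0 <= p < X.+1 | prime p && (p == 0 %[mod 1])) lnn p = \sum_(0 <= p < X.+1 | prime p) lnn p.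
  by apply: eq_bigl => p; rewrite !modn1 andbT.
by rewrite lerBlDr mulrDl mul1r mulrAC -mulrA => h; rewrite addrC.
Qed.

Lemma prime_recip_sum_le theta : condA theta -> 0 < theta ->
  exists2 K : R, 0 <= K & forall (D M : nat) (z : R), 0 <= z ->
    \sum_(p in prime_range M D | lns p <= z) (1 + lns p) / p%:R <= K * (z + 1).
Proof.
move=> hA t0; have [K K0 hK] := chebyshev_of_condA hA t0.
have l2 : 0 < lnn 2 by apply: lnn_gt0.
have hJ J : \sum_(0 <= p < 2 ^ J | prime p) lnn p / p%:R <= J%:R * (2 * K).
  elim: J => [|J IH].
    by rewrite mul0r expn0 big_mkcond big_nat1.
  rewrite (big_cat_nat (n := (2 ^ J)%N)) //=; last by rewrite leq_exp2l.
  rewrite -natr1 mulrDl mul1r; apply: lerD => //.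
  have p0 : 0 < (2 ^ J)%:R :> R by rewrite ltr0n expn_gt0.
  apply: (@le_trans _ _ ((\sum_(0 <= p < (2 ^ J.+1).+1 | prime p) lnn p) / (2 ^ J)%:R)).
    rewrite mulr_suml.
    have le1 : (0 <= 2 ^ J)%N by [].
    have le2 : (2 ^ J <= (2 ^ J.+1).+1)%N by rewrite (leq_trans _ (leqnSn _)) // leq_exp2l.
    rewrite [leRHS](big_cat_nat (n := (2 ^ J)%N)) //= ler_wpDl //.
      by apply: sumr_ge0 => p _; rewrite divr_ge0 // lnn_ge0.
    rewrite big_mkcond [leRHS]big_mkcond /= [leRHS]big_nat_recr ?leq_exp2l //= ler_wpDr //.
      by case: ifP => // _; rewrite divr_ge0 // lnn_ge0.
    rewrite [leLHS]big_nat_cond [leRHS]big_nat_cond; apply: ler_sum => p /andP[/andP[pJ _] _].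
    case: ifP => // pp; apply: ler_wpM2l; first exact: lnn_ge0.
    by rewrite lef_pV2 ?posrE ?ler_nat // ltr0n prime_gt0.
  rewrite ler_pdivrMr //; apply: le_trans (hK _ _) _; first by rewrite expnS leq_pmulr // expn_gt0.
  by rewrite expnS natrM mulrA [2 * K]mulrC.
exists ((1 + (lnn 2)^-1) * (2 * K * (1 + (lnn 2)^-1))).
  by rewrite !mulr_ge0 ?addr_ge0 ?invr_ge0 // ltW.
move=> D M z z0; pose J := (Num.truncn (z / lnn 2)).+1.
have zl0 : 0 <= z / lnn 2 by rewrite divr_ge0 // ltW.
have /andP[J1 J2] := truncn_itv zl0.
have h1 : \sum_(p in prime_range M D | lns p <= z) (1 + lns p) / p%:R <=
   (1 + (lnn 2)^-1) * \sum_(0 <= p < 2 ^ J | prime p) lnn p / p%:R.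
  apply: (@le_trans _ _ (\sum_(p in prime_range M D | lns p <= z)
      (1 + (lnn 2)^-1) * (lnn p / p%:R))).
    apply: ler_sum => p /andP[/prime_rangeP pp _].
    rewrite mulrA; apply: ler_wpM2r; first by rewrite invr_ge0.
    rewrite mulrDl mul1r addrC lerD2l -ler_pdivrMl ?invr_gt0 // invrK mulr1.
    by apply: ler_lnn => //; apply: prime_gt1.
  rewrite -mulr_sumr; apply: ler_wpM2l; first by rewrite addr_ge0 // invr_ge0 ltW.
  apply: (sum_inj_le (f := fun p : 'I_M => p : nat) (psi := fun p => lnn p / p%:R)).
  - by move=> p q _ _; apply: val_inj.
  - move=> p /andP[/prime_rangeP pp pz]; rewrite pp andbT ltnNge; apply/negP => hp.
    have : lnn (2 ^ J) <= z by apply: le_trans pz; apply: ler_lnn; rewrite ?expn_gt0.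
    have -> : lnn (2 ^ J) = J%:R * lnn 2.
      elim: (J) => [|j IH]; first by rewrite expn0 lnn1 mul0r.
      by rewrite expnS lnnM ?expn_gt0 // IH -natr1 mulrDl mul1r addrC.
    by rewrite -ler_pdivlMr // leNgt J2.
  - by move=> p _; rewrite divr_ge0 // lnn_ge0.
apply: le_trans h1 _; rewrite -[leRHS]mulrA; apply: ler_wpM2l.
  by rewrite addr_ge0 // invr_ge0 ltW.
apply: le_trans (hJ J) _; rewrite [leLHS]mulrC -[leRHS]mulrA; apply: ler_wpM2l; first by rewrite mulr_ge0.
have e : J%:R <= z / lnn 2 + 1 by rewrite -natr1 lerD2r.
apply: le_trans e _.
have i2 : 0 <= (lnn 2)^-1 by rewrite invr_ge0 ltW.
by rewrite mulrDr mulr1 mulrDl mul1r; lra.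
Qed.

(** * The sieve inequality *)

Section MainInequality.
Variables (D v0 M N k : nat) (hs : seq nat).
Local Notation P := (prime_range M D).
Local Notation W := (primorial D).
Local Notation al := (mertens D).
Local Notation C := (dim_const D).
Hypotheses (k1 : (1 < k)%N) (kD : (2 * k <= D)%N) (uhs : uniq hs) (shs : size hs = k).
Hypotheses (hsD : {in hs, forall h, (h <= D)%N}).
Hypotheses (hv0 : {in hs, forall h, coprime W (v0 + h)}) (MN : (M <= N.+1)%N).
Hypotheses (DM : (D < M)%N) (N0 : (0 < N)%N).
Variables (L : R) (L1 : 1 <= L) (LM : (Num.truncn (exp L) < M)%N).
Variables (n : nat) (F : nat -> R) (del : R).
Hypotheses (n0 : (0 < n)%N) (F_dec : forall i, F i.+1 <= F i) (Fn0 : F n = 0)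
  (del0 : 0 <= del) (ndel : n%:R * del = L).
Variables (ED Kc r c z : R).
Hypotheses (hCL : k%:R * C <= al * L) (hED : euler_excess M k D <= ED).
Hypothesis (hz : z = c * r * L).
Hypothesis he1 : B0 D M k L F ^+ 2 * errsum D L (fun U : {set 'I_M} => k%:R ^+ #|U|) <= N%:R.
Hypothesis he2 : {in hs, forall h, B0 D M k L F ^+ 2 * errsum D L (fun U : {set 'I_M} => k%:R ^+ #|U| *
     (prime_AP_max (N + N + h) (W * setprod U) + prime_AP_max (N + h) (W * setprod U))) <= 2 * N%:R}.
Hypothesis he3 : {in hs, forall h, B0 D M k L F ^+ 2 * errsum D L (fun U : {set 'I_M} =>
     k%:R ^+ #|U| * (2 * liouville_AP_max (N + N + h) (W * setprod U))) <= 2 * N%:R}.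
Hypothesis he4 : \sum_(p in P | lns p <= z)
  B0 D M k L F ^+ 2 * errsum D L (fun U : {set 'I_M} => k%:R ^+ #|U|.+1) <= N%:R.
Hypothesis hc : \sum_(p in P | lns p <= z) (1 + lns p) / p%:R <= Kc * (z + 1).
Hypothesis hX : lnn (N + N + D) <= (r + 2 / L) * L.
Hypothesis ng : forall m, (N < m)%N -> (m <= N + N)%N -> m = v0 %[mod W] ->
  ~ good_at D M hs z m.

Definition i_mean : R := \sum_(i < n) (F i ^+ 2 - F i.+1 ^+ 2) * (i.+1%:R / n%:R) ^+ k.
Definition j_mean : R :=
  \sum_(j < n) (tailF n F j ^+ 2 - tailF n F j.+1 ^+ 2) * (j.+1%:R / n%:R) ^+ k.-1.
Definition om : R := W%:R / al ^+ k.

Let V : R := N%:R / W%:R * (al * L) ^+ k.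
Let L0 : 0 < L := lt_le_trans ltr01 L1.
Let al0 : 0 < al := mertens_gt0 D.
Let W0 : 0 < W%:R :> R. Proof. by rewrite ltr0n primorial_gt0. Qed.
Let V0 : 0 < V. Proof.
apply: mulr_gt0; first by rewrite divr_gt0 // ltr0n.
by apply: exprn_gt0; apply: mulr_gt0.
Qed.
Let aL0 : 0 <= al * L. Proof. by apply: mulr_ge0; apply: ltW. Qed.
Let nr0 : 0 < n%:R :> R. Proof. by rewrite ltr0n. Qed.
Let k0 : 1 < k%:R :> R. Proof. by rewrite ltr1n. Qed.
Let delE : del = L / n%:R. Proof. by rewrite -ndel mulrAC mulfV ?mul1r // gt_eqF. Qed.
Let C0 : 0 <= C.
Proof. by rewrite /dim_const !addr_ge0 // ltW. Qed.

Let F_ge0 i : (i <= n)%N -> 0 <= F i.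
Proof.
move=> iln; have h m : F (m + i)%N <= F i.
  by elim: m => // m; apply: le_trans; apply: F_dec.
by rewrite -Fn0 -{1}(subnK iln).
Qed.

Let sqF_dec i : (i < n)%N -> 0 <= F i ^+ 2 - F i.+1 ^+ 2.
Proof.
move=> iln; rewrite subr_ge0; apply: lerXn2r; rewrite ?nnegrE ?F_ge0 //.
exact: ltnW.
Qed.

Let tail_dec j : 0 <= tailF n F j ^+ 2 - tailF n F j.+1 ^+ 2.
Proof. by rewrite subr_ge0; apply: lerXn2r; rewrite ?nnegrE ?tailF_ge0 ?tailF_dec. Qed.

Let Nle : N%:R <= V * (om / L).
Proof.
have e : V * (om / L) = N%:R * L ^+ k.-1.
  rewrite /V /om exprMn -{2}(prednK (ltnW k1)) exprSr.
  by field; rewrite !gt_eqF // exprn_gt0.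
by rewrite e ler_peMr // exprn_ege1.
Qed.

Lemma expr_add_le (a x : R) : 0 <= a <= 1 -> 0 <= x <= 1 ->
  (a + x) ^+ k <= a ^+ k + k%:R * 2 ^+ k * x.
Proof.
move=> /andP[a0 a1] /andP[x0 x1].
have := expr_diff_le k.-1 a0 (_ : a <= a + x); rewrite lerDl x0 prednK ?(ltnW k1) // => /(_ isT).
have -> : a + x - a = x by ring.
have h : k%:R * x * (a + x) ^+ k.-1 <= k%:R * x * 2 ^+ k.
  apply: ler_wpM2l; first by rewrite mulr_ge0.
  apply: (@le_trans _ _ (2 ^+ k.-1)).
    by apply: lerXn2r; rewrite ?nnegrE ?addr_ge0 //; lra.
  by rewrite ler_weXn2l ?leq_pred // ler1n.
lra.
Qed.

Lemma expr_sub_ge (a x : R) : 0 <= a <= 1 -> 0 <= x ->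
  a ^+ k.-1 - k.-1%:R * x <= Num.max 0 (a - x) ^+ k.-1.
Proof.
move=> /andP[a0 a1] x0; have kk : k.-1 = k.-2.+1 by move: k1; case: (k) => [|[|m]].
have [xa|ax] := leP x a.
  rewrite max_r ?subr_ge0 // lerBlDr -lerBlDl kk.
  have ax0 : 0 <= a - x by rewrite subr_ge0.
  apply: le_trans (expr_diff_le k.-2 ax0 (_ : a - x <= a)) _; first by rewrite gerBl.
  have -> : a - (a - x) = x by ring.
  rewrite -[leRHS]mulr1; apply: ler_wpM2l; first by rewrite mulr_ge0.
  exact: exprn_ile1.
rewrite max_l; last by rewrite subr_le0 ltW.
rewrite kk expr0n /= subr_le0; apply: (@le_trans _ _ a).
  by rewrite exprS ler_piMr // exprn_ile1.
apply: (le_trans (ltW ax)); rewrite ler_peMl // ler1n //.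
Qed.

Lemma upper_bound :
  \sum_(m <- dyadic N | m == v0 %[mod W]) sieve D M k hs n F del m <=
  V * (ED / k`!%:R * (i_mean + F 0%N ^+ 2 * (k%:R * 2 ^+ k * (k%:R * C / al)) / L)) +
  N%:R.
Proof.
apply: le_trans (sieve_total_le v0 M N k1 kD uhs shs hsD F_dec Fn0 del0 ndel) _.
apply: lerD => //.
apply: le_trans (ler_wpM2l _ (main_upper M k1 kD F_dec Fn0 del0)) _; first by rewrite divr_ge0.
rewrite /V -[leRHS]mulrA; apply: ler_wpM2l; first by rewrite divr_ge0.
have fk : 0 < k`!%:R :> R by rewrite ltr0n fact_gt0.
have S0 : 0 <= \sum_(i < n) (F i ^+ 2 - F i.+1 ^+ 2) * (al * (i.+1%:R * del) + k%:R * C) ^+ k.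
  apply: sumr_ge0 => i _; apply: mulr_ge0; first exact: sqF_dec.
  apply: exprn_ge0; apply: addr_ge0; last by rewrite mulr_ge0.
  by rewrite mulr_ge0 ?(ltW al0) // mulr_ge0.
apply: le_trans (ler_wpM2r S0 (_ : _ <= ED / k`!%:R)) _.
  by rewrite ler_pM2r ?invr_gt0.
have ED0 : 0 <= ED / k`!%:R.
  by rewrite divr_ge0 ?(le_trans _ hED) // (le_trans _ (euler_excess_ge1 M k1 kD)).
rewrite [leRHS]mulrCA; apply: ler_wpM2l => //.
have sF : \sum_(i < n) (F i ^+ 2 - F i.+1 ^+ 2) = F 0%N ^+ 2.
  by rewrite (sum_telescope (fun i => F i ^+ 2)) Fn0 expr0n subr0.
rewrite /i_mean -sF -mulrA mulr_suml -big_split mulr_sumr; apply: ler_sum => i _ /=.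
rewrite -mulrDr [leRHS]mulrCA; apply: ler_wpM2l; first exact: sqF_dec.
have -> : al * (i.+1%:R * del) + k%:R * C = al * L * (i.+1%:R / n%:R + k%:R * C / al / L).
  by rewrite delE; field; rewrite !gt_eqF.
rewrite exprMn; apply: ler_wpM2l; first by apply: exprn_ge0.
apply: le_trans (expr_add_le _ _) _.
- by rewrite divr_ge0 //= ler_pdivrMr // mul1r ler_nat.
- apply/andP; split; last by rewrite ler_pdivrMr // mul1r ler_pdivrMr // [L * _]mulrC.
  by do 2!(apply: divr_ge0; last exact: ltW); rewrite mulr_ge0.
by rewrite lerD2l mulrA.
Qed.

Lemma lower_bound h : h \in hs ->
  V * L * ((j_mean - tailF n F 0 ^+ 2 * (k.-1%:R * k.-1%:R) / L) / (n%:R ^+ 2 * k.-1`!%:R)) -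
  2 * N%:R <=
  \sum_(m <- dyadic N | m == v0 %[mod W]) (if prime (m + h) then lnn (m + h) else 0) *
     sieve D M k hs n F del m.
Proof.
move=> hh.
apply: le_trans (sieve_prime_ge k1 kD uhs shs hsD hv0 MN F_dec Fn0 del0 ndel hh).
apply: lerD; last by rewrite lerN2 he2.
have T0 : 0 < (totient W)%:R :> R by rewrite ltr0n totient_gt0 primorial_gt0.
have hl := main_lower k1 kD DM LM F_dec Fn0 del0 ndel.
apply: le_trans _ (ler_wpM2l _ hl); last by rewrite divr_ge0 // ltW.
have fk : 0 < (k.-1)`!%:R :> R by rewrite ltr0n fact_gt0.
have T : \sum_(j < n) (tailF n F j ^+ 2 - tailF n F j.+1 ^+ 2) *
    ((al * Num.max 0 (j.+1%:R * del - k.-1%:R)) ^+ k.-1 / (k.-1)`!%:R) >=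
  (al * L) ^+ k.-1 / (k.-1)`!%:R * (j_mean - tailF n F 0 ^+ 2 * (k.-1%:R * k.-1%:R) / L).
  have sT : tailF n F 0 ^+ 2 = \sum_(j < n) (tailF n F j ^+ 2 - tailF n F j.+1 ^+ 2).
    rewrite (sum_telescope (fun j => tailF n F j ^+ 2)).
    by rewrite [tailF n F n]/tailF big_geq // expr0n subr0.
  rewrite /j_mean sT -[_ * (k.-1%:R * k.-1%:R) / L]mulrA mulr_suml -sumrB mulr_sumr; apply: ler_sum => j _.
  rewrite -mulrBr [leLHS]mulrCA; apply: ler_wpM2l; first exact: tail_dec.
  have -> : j.+1%:R * del - k.-1%:R = L * (j.+1%:R / n%:R - k.-1%:R / L).
    by rewrite delE; field; rewrite !gt_eqF.
  have -> : Num.max 0 (L * (j.+1%:R / n%:R - k.-1%:R / L)) =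
      L * Num.max 0 (j.+1%:R / n%:R - k.-1%:R / L).
    by rewrite maxr_pMr ?mulr0 // ltW.
  rewrite [al * (L * _)]mulrA [(al * L * _) ^+ _]exprMn [leLHS]mulrAC.
  apply: ler_wpM2r; first by rewrite invr_ge0 ltW.
  apply: ler_wpM2l; first by apply: exprn_ge0.
  apply: le_trans (expr_sub_ge _ _).
  - by rewrite -mulrA.
  - by rewrite divr_ge0 //= ler_pdivrMr // mul1r ler_nat.
  - by rewrite divr_ge0 // ltW.
have aw : N%:R / (totient W)%:R * (al ^+ 2 * del ^+ 2) >= 0.
  by rewrite !mulr_ge0 ?exprn_ge0 ?invr_ge0 // ltW.
rewrite [leRHS]mulrA; apply: le_trans (ler_wpM2l aw T).
rewrite le_eqVlt; apply/orP; left; apply/eqP.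
set J := j_mean - _.
have -> : V = N%:R / W%:R * (al * L * (al * L) ^+ k.-1).
  by rewrite /V -exprS prednK // ltnW.
rewrite delE {1}/mertens.
have e : al = (totient W)%:R / W%:R by [].
have e2 : (totient W)%:R = al * W%:R by rewrite e mulfVK // gt_eqF.
rewrite e2 -mulrA; set x := (al * L) ^+ k.-1.
by field; rewrite !gt_eqF.
Qed.

Lemma small_bound :
  \sum_(p in P | lns p <= z)
    \sum_(m <- dyadic N | (m == v0 %[mod W]) && (p \in divset D M hs m)) sieve D M k hs n F del m <=
  V * (k%:R * F 0%N ^+ 2 * ED * 2 ^+ k.-1 / (al * k.-1`!%:R) * Kc * (c * r + 1 / L)) + N%:R.
Proof.
have fk : 0 < (k.-1)`!%:R :> R by rewrite ltr0n fact_gt0.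
pose Q : R := N%:R / W%:R * (k%:R * F 0%N ^+ 2 * (ED * ((2 * (al * L)) ^+ k.-1 / k.-1`!%:R))).
have ED1 : 1 <= ED by apply: le_trans hED; apply: euler_excess_ge1.
have Q0 : 0 <= Q.
  apply: mulr_ge0; first by rewrite divr_ge0.
  apply: mulr_ge0; first by rewrite mulr_ge0 // exprn_ge0 // F_ge0.
  apply: mulr_ge0; first exact: le_trans ler01 ED1.
  by rewrite divr_ge0 // exprn_ge0 // mulr_ge0.
have h1 : \sum_(p in P | lns p <= z)
    \sum_(m <- dyadic N | (m == v0 %[mod W]) && (p \in divset D M hs m)) sieve D M k hs n F del m <=
  \sum_(p in P | lns p <= z) (Q * ((1 + lns p) / p%:R) +
     B0 D M k L F ^+ 2 * errsum D L (fun U : {set 'I_M} => k%:R ^+ #|U|.+1)).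
  apply: ler_sum => p /andP[pP _].
  apply: le_trans (sieve_small_le v0 N k1 kD uhs shs hsD F_dec Fn0 del0 ndel pP) _.
  rewrite lerD2r.
  have sg0 : 0 <= sg k p by rewrite /sg divr_ge0.
  have L0' : 0 <= L by apply: ltW.
  apply: le_trans (ler_wpM2l _ (main_shift k1 kD L0' F_dec Fn0 del0 ndel pP)) _.
    by rewrite !mulr_ge0 ?invr_ge0.
  have -> : Q * ((1 + lns p) / p%:R) = N%:R / W%:R * sg k p * (F 0%N ^+ 2 * ((1 + lns p) *
     (ED * ((2 * (al * L)) ^+ k.-1 / k.-1`!%:R)))).
    by rewrite /Q /sg; ring.
  apply: ler_wpM2l; first by rewrite !mulr_ge0 ?invr_ge0.
  apply: ler_wpM2l; first by rewrite exprn_ge0 // F_ge0.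
  apply: ler_wpM2l; first by rewrite addr_ge0 // lns_ge0.
  have x0 : 0 <= al * L + k.-1%:R * C by apply: addr_ge0 => //; apply: mulr_ge0.
  apply: ler_pM => //.
  - by rewrite (le_trans _ (euler_excess_ge1 M k1 kD)).
  - by rewrite divr_ge0 ?exprn_ge0.
  apply: ler_wpM2r; first by rewrite invr_ge0 ltW.
  apply: lerXn2r; [by rewrite nnegrE|by rewrite nnegrE mulr_ge0|].
  have : k.-1%:R * C <= k%:R * C by apply: ler_wpM2r => //; rewrite ler_nat leq_pred.
  move: hCL; lra.
apply: le_trans h1 _; rewrite big_split /=; apply: lerD => //.
rewrite -mulr_sumr; apply: le_trans (ler_wpM2l Q0 hc) _.
rewrite le_eqVlt; apply/orP; left; apply/eqP.
have -> : V = N%:R / W%:R * (al * L * (al * L) ^+ k.-1).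
  by rewrite /V -exprS prednK // ltnW.
rewrite /Q hz exprMn; set x := (al * L) ^+ k.-1; set y := 2 ^+ k.-1.
by field; rewrite !gt_eqF.
Qed.

Definition err_const1 : R :=
  (k%:R - 1) * k%:R * (tailF n F 0 ^+ 2 * (k.-1%:R * k.-1%:R) / (n%:R ^+ 2 * k.-1`!%:R) + 2 * om).
Definition small_const : R :=
  k%:R ^+ 2 * (k%:R * F 0%N ^+ 2 * ED * 2 ^+ k.-1 / (al * k.-1`!%:R) * Kc).
Definition err_const2 : R :=
  k%:R / 2 * (ED / k`!%:R * (F 0%N ^+ 2 * (k%:R * 2 ^+ k * (k%:R * C / al)))) +
  (k%:R / 2 + k%:R + k%:R ^+ 2) * om + small_const.

Lemma main_inequality :
  (k%:R - 1) * k%:R * (j_mean / (n%:R ^+ 2 * k.-1`!%:R)) <=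
  err_const1 / L + (r + 2 / L) *
    (k%:R / 2 * (ED / k`!%:R * i_mean) + err_const2 / L + c * (r * small_const)).
Proof.
have fk : 0 < (k.-1)`!%:R :> R by rewrite ltr0n fact_gt0.
have concl := sieve_conclusion k1 kD uhs shs hsD MN DM (ltW L0) LM F_dec Fn0 del0 N0 ng.
set S1 := \sum_(m <- _ | _) sieve _ _ _ _ _ _ _ m in concl.
set S3 := \sum_(h <- hs) `|_| in concl.
set S4 := \sum_(p in P | _) \sum_(m <- _ | _) _ in concl.
have hS1 : S1 <= _ := upper_bound.
have hS4 : S4 <= _ := small_bound.
have hS3 : S3 <= k%:R * (2 * N%:R).
  have -> : k%:R * (2 * N%:R) = \sum_(h <- hs) 2 * N%:R :> R.
    by rewrite big_const_seq count_predT iter_addr_0 shs mulr_natl.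
  rewrite /S3 big_seq [leRHS]big_seq; apply: ler_sum => h hh.
  apply: le_trans (sieve_liouville_le v0 k1 kD uhs shs hsD MN F_dec Fn0 del0 ndel hh) _.
  exact: he3.
pose X2 : R := (j_mean - tailF n F 0 ^+ 2 * (k.-1%:R * k.-1%:R) / L) / (n%:R ^+ 2 * k.-1`!%:R).
have hS2 : (k%:R - 1) * (k%:R * (V * L * X2 - 2 * N%:R)) <= (k%:R - 1) *
   \sum_(h <- hs) (\sum_(m <- dyadic N | m == v0 %[mod W])
      (if prime (m + h) then lnn (m + h) else 0) * sieve D M k hs n F del m).
  apply: ler_wpM2l; first by rewrite subr_ge0 ltW.
  have -> : k%:R * (V * L * X2 - 2 * N%:R) = \sum_(h <- hs) (V * L * X2 - 2 * N%:R).
    by rewrite big_const_seq count_predT iter_addr_0 shs mulr_natl.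
  rewrite big_seq [leRHS]big_seq; apply: ler_sum => h hh; exact: lower_bound.
have hA := le_trans hS2 concl.
pose Y1 : R := ED / k`!%:R * (i_mean + F 0%N ^+ 2 * (k%:R * 2 ^+ k * (k%:R * C / al)) / L).
pose Y4 : R := k%:R * F 0%N ^+ 2 * ED * 2 ^+ k.-1 / (al * k.-1`!%:R) * Kc * (c * r + 1 / L).
have kp : 0 <= k%:R :> R by [].
set B := _ / 2 * S1 + _ + _ in hA.
pose T := V * (k%:R / 2 * (Y1 + om / L) + k%:R * (om / L) + k%:R ^+ 2 * (Y4 + om / L)).
have hB : B <= T.
  have g1 : k%:R / 2 * S1 <= k%:R / 2 * (V * Y1 + V * (om / L)).
    apply: ler_wpM2l; first by rewrite divr_ge0.
    by apply: (le_trans hS1); rewrite lerD2l.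
  have g4 : k%:R ^+ 2 * S4 <= k%:R ^+ 2 * (V * Y4 + V * (om / L)).
    apply: ler_wpM2l; first by rewrite exprn_ge0.
    by apply: (le_trans hS4); rewrite lerD2l.
  have g3 : S3 / 2 <= k%:R * (V * (om / L)).
    rewrite ler_pdivrMr //; apply: (le_trans hS3).
    have -> : k%:R * (2 * N%:R) = k%:R * N%:R * 2 :> R by ring.
    by apply: ler_wpM2r => //; apply: ler_wpM2l.
  rewrite /B /T; have -> : V * (k%:R / 2 * (Y1 + om / L) + k%:R * (om / L) + k%:R ^+ 2 * (Y4 + om / L)) =
    k%:R / 2 * (V * Y1 + V * (om / L)) + k%:R * (V * (om / L)) + k%:R ^+ 2 * (V * Y4 + V * (om / L)) by ring.
  by apply: lerD => //; apply: lerD.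
have lX0 : 0 <= lnn (N + N + D) by apply: lnn_ge0.
have B0' : 0 <= B.
  rewrite /B; apply: addr_ge0; first apply: addr_ge0.
  - by rewrite mulr_ge0 ?divr_ge0 // /S1 sumr_ge0 // => m _; apply: sieve_ge0.
  - by rewrite divr_ge0 // /S3 sumr_ge0.
  - rewrite mulr_ge0 ?exprn_ge0 // /S4 sumr_ge0 // => p _.
    by apply: sumr_ge0 => m _; apply: sieve_ge0.
have hR : lnn (N + N + D) * B <= (r + 2 / L) * L * T.
  by apply: ler_pM.
have hF := le_trans hA hR.
have hN2 : V * L * X2 - 2 * (V * L * (om / L)) <= V * L * X2 - 2 * N%:R.
  rewrite lerD2l lerN2; apply: ler_wpM2l => //; apply: (le_trans Nle).
  have om0 : 0 <= om / L by rewrite !divr_ge0 ?exprn_ge0 // ltW.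
  apply: ler_wpM2r => //; rewrite ler_peMr // ltW //.
have hG : (k%:R - 1) * (k%:R * (V * L * X2 - 2 * (V * L * (om / L)))) <= (r + 2 / L) * L * T.
  apply: le_trans hF; apply: ler_wpM2l; first by rewrite subr_ge0 ltW.
  exact: ler_wpM2l.
have VL : 0 < V * L by rewrite mulr_gt0.
have e1 : (k%:R - 1) * (k%:R * (V * L * X2 - 2 * (V * L * (om / L)))) =
   V * L * ((k%:R - 1) * k%:R * (X2 - 2 * (om / L))) by ring.
have e2 : (r + 2 / L) * L * T = V * L * ((r + 2 / L) *
   (k%:R / 2 * (Y1 + om / L) + k%:R * (om / L) + k%:R ^+ 2 * (Y4 + om / L))).
  by rewrite /T; ring.
rewrite e1 e2 ler_pM2l // in hG.
have e3 : (k%:R - 1) * k%:R * (X2 - 2 * (om / L)) =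
   (k%:R - 1) * k%:R * (j_mean / (n%:R ^+ 2 * k.-1`!%:R)) - err_const1 / L.
  by rewrite /X2 /err_const1; field; rewrite !gt_eqF // ?exprn_gt0.
have e4 : k%:R / 2 * (Y1 + om / L) + k%:R * (om / L) + k%:R ^+ 2 * (Y4 + om / L) =
  k%:R / 2 * (ED / k`!%:R * i_mean) + err_const2 / L + c * (r * small_const).
  rewrite /Y1 /Y4 /err_const2 /small_const.
  have fk' : 0 < (k`!)%:R :> R by rewrite ltr0n fact_gt0.
  by field; rewrite !gt_eqF.
by rewrite e3 e4 lerBlDl in hG.
Qed.

End MainInequality.

Section EventualErrors.
Variables (D k n : nat) (F : nat -> R) (ED rho : R).
Hypotheses (k1 : (1 < k)%N) (kD : (2 * k <= D)%N) (rho0 : 0 < rho) (rho1 : rho < 1).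
Hypotheses (F_dec : forall i, F i.+1 <= F i) (Fn0 : F n = 0).
Hypothesis (hED : forall M, euler_excess M k D <= ED).
Local Notation P M := (prime_range M D).
Local Notation W := (primorial D).
Local Notation C := (dim_const D).
Local Notation al := (mertens D).

(* The sieve is supported on integers up to [exp (level N)], the square root of [N ^ rho]. *)
Definition level (N : nat) : R := rho / 2 * lnn N.

Let al0 : 0 < al := mertens_gt0 D.
Let al1 : al <= 1 := mertens_le1 D.
Let C0 : 0 <= C.
Proof. by rewrite /dim_const !addr_ge0 // ltW. Qed.
Let F0 : 0 <= F 0%N.
Proof.
by have := yv_le 0 F_dec Fn0 (set0 : {set 'I_1}); apply: le_trans; apply: yv_ge0.
Qed.
Let ED1 : 1 <= ED. Proof. exact: le_trans (euler_excess_ge1 0 k1 kD) (hED 0). Qed.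

Lemma affine_pow_le N (c : R) j : 0 <= c -> c <= 2 -> 1 <= lnn N ->
  0 <= al * (c * level N) + j%:R * C /\
  (al * (c * level N) + j%:R * C) ^+ j / j`!%:R <= ((1 + j%:R * C) * lnn N) ^+ j.
Proof.
move=> c0 c2 l1; have l0 : 0 <= lnn N by apply: lnn_ge0.
have x0 : 0 <= c * level N by rewrite mulr_ge0 // /level mulr_ge0 // divr_ge0 // ltW.
have x1 : c * level N <= lnn N.
  apply: (@le_trans _ _ (2 * level N)).
    by apply: ler_wpM2r => //; rewrite /level mulr_ge0 // divr_ge0 // ltW.
  have : rho * lnn N <= 1 * lnn N by apply: ler_wpM2r => //; exact: ltW.
  rewrite /level; lra.
have a0 : 0 <= al * (c * level N) by rewrite mulr_ge0 // ltW.
have a1 : al * (c * level N) <= lnn N.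
  by apply: le_trans x1; rewrite ler_piMl.
have jC0 : 0 <= j%:R * C by rewrite mulr_ge0.
split; first by rewrite addr_ge0.
have fj : 1 <= j`!%:R :> R by rewrite ler1n fact_gt0.
apply: (@le_trans _ _ ((al * (c * level N) + j%:R * C) ^+ j)).
  by rewrite ler_pdivrMr ?(lt_le_trans ltr01) // ler_peMr // exprn_ge0 // addr_ge0.
apply: lerXn2r; [by rewrite nnegrE addr_ge0|by rewrite nnegrE mulr_ge0 // addr_ge0|].
rewrite mulrDl mul1r; apply: lerD => //.
by rewrite ler_peMr.
Qed.

Definition B0_const : R := F 0%N * ED * (1 + k%:R * C) ^+ k.

Lemma B0_const_ge0 : 0 <= B0_const.
Proof.
rewrite /B0_const; apply: mulr_ge0; first by rewrite mulr_ge0 // (le_trans ler01).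
by rewrite exprn_ge0 // addr_ge0 // mulr_ge0.
Qed.

Lemma B0_le M N : 1 <= lnn N -> B0 D M k (level N) F ^+ 2 <= B0_const ^+ 2 * lnn N ^+ (2 * k).
Proof.
move=> l1; have L0 : 0 <= level N by rewrite mulr_ge0 ?lnn_ge0 // divr_ge0 // ltW.
rewrite mulnC exprM -exprMn.
have b0 : 0 <= B0 D M k (level N) F by apply: (B0_ge0 M k1 kD (level N) 0 F_dec Fn0).
apply: lerXn2r; rewrite ?nnegrE //.
  by rewrite mulr_ge0 ?B0_const_ge0 // exprn_ge0 // lnn_ge0.
rewrite /B0 /B0_const -!mulrA; apply: ler_wpM2l => //.
apply: le_trans (msum_sh_le M k1 kD L0) _.
have [h1 h2] := affine_pow_le k (ler0n R 1) (ler_nat R 1 2) l1.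
rewrite mul1r in h1 h2.
rewrite -exprMn; apply: ler_pM => //.
  by rewrite (le_trans _ (euler_excess_ge1 M k1 kD)).
by rewrite divr_ge0 // exprn_ge0.
Qed.

Lemma exp_lnn N : (0 < N)%N -> exp (lnn N) = N%:R.
Proof. by move=> N0; rewrite /lnn lnK // ltr0n. Qed.

Lemma errsum_pow_ev (c : R) : 0 <= c -> rho + c < 1 ->
  exists l0 : R, forall M N, l0 <= lnn N -> (0 < N)%N ->
    exp (c * lnn N) * (k%:R * (B0 D M k (level N) F ^+ 2 *
      errsum D (level N) (fun U : {set 'I_M} => k%:R ^+ #|U|))) <= N%:R.
Proof.
move=> c0 rc.
pose m := (2 * k + 16 * k)%N.
pose K : R := k%:R * (B0_const ^+ 2 * (1 + (16 * k)%:R * C) ^+ (16 * k)).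
have eta0 : 0 < 1 - (rho + c) by rewrite subr_gt0.
have [u0 u00 hu] := poly_le_exp K m eta0.
exists (Num.max 1 u0) => M N; rewrite ge_max => /andP[l1 lu] N0.
have l0 : 0 <= lnn N by apply: lnn_ge0.
have L0 : 0 <= level N by rewrite mulr_ge0 // divr_ge0 // ltW.
have [h1 h2] := affine_pow_le (16 * k) (ler0n R 2) (lexx (2 : R)) l1.
have hE := errsum_pow_le D M k L0.
have e2L : 2 * level N = rho * lnn N by rewrite /level; field.
have hE2 : errsum D (level N) (fun U : {set 'I_M} => k%:R ^+ #|U|) <=
    exp (rho * lnn N) * ((1 + (16 * k)%:R * C) * lnn N) ^+ (16 * k).
  apply: le_trans hE _; rewrite [exp (2 * level N)](_ : _ = exp (rho * lnn N)); last by rewrite e2L.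
  by apply: ler_wpM2l => //; apply/ltW/expR_gt0.
have hB := B0_le M l1.
have er0 : 0 <= errsum D (level N) (fun U : {set 'I_M} => k%:R ^+ #|U|).
  by apply: sumr_ge0 => U _; rewrite mulr_ge0 // exprn_ge0.
have ec0 : 0 <= exp (c * lnn N) by apply/ltW/expR_gt0.
have er1 : 0 <= exp (rho * lnn N) by apply/ltW/expR_gt0.
apply: (@le_trans _ _ (exp (c * lnn N) * (k%:R * ((B0_const ^+ 2 * lnn N ^+ (2 * k)) *
   (exp (rho * lnn N) * ((1 + (16 * k)%:R * C) * lnn N) ^+ (16 * k)))))).
  apply: ler_wpM2l => //; apply: ler_wpM2l => //.
  by apply: ler_pM => //; rewrite sqr_ge0.
have -> : exp (c * lnn N) * (k%:R * ((B0_const ^+ 2 * lnn N ^+ (2 * k)) *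
   (exp (rho * lnn N) * ((1 + (16 * k)%:R * C) * lnn N) ^+ (16 * k)))) =
   (K * lnn N ^+ m) * (exp (c * lnn N) * exp (rho * lnn N)).
  rewrite /K /m [(_ * lnn N) ^+ _]exprMn [lnn N ^+ (2 * k + _)]exprD.
  move: (lnn N ^+ (2 * k)) (lnn N ^+ (16 * k)) ((1 + _) ^+ (16 * k)) => x1 x2 x3.
  by move: (exp _) (exp _) (B0_const ^+ 2) => x4 x5 x6; ring.
apply: le_trans (ler_wpM2r _ (hu _ lu)) _; first by rewrite mulr_ge0.
rewrite -!expR_add -(exp_lnn N0) le_eqVlt; apply/orP; left; apply/eqP; congr exp.
ring.
Qed.

Lemma errsum_mean_ev (G : nat -> nat -> R) (tau : R) : rho < tau ->
  (forall X q, 0 <= G X q) ->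
  (forall M X (U : {set 'I_M}), U \subset P M -> (W * setprod U <= X)%N -> 1 <= lnn X ->
     G X (W * setprod U)%N <= 4 * X%:R * lnn X * 2 ^+ #|U| / (setprod U)%:R) ->
  (forall a, (0 < a)%N -> exists2 K : R, 0 <= K & forall X, (2 <= X)%N ->
    \sum_(1 <= q < X.+1 | lnn q <= tau * lnn X) G X q <= K * (X%:R / lnn X ^+ a)) ->
  exists l0 : R, forall M N X, l0 <= lnn N -> (0 < N)%N -> (N <= X <= 3 * N)%N ->
    B0 D M k (level N) F ^+ 2 *
      errsum D (level N) (fun U : {set 'I_M} => k%:R ^+ #|U| * G X (W * setprod U)%N) <= N%:R.
Proof.
move=> rt G0 hZ hT.
pose J := (2 * (16 * k) ^ 2)%N; pose y := (2 * k + J + 2)%N; pose a := (y + 2 * k + 1)%N.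
have [|K K0 hK] := hT a; first by rewrite /a addn1.
pose Kt : R := B0_const ^+ 2 * (24 * (1 + J%:R * C) ^+ J + 3 * K).
pose gam : R := Num.min tau 1 - rho.
have gam0 : 0 < gam by rewrite subr_gt0 lt_min rt.
exists (Num.max 2 (Num.max Kt (lnn W / gam))) => M N X.
rewrite !ge_max => /and3P[l2 lK lW] N0 /andP[NX X3].
have l1 : 1 <= lnn N by apply: le_trans l2; rewrite ler1n.
have l0 : 0 < lnn N := lt_le_trans ltr01 l1.
have L0 : 0 <= level N by rewrite mulr_ge0 ?(ltW l0) // divr_ge0 // ltW.
have lNX : lnn N <= lnn X by apply: ler_lnn.
have lX1 : 1 <= lnn X by apply: le_trans lNX.
have lX0 : 0 < lnn X := lt_le_trans ltr01 lX1.
have X0 : (0 < X)%N by apply: leq_trans NX.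
have X2 : (2 <= X)%N.
  have [//|X1] := ltnP 1 X.
  have e1 : X = 1%N by apply/eqP; rewrite eqn_leq X1 X0.
  by move: lX0; rewrite e1 lnn1 ltxx.
have l3 : lnn 3 <= 2.
  have := @ln_le_subr1 3%:R; rewrite /lnn => h; apply: le_trans (h _) _ => //.
  by rewrite lerBlDr -[leRHS]/(2%:R + 1%:R) -natrD ler_nat.
have lX2 : lnn X <= 2 * lnn N.
  apply: (@le_trans _ _ (lnn (3 * N))); first exact: ler_lnn.
  rewrite lnnM //; lra.
have X3' : X%:R <= 3 * N%:R :> R by rewrite -natrM ler_nat.
have e2L : 2 * level N = rho * lnn N by rewrite /level; field.
have hW (U : {set 'I_M}) : U \subset P M -> \sum_(p in U) lns p <= 2 * level N ->
    lnn (W * setprod U) <= Num.min tau 1 * lnn N.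
  move=> UP sU; have hp : {in U, forall p : 'I_M, prime p} by move=> p /(subsetP UP)/prime_rangeP.
  rewrite lnnM ?primorial_gt0 ?setprod_gt0 // lnn_setprod //.
  move: lW; rewrite ler_pdivrMr // => lW; rewrite e2L in sU.
  have -> : Num.min tau 1 = gam + rho by rewrite /gam subrK.
  by rewrite mulrDl; apply: lerD => //; rewrite mulrC.
have hWX (U : {set 'I_M}) : U \subset P M -> \sum_(p in U) lns p <= 2 * level N -> (W * setprod U <= X)%N.
  move=> UP sU; have hp : {in U, forall p : 'I_M, prime p} by move=> p /(subsetP UP)/prime_rangeP.
  have q0 : (0 < W * setprod U)%N by rewrite muln_gt0 primorial_gt0 setprod_gt0.
  have h := hW U UP sU; rewrite -(ler_nat R) -(exp_lnn q0) -(exp_lnn X0); apply: ler_expR.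
  apply: le_trans h _; apply: le_trans lNX; rewrite ler_piMl ?(ltW l0) // ge_min lexx orbT.
  by [].
have hG (U : {set 'I_M}) : U \subset P M -> \sum_(p in U) lns p <= 2 * level N ->
    G X (W * setprod U)%N <= 24 * N%:R * lnn N * 2 ^+ #|U| / (setprod U)%:R.
  move=> UP sU; apply: le_trans (hZ M X U UP (hWX U UP sU) lX1) _.
  apply: ler_wpM2r; first by rewrite invr_ge0.
  apply: ler_wpM2r; first by rewrite exprn_ge0.
  have -> : 24 * N%:R * lnn N = 4 * (3 * N%:R) * (2 * lnn N) by ring.
  apply: ler_pM => //; rewrite ?mulr_ge0 ?(ltW lX0) //.
  by apply: ler_wpM2l.
have hsum : \sum_(U in powerset (P M) | \sum_(p in U) lns p <= 2 * level N) G X (W * setprod U)%N <=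
    K * (3 * N%:R / lnn N ^+ a).
  apply: (@le_trans _ _ (\sum_(1 <= q < X.+1 | lnn q <= tau * lnn X) G X q)).
    apply: (sum_moduli_le (b := fun q => lnn q <= tau * lnn X)) => // U UP sU.
    rewrite hWX //=; apply: le_trans (hW U UP sU) _.
    have t0 : 0 < tau by apply: lt_trans rt.
    apply: (@le_trans _ _ (tau * lnn N)); last by apply: ler_wpM2l => //; exact: ltW.
    by apply: ler_wpM2r; [exact: ltW|rewrite ge_min lexx].
  apply: le_trans (hK X X2) _; apply: ler_wpM2l => //.
  apply: ler_pM => //; first by rewrite invr_ge0 exprn_ge0 // ltW.
  rewrite lef_pV2 ?posrE ?exprn_gt0 //.
  by apply: lerXn2r => //; rewrite nnegrE ltW.
have Y0 : 0 < lnn N ^+ y by rewrite exprn_gt0.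
have hE := errsum_mean_le k L0 Y0 (G0 X) hG hsum.
have [h1 h2] := affine_pow_le J (ler0n R 2) (lexx (2 : R)) l1.
have hB := B0_le M l1.
set Er := errsum _ _ _ in hE *.
have Er0 : 0 <= Er by apply: sumr_ge0 => U _; rewrite !mulr_ge0 ?exprn_ge0.
have hE2 : Er <= 24 * N%:R * lnn N / lnn N ^+ y * ((1 + J%:R * C) * lnn N) ^+ J +
    lnn N ^+ y * (K * (3 * N%:R / lnn N ^+ a)).
  apply: le_trans hE _; rewrite lerD2r; apply: ler_wpM2l => //.
  by rewrite divr_ge0 ?mulr_ge0 // ?ltW.
apply: (@le_trans _ _ ((B0_const ^+ 2 * lnn N ^+ (2 * k)) *
   (24 * N%:R * lnn N / lnn N ^+ y * ((1 + J%:R * C) * lnn N) ^+ J +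
    lnn N ^+ y * (K * (3 * N%:R / lnn N ^+ a))))).
  by apply: ler_pM => //; rewrite sqr_ge0.
have -> : (B0_const ^+ 2 * lnn N ^+ (2 * k)) *
   (24 * N%:R * lnn N / lnn N ^+ y * ((1 + J%:R * C) * lnn N) ^+ J +
    lnn N ^+ y * (K * (3 * N%:R / lnn N ^+ a))) = N%:R * (Kt / lnn N).
  rewrite /Kt /a /y [((1 + _) * _) ^+ J]exprMn !exprD expr1.
  by field; rewrite !gt_eqF // ?exprn_gt0.
by rewrite ler_piMr // ler_pdivrMr // mul1r.
Qed.

Lemma prime_AP_max_trivial M X (U : {set 'I_M}) : U \subset P M -> (W * setprod U <= X)%N ->
  1 <= lnn X -> prime_AP_max X (W * setprod U) <= 4 * X%:R * lnn X * 2 ^+ #|U| / (setprod U)%:R.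
Proof.
move=> UP hX l1; have hp : {in U, forall p : 'I_M, prime p} by move=> p /(subsetP UP)/prime_rangeP.
have s0 : 0 < (setprod U)%:R :> R by rewrite ltr0n setprod_gt0.
have q0 : (0 < W * setprod U)%N by rewrite muln_gt0 primorial_gt0 setprod_gt0.
have qr0 : 0 < (W * setprod U)%:R :> R by rewrite ltr0n.
have l0 : 0 <= lnn X by apply: lnn_ge0.
have t2 : 1 <= 2 ^+ #|U| :> R by rewrite exprn_ege1 // ler1n.
apply: le_trans (prime_AP_max_le q0 hX) _.
have h1 : 3 * X%:R / (W * setprod U)%:R * lnn X <= 3 * X%:R * lnn X * 2 ^+ #|U| / (setprod U)%:R.
  rewrite mulrAC; apply: ler_pM; rewrite ?invr_ge0 ?mulr_ge0 //.
    by rewrite ler_peMr // !mulr_ge0.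
  by rewrite lef_pV2 ?posrE // ler_nat leq_pmull // primorial_gt0.
have h2 : X%:R / (totient (W * setprod U))%:R <= X%:R * lnn X * 2 ^+ #|U| / (setprod U)%:R.
  have t0 : 0 < (totient (W * setprod U))%:R :> R by rewrite ltr0n totient_gt0.
  rewrite ler_pdivrMr // mulrAC ler_pdivlMr //.
  have h := totient_setprod_ge UP.
  apply: le_trans (ler_wpM2l (ler0n R X) h) _.
  rewrite -!mulrA; apply: ler_wpM2l => //; rewrite mulrA.
  by rewrite -mulrA ler_peMl // mulr_ge0 // exprn_ge0.
apply: le_trans (lerD h1 h2) _; rewrite le_eqVlt; apply/orP; left; apply/eqP; ring.
Qed.

Lemma liouville_AP_max_trivial M X (U : {set 'I_M}) : U \subset P M -> (W * setprod U <= X)%N ->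
  1 <= lnn X -> liouville_AP_max X (W * setprod U) <= 4 * X%:R * lnn X * 2 ^+ #|U| / (setprod U)%:R.
Proof.
move=> UP hX l1; have hp : {in U, forall p : 'I_M, prime p} by move=> p /(subsetP UP)/prime_rangeP.
have s0 : 0 < (setprod U)%:R :> R by rewrite ltr0n setprod_gt0.
have q0 : (0 < W * setprod U)%N by rewrite muln_gt0 primorial_gt0 setprod_gt0.
have qr0 : 0 < (W * setprod U)%:R :> R by rewrite ltr0n.
have l0 : 0 <= lnn X by apply: lnn_ge0.
have t2 : 1 <= 2 ^+ #|U| :> R by rewrite exprn_ege1 // ler1n.
apply: le_trans (liouville_AP_max_le q0 hX) _.
apply: ler_pM; rewrite ?invr_ge0 ?mulr_ge0 //; last first.
  by rewrite lef_pV2 ?posrE // ler_nat leq_pmull // primorial_gt0.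
have h3 : 1 <= lnn X * 2 ^+ #|U| by rewrite mulr_ege1.
have x0 : 0 <= X%:R :> R by [].
rewrite -mulrA; apply: (@le_trans _ _ (4 * X%:R * 1)); first by rewrite mulr1; lra.
by apply: ler_wpM2l => //; rewrite mulr_ge0.
Qed.

End EventualErrors.

Lemma admissible_residue (hs : seq nat) D :
  (forall p, prime p -> exists v, {in hs, forall h, ~~ (p %| v + h)%N}) ->
  exists v, {in hs, forall h, coprime (primorial D) (v + h)}.
Proof.
move=> adm; elim: D => [|D [v hv]].
  by exists 0%N => h _; rewrite /primorial big_mkcond big_nat1 coprime1n.
have e : primorial D.+1 = (primorial D * if prime D.+1 then D.+1 else 1)%N.
  by rewrite /primorial big_mkcond big_nat_recr //= -big_mkcond.
case: (boolP (prime D.+1)) e => [pD|_] e; last by exists v; rewrite e muln1.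
have [u hu] := adm _ pD.
have cop : coprime (primorial D) D.+1.
  by apply/coprime_primorialP => // q pq; rewrite dvdn_prime2 // => /eqP ->.
exists (chinese (primorial D) D.+1 v u) => h hh; rewrite e coprimeMl; apply/andP; split.
  by rewrite -coprime_modr -modnDml chinese_modl // modnDml coprime_modr; apply: hv.
by rewrite prime_coprime // /dvdn -modnDml chinese_modr // modnDml; apply: hu.
Qed.

Lemma i_mean_ge0 k n (F : nat -> R) : (forall i, F i.+1 <= F i) -> F n = 0 -> 0 <= i_mean k n F.
Proof.
move=> Fd Fn; have F_ge0 i : (i <= n)%N -> 0 <= F i.
  move=> iln; have h m : F (m + i)%N <= F i by elim: m => // m; apply: le_trans; apply: Fd.
  by rewrite -Fn -{1}(subnK iln).
apply: sumr_ge0 => i _; rewrite mulr_ge0 ?exprn_ge0 ?divr_ge0 // subr_ge0.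
by apply: lerXn2r; rewrite ?nnegrE ?F_ge0 // ltnW.
Qed.

Lemma exists_nat_gt (x : R) : exists n : nat, x < n%:R.
Proof.
have [x0|x0] := leP 0 x; last by exists 0%N.
by exists (Num.truncn x).+1; have /andP[] := truncn_itv x0.
Qed.

Lemma choose_sifting_limit (k D0 : nat) (eps : R) : (1 < k)%N -> 0 < eps ->
  exists D, [/\ (2 * k <= D)%N, (D0 <= D)%N & forall M, euler_excess M k D <= 1 + eps].
Proof.
move=> k1 e0; have [d hd] := exists_nat_gt (2 * k%:R ^+ 2 * (1 + eps) / eps).
pose D := (d + 2 * k + D0)%N; exists D; split; try lia.
have kD : (2 * k <= D)%N by rewrite /D; lia.
move=> M; have h := euler_excess_le M k1 kD; have E1 := euler_excess_ge1 M k1 kD.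
set E := euler_excess M k D in h E1 *; set x := 2 * k%:R ^+ 2 in h hd.
have D0' : 0 < D%:R :> R by rewrite ltr0n; lia.
have dD : d%:R <= D%:R :> R by rewrite ler_nat; lia.
have hx : x * (1 + eps) < D%:R * eps.
  by rewrite -ltr_pdivrMr //; apply: lt_le_trans dD.
have hy : x / D%:R * (1 + eps) < eps by rewrite mulrAC ltr_pdivrMr // [eps * _]mulrC.
move: (x / D%:R) h hy => y h hy.
rewrite leNgt; apply/negP => hE; have y1 : 0 < 1 - y.
  rewrite subr_gt0 -(ltr_pM2r (_ : 0 < 1 + eps)); last by rewrite addr_gt0.
  by apply: (lt_trans hy); rewrite mul1r ltrDr.
have : (1 + eps) * (1 - y) < E * (1 - y) by rewrite ltr_pM2r.
move: hy h; lra.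
Qed.

Lemma good_infinitely k n (hs : seq nat) (F : nat -> R) (theta rho : R) :
  (1 < k)%N -> (0 < n)%N -> uniq hs -> size hs = k ->
  (forall i, F i.+1 <= F i) -> F n = 0 ->
  (forall p, prime p -> exists v, {in hs, forall h, ~~ (p %| v + h)%N}) ->
  condA theta -> condB theta -> 0 < rho -> rho < 1 -> rho < theta ->
  n%:R ^+ 2 * i_mean k n F < (k%:R - 1) * k%:R * rho * j_mean k n F ->
  exists c : R, 0 < c /\ exists N0 : nat, forall N, (N0 <= N)%N -> exists m h h' : nat,
    [/\ (N < m <= N + N)%N, [/\ h \in hs, h' \in hs & h != h'], prime (m + h),
     liouville (m + h') = -1 & forall q, prime q -> (q %| m + h')%N -> c * lnn N < lnn q].
Proof.
move=> k1 n0 uhs shs F_dec Fn0 adm hA hB rho0 rho1 rt hnum.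
have n0r : 0 < n%:R :> R by rewrite ltr0n.
have k0r : 1 < k%:R :> R by rewrite ltr1n.
have fk : 0 < (k.-1)`!%:R :> R by rewrite ltr0n fact_gt0.
have fkE : (k`!)%:R = k%:R * (k.-1)`!%:R :> R by rewrite -natrM -{1}(prednK (ltnW k1)) factS prednK // ltnW.
set i0 := i_mean k n F in hnum; set j0 := j_mean k n F in hnum.
have i00 : 0 <= i0 by apply: i_mean_ge0.
pose A : R := (k%:R - 1) * k%:R * (j0 / (n%:R ^+ 2 * k.-1`!%:R)).
pose r : R := 2 / rho.
have r0 : 0 < r by rewrite divr_gt0.
pose b : R := k%:R / 2 * (i0 / k`!%:R).
have rb0 : 0 <= r * b.
  by apply: mulr_ge0; [exact: ltW|rewrite mulr_ge0 ?divr_ge0].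
have gap1 : r * b < A.
  have -> : r * b = i0 / (rho * k.-1`!%:R).
    by rewrite /r /b fkE; field; rewrite !gt_eqF // (lt_trans ltr01).
  have -> : A = (k%:R - 1) * k%:R * rho * j0 / (n%:R ^+ 2) / (rho * k.-1`!%:R).
    by rewrite /A; field; rewrite !gt_eqF.
  rewrite ltr_pM2r ?invr_gt0 ?mulr_gt0 // ltr_pdivlMr ?exprn_gt0 //.
  by rewrite mulrC.
pose eps : R := (A - r * b) / (2 * (r * b + 1)).
have eps0 : 0 < eps by rewrite divr_gt0 ?subr_gt0 // mulr_gt0 // ltr_wpDl.
pose D0 := (\max_(h <- hs) h)%N.
have [D [kD D0D hED]] := choose_sifting_limit D0 k1 eps0.
have hsD : {in hs, forall h, (h <= D)%N}.
  by move=> h hh; apply: leq_trans D0D; rewrite /D0 (big_rem h hh) /= leq_maxl.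
have [v0 hv0] := admissible_residue D adm.
pose ED : R := 1 + eps.
pose gap : R := A - r * (ED * b).
have gap0 : 0 < gap.
  rewrite /gap /ED; have : eps * (r * b) <= (A - r * b) / 2.
    rewrite /eps ler_pdivlMr // mulrAC -mulrA mulrAC ler_pdivrMr; last by rewrite mulr_gt0 // ltr_wpDl.
    have d0 : 0 <= A - r * b by rewrite subr_ge0 ltW.
    by have := mulr_ge0 d0 rb0; lra.
  lra.
have theta0 : 0 < theta by apply: lt_trans rt.
have [Kc Kc0 hKc] := prime_recip_sum_le hA theta0.
pose kap := small_const D k F ED Kc.
pose c : R := Num.min (rho / 4) (Num.min ((1 - rho) / 2) (gap / (4 * (r * r * (`|kap| + 1))))).
have kap1 : 0 < `|kap| + 1 by rewrite ltr_wpDl.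
have c0 : 0 < c.
  rewrite !lt_min; apply/and3P; split; apply: divr_gt0; rewrite ?subr_gt0 //.
    by rewrite -subr_gt0.
  by apply: mulr_gt0 => //; apply: mulr_gt0 kap1; apply: mulr_gt0.
have c_rho : c <= rho / 4 by rewrite ge_min lexx.
have c_1 : rho + c < 1.
  have : c <= (1 - rho) / 2 by rewrite !ge_min lexx orbT.
  by move: rho1; lra.
have c_gap : r * (c * (r * kap)) <= gap / 4.
  have h : c <= gap / (4 * (r * r * (`|kap| + 1))) by rewrite !ge_min lexx !orbT.
  have rr : 0 < r * r * (`|kap| + 1) by apply: mulr_gt0 kap1; apply: mulr_gt0.
  have h2 : c * (r * r * (`|kap| + 1)) <= gap / 4.
    have rr4 : 0 < 4 * (r * r * (`|kap| + 1)) by apply: mulr_gt0.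
    move: h; rewrite ler_pdivlMr // ler_pdivlMr // => h.
    by apply: le_trans h; rewrite le_eqVlt; apply/orP; left; apply/eqP; ring.
  apply: le_trans h2.
  have -> : r * (c * (r * kap)) = c * (r * r * kap) by ring.
  apply: ler_wpM2l; first exact: (ltW c0).
  apply: ler_wpM2l; first exact: (mulr_ge0 (ltW r0) (ltW r0)).
  by apply: (le_trans (ler_norm kap)); rewrite lerDl.
exists c; split => //.
have [l1 hl1] := errsum_pow_ev k1 kD rho0 rho1 F_dec Fn0 hED (ltW c0) c_1.
have rho_c0 : rho + 0 < 1 by rewrite addr0.
pose eps' : R := (theta - rho) / 2.
have eps'0 : 0 < eps' by rewrite divr_gt0 // subr_gt0.
have rtau : rho < theta - eps' by move: rt; rewrite /eps'; lra.
have [l2 hl2] := errsum_mean_ev k1 kD rho0 rho1 F_dec Fn0 hED rtau prime_AP_max_ge0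
   (@prime_AP_max_trivial D) (fun a => @level_A theta eps' a hA eps'0).
have [l3 hl3] := errsum_mean_ev k1 kD rho0 rho1 F_dec Fn0 hED rtau liouville_AP_max_ge0
   (@liouville_AP_max_trivial D) (fun a => @level_B theta eps' a hB eps'0).
have al0 := mertens_gt0 D.
pose e1 := err_const1 D k n F; pose e2 := err_const2 D k F ED Kc.
pose b' : R := k%:R / 2 * (ED / k`!%:R * i0).
have bb' : b' = ED * b by rewrite /b' /b; ring.
pose K7 : R := `|e1| + r * `|e2| + 2 * (`|b'| + `|e2| + `|c * (r * kap)|).
pose L0 : R := Num.max 1 (Num.max (k%:R * dim_const D / mertens D) (Num.max (lnn D) (4 * K7 / gap))).
pose l0 : R := Num.max 1 (Num.max (lnn D) (Num.max l1 (Num.max l2 (Num.max l3 (r * L0))))).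
exists (Num.truncn (exp l0)).+1 => N hN.
have N1 : (0 < N)%N by apply: leq_trans hN.
have lN : l0 <= lnn N.
  have /andP[_ h] := truncn_itv (ltW (expR_gt0 l0)).
  rewrite -[leLHS]ln_exp; apply: ler_lnR; first exact: expR_gt0.
  by apply: le_trans (ltW h) _; rewrite ler_nat.
move: (lN); rewrite /l0 !ge_max => /and5P[lN1 lND ll1 ll2 /andP[ll3 llL]].
pose L := level rho N.
have rL : r * L = lnn N by rewrite /r /L /level; field; rewrite gt_eqF.
have LL0 : L0 <= L by rewrite -(ler_pM2l r0) rL.
move: (LL0); rewrite /L0 !ge_max => /and4P[L1 LC LD LK].
have L0' : 0 < L := lt_le_trans ltr01 L1.
pose M := (Num.truncn (exp L)).+1.
have Lle : L <= lnn N.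
  by rewrite /L /level ler_piMl ?lnn_ge0 // ler_pdivrMr // mul1r; move: rho1; lra.
have MN : (M <= N.+1)%N.
  rewrite ltnS -(ler_nat R) -(exp_lnn N1); apply: le_trans (ler_expR Lle).
  by have /andP[] := truncn_itv (ltW (expR_gt0 L)).
have Dpos : (0 < D)%N by apply: leq_trans kD; rewrite mul2n double_gt0 ltnW.
have DM : (D < M)%N by rewrite ltnS trunc_expRP.
have DN : (D <= N)%N.
  by rewrite -(ler_nat R) -(exp_lnn N1) -(exp_lnn Dpos); apply: ler_expR.
have LM : (Num.truncn (exp L) < M)%N by [].
pose del : R := L / n%:R.
have del0 : 0 <= del by rewrite divr_ge0 // ltW.
have ndel : n%:R * del = L by rewrite /del mulrC divfK // gt_eqF.
have hCL : k%:R * dim_const D <= mertens D * L by move: LC; rewrite ler_pdivrMr // [L * _]mulrC.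
pose z : R := c * r * L.
have zE : z = c * lnn N by rewrite /z -mulrA rL.
have z0 : 0 <= z by rewrite zE mulr_ge0 ?lnn_ge0 // ltW.
have zL : z < L.
  rewrite zE /L /level ltr_pM2r; last exact: lt_le_trans lN1.
  by move: c_rho rho0; lra.
have B2 : 0 <= B0 D M k L F ^+ 2 by apply: sqr_ge0.
have B2e (Er : {set 'I_M} -> R) : (forall U, 0 <= Er U) -> 0 <= errsum D L Er.
  by move=> h; apply: sumr_ge0 => U _; rewrite mulr_ge0 ?exprn_ge0.
have hpow := hl1 M N ll1 N1; rewrite -/L in hpow.
set X1 := B0 D M k L F ^+ 2 * errsum D L _ in hpow.
have X10 : 0 <= X1 by apply: mulr_ge0 => //; apply: B2e => U; rewrite exprn_ge0.
have ez1 : 1 <= exp (c * lnn N).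
  by apply: le_trans (expR_ge1Dx _); rewrite lerDl mulr_ge0 ?lnn_ge0 // ltW.
have he1 : X1 <= N%:R.
  apply: le_trans hpow; rewrite mulrA ler_peMl // mulr_ege1 // ltW //.
have he4 : \sum_(p in prime_range M D | lns p <= z) B0 D M k L F ^+ 2 *
    errsum D L (fun U : {set 'I_M} => k%:R ^+ #|U|.+1) <= N%:R.
  have -> : B0 D M k L F ^+ 2 * errsum D L (fun U : {set 'I_M} => k%:R ^+ #|U|.+1) = k%:R * X1.
    rewrite /X1 mulrCA; congr (_ * _); rewrite /errsum mulr_sumr; apply: eq_bigr => U _.
    by rewrite exprS mulrCA.
  apply: le_trans hpow; rewrite -zE sumr_const -[leLHS]mulr_natl; apply: ler_wpM2r.
    by rewrite mulr_ge0.
  apply: (@le_trans _ _ (Num.truncn (exp z))%:R); last first.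
    by have /andP[] := truncn_itv (ltW (expR_gt0 z)).
  rewrite ler_nat -[leqRHS]card_ord.
  have hx (p : 'I_M) : (p \in prime_range M D) && (lns p <= z) -> (p.-1 < Num.truncn (exp z))%N.
    by move=> /andP[/prime_rangeP pp]; rewrite prednK ?prime_gt0 // trunc_expRP ?prime_gt0.
  have T0 : (0 < Num.truncn (exp z))%N by rewrite trunc_expRP // lnn1.
  pose f (p : 'I_M) : 'I_(Num.truncn (exp z)) := insubd (Ordinal T0) p.-1.
  have fE (p : 'I_M) : (p \in prime_range M D) && (lns p <= z) -> (f p).+1 = p.
    move=> hp; rewrite /f /= val_insubd hx // prednK //.
    by case/andP: hp => /prime_rangeP/prime_gt0.
  apply: (@leq_card_in _ _ f).
    move=> p q; rewrite !unfold_in => hp hq e; apply: val_inj.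
    by rewrite /= -(fE p hp) -(fE q hq) e.
have X3 h : h \in hs -> (N + N + h <= 3 * N)%N by move=> /hsD hD; clear -hD DN; lia.
have X3' h : h \in hs -> (N + h <= 3 * N)%N by move=> /hsD hD; clear -hD DN; lia.
have he2 : {in hs, forall h, B0 D M k L F ^+ 2 * errsum D L (fun U : {set 'I_M} => k%:R ^+ #|U| *
     (prime_AP_max (N + N + h) (primorial D * setprod U) +
      prime_AP_max (N + h) (primorial D * setprod U))) <= 2 * N%:R}.
  move=> h hh.
  have g1 := hl2 M N (N + N + h)%N ll2 N1; rewrite X3 // andbT in g1.
  have g2 := hl2 M N (N + h)%N ll2 N1; rewrite X3' // andbT in g2.
  have := lerD (g1 (leq_trans (leq_addl N N) (leq_addr h _))) (g2 (leq_addr h N)).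
  rewrite -/L -mulrDr /errsum -big_split /= => g.
  have -> : 2 * N%:R = N%:R + N%:R :> R by ring.
  apply: le_trans g; rewrite le_eqVlt; apply/orP; left; apply/eqP; congr (_ * _).
  by rewrite /errsum; apply: eq_bigr => U _; rewrite !mulrDr.
have he3 : {in hs, forall h, B0 D M k L F ^+ 2 * errsum D L (fun U : {set 'I_M} => k%:R ^+ #|U| *
     (2 * liouville_AP_max (N + N + h) (primorial D * setprod U))) <= 2 * N%:R}.
  move=> h hh.
  have g1 := hl3 M N (N + N + h)%N ll3 N1; rewrite X3 // andbT in g1.
  have := ler_wpM2l (ler0n R 2) (g1 (leq_trans (leq_addl N N) (leq_addr h _))); apply: le_trans.
  rewrite -/L le_eqVlt; apply/orP; left; apply/eqP; rewrite mulrCA; congr (_ * _).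
  rewrite /errsum mulr_sumr; apply: eq_bigr => U _.
  by rewrite [k%:R ^+ _ * _]mulrCA [LHS]mulrCA.
have hX : lnn (N + N + D) <= (r + 2 / L) * L.
  have -> : (r + 2 / L) * L = lnn N + 2 by rewrite mulrDl rL divfK // gt_eqF.
  have l3' : lnn 3 <= 2.
    have := @ln_le_subr1 3%:R; rewrite /lnn => h; apply: le_trans (h _) _ => //.
    by rewrite lerBlDr -[leRHS]/(2%:R + 1%:R) -natrD ler_nat.
  apply: (@le_trans _ _ (lnn (3 * N))); first by apply: ler_lnn; clear -DN N1; lia.
  by rewrite lnnM // addrC lerD2l.
pose good N := exists m h h' : nat, [/\ (N < m <= N + N)%N, [/\ h \in hs, h' \in hs & h != h'],
  prime (m + h), liouville (m + h') = -1 &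
  forall q, prime q -> (q %| m + h')%N -> c * lnn N < lnn q].
have [//|ng0] := Classical_Prop.classic (good N).
exfalso.
have ng m : (N < m)%N -> (m <= N + N)%N -> m = v0 %[mod primorial D] -> ~ good_at D M hs z m.
  move=> Nm mN mv [h [h' [hh hh' ne ph [lh hsmall]]]]; apply: ng0.
  exists m, h, h'; split=> //; first by rewrite Nm.
  move=> q pq qm; rewrite -zE.
  have Dq : (D < q)%N.
    rewrite ltnNge -dvdn_primorial //; apply/negP => qW.
    have cop : coprime (primorial D) (m + h').
      by rewrite -coprime_modr -modnDml mv modnDml coprime_modr; apply: hv0.
    have : (q %| gcdn (primorial D) (m + h'))%N by rewrite dvdn_gcd qW.
    by rewrite (eqP cop) dvdn1 => /eqP q1; rewrite q1 in pq.
  have [Mq|qM] := leqP M q.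
    apply: lt_le_trans zL _; rewrite -[leLHS]ln_exp; apply: ler_lnR; first exact: expR_gt0.
    have /andP[_ h1] := truncn_itv (ltW (expR_gt0 L)).
    by apply: le_trans (ltW h1) _; rewrite ler_nat.
  have qP : Ordinal qM \in prime_range M D by rewrite inE /= pq.
  rewrite ltNge; apply/negP => qz; have := hsmall _ qP qz.
  by rewrite inE qP /=; case/negP; apply/hasP; exists h'.
have main := main_inequality k1 kD uhs shs hsD hv0 MN DM N1 L1 LM n0 F_dec Fn0 del0 ndel
  hCL (hED M) (erefl z) he1 he2 he3 he4 (hKc D M z z0) hX ng.
rewrite -/A -/e1 -/e2 -/kap -/b' in main.
have t0 : 0 < L^-1 by rewrite invr_gt0.
have t1 : L^-1 <= 1 by rewrite invf_le1.
have K70 : 0 <= K7.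
  rewrite /K7; apply: addr_ge0; last by rewrite mulr_ge0 // !addr_ge0.
  by apply: addr_ge0 => //; exact: mulr_ge0 (ltW r0) _.
have hK7 : K7 / L <= gap / 4.
  move: LK; rewrite ler_pdivrMr // => LK; rewrite ler_pdivrMr //.
  by rewrite mulrAC ler_pdivlMr // [leLHS]mulrC [gap * _]mulrC.
have up : e1 / L + (r + 2 / L) * (b' + e2 / L + c * (r * kap)) <=
   r * b' + r * (c * (r * kap)) + K7 / L.
  have a1 := ler_norm e1; have a2 := ler_norm e2; have a3 := ler_norm b'.
  have a4 := ler_norm (c * (r * kap)).
  move: (L^-1) t0 t1 a1 a2 a3 a4 => t t0 t1 a1 a2 a3 a4.
  have -> : e1 * t + (r + 2 * t) * (b' + e2 * t + c * (r * kap)) =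
     r * b' + r * (c * (r * kap)) + (e1 + r * e2 + 2 * (b' + e2 * t + c * (r * kap))) * t by ring.
  rewrite lerD2l; apply: ler_wpM2r; first exact: ltW.
  have a5 : r * e2 <= r * `|e2| by apply: ler_wpM2l => //; exact: ltW.
  have a6 : e2 * t <= `|e2|.
    apply: (@le_trans _ _ (`|e2| * t)); first by apply: ler_wpM2r => //; exact: ltW.
    by rewrite ler_piMr.
  rewrite /K7; lra.
have fin := le_trans main up.
move: fin c_gap hK7 gap0; rewrite bb' /gap; lra.
Qed.

(** * Numerical weights and conclusion *)

Delimit Scope Z_scope with coqZ.

Open Scope Z_scope.

Definition quad_weight (n a b c z : Z) : Z := a * n ^ 2 + b * n * (n - z) + c * (n - z) ^ 2.

(* Downward loop on [i], with [z = i], [f = F i] and [t = tailF n F i], accumulating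
   [n ^ k * i_mean] and [n ^ (k - 1) * j_mean]. *)
Fixpoint mean_scan (w : Z -> Z) (k : Z) (i : nat) (z f t accI accJ : Z) : Z * Z :=
  if i is i'.+1 then
    mean_scan w k i' (z - 1) (w z) (t + f)
      (accI + (w z ^ 2 - f ^ 2) * z ^ k) (accJ + ((t + f) ^ 2 - t ^ 2) * z ^ (k - 1))
  else (accI, accJ).

Definition weight_check (n k t a b c : Z) : bool :=
  let IJ := mean_scan (quad_weight n a b c) k (Z.to_nat n) n 0 0 0 0 in
  (0 <=? snd IJ) && (1000 * n * fst IJ <? (k - 1) * k * t * snd IJ).

Close Scope Z_scope.

Definition step_weight (n : nat) (w : Z -> Z) (i : nat) : R :=
  if (i < n)%N then IZR (w (Z.of_nat i.+1)) else 0.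

Lemma IZR_of_nat n : IZR (Z.of_nat n) = n%:R.
Proof. by rewrite -INR_IZR_INZ INRE. Qed.

Lemma IZR_exp z k : IZR (z ^ Z.of_nat k) = IZR z ^+ k.
Proof. by rewrite -pow_IZR RpowE. Qed.

Lemma mean_scanP n w k i f t accI accJ : (i <= n)%N -> (0 < k)%N ->
  IZR f = step_weight n w i -> IZR t = tailF n (step_weight n w) i ->
  let F := step_weight n w in
  let IJ := mean_scan w (Z.of_nat k) i (Z.of_nat i) f t accI accJ in
  IZR (fst IJ) = IZR accI + \sum_(l < i) (F l ^+ 2 - F l.+1 ^+ 2) * l.+1%:R ^+ k /\
  IZR (snd IJ) = IZR accJ +
    \sum_(l < i) (tailF n F l ^+ 2 - tailF n F l.+1 ^+ 2) * l.+1%:R ^+ k.-1.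
Proof.
elim: i f t accI accJ => [|i IH] f t accI accJ iln k0 hf ht; first by rewrite /= !big_ord0 !addr0.
move=> F IJ; rewrite {}/F {}/IJ [mean_scan _ _ _ _ _ _ _ _]/mean_scan -/mean_scan.
have -> : (Z.of_nat i.+1 - 1)%coqZ = Z.of_nat i by lia.
have -> : (Z.of_nat k - 1)%coqZ = Z.of_nat k.-1 by lia.
have hw : IZR (w (Z.of_nat i.+1)) = step_weight n w i by rewrite /step_weight iln.
have htf : IZR (t + f)%coqZ = tailF n (step_weight n w) i.
  rewrite plus_IZR hf ht /tailF RplusE addrC; case: (ltnP i.+1 n) => h; first by rewrite [RHS]big_ltn.
  by rewrite /step_weight ltnNge h add0r !big_geq // ltnW.
move: (Z.of_nat i.+1) (IZR_of_nat i.+1) hw => z hz hw.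
have [-> ->] := IH _ _ (accI + (w z ^ 2 - f ^ 2) * z ^ Z.of_nat k)%coqZ
   (accJ + ((t + f) ^ 2 - t ^ 2) * z ^ Z.of_nat k.-1)%coqZ (ltnW iln) k0 hw htf.
split; rewrite big_ord_recr /= plus_IZR mult_IZR minus_IZR IZR_exp.
  by rewrite !(IZR_exp _ 2) hw hf hz ?RplusE ?RminusE ?RmultE addrA addrAC.
by rewrite !(IZR_exp _ 2) htf ht hz ?RplusE ?RminusE ?RmultE addrA addrAC.
Qed.

Lemma weight_checkP n k t a b c (rho : R) : (0 < n)%N -> (0 < k)%N ->
  weight_check (Z.of_nat n) (Z.of_nat k) t a b c -> IZR t / 1000 < rho ->
  let F := step_weight n (quad_weight (Z.of_nat n) a b c) in
  n%:R ^+ 2 * i_mean k n F < (k%:R - 1) * k%:R * rho * j_mean k n F.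
Proof.
move=> n0 k0; rewrite /weight_check; set w := quad_weight _ _ _ _.
have Fn : step_weight n w n = 0 by rewrite /step_weight ltnn.
have Tn : tailF n (step_weight n w) n = 0 by rewrite /tailF big_geq.
rewrite Znat.Nat2Z.id; case/andP; have := @mean_scanP n w k n 0%coqZ 0%coqZ 0%coqZ 0%coqZ (leqnn n) k0 (esym Fn) (esym Tn).
case: (mean_scan _ _ _ _ _ _ _ _) => I J; cbn [fst snd] => -[hI hJ].
move=> /Z.leb_le/IZR_le/RleP J0 /Z.ltb_lt/IZR_lt/RltP; rewrite !mult_IZR minus_IZR !IZR_of_nat.
rewrite (_ : IZR 1000 = 1000%:R); last by rewrite -IZR_of_nat.
rewrite (_ : IZR 1 = 1); last by rewrite -[RHS](IZR_of_nat 1).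
rewrite ?RmultE ?RminusE => hIJ ht.
have n0r : 0 < n%:R :> R by rewrite ltr0n.
set F := step_weight n w in hI hJ *.
have -> : i_mean k n F = IZR I / n%:R ^+ k.
  rewrite hI add0r mulr_suml; apply: eq_bigr => i _.
  by rewrite expr_div_n mulrA.
have -> : j_mean k n F = IZR J / n%:R ^+ k.-1.
  rewrite hJ add0r mulr_suml; apply: eq_bigr => i _.
  by rewrite expr_div_n mulrA.
have nk : n%:R ^+ k = n%:R * n%:R ^+ k.-1 :> R by rewrite -exprS prednK.
have nk0 : 0 < n%:R ^+ k.-1 :> R by rewrite exprn_gt0.
rewrite nk; set x := n%:R ^+ k.-1 in nk0 *.
have -> : n%:R ^+ 2 * (IZR I / (n%:R * x)) = n%:R * IZR I / x.
  by field; rewrite !gt_eqF.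
rewrite mulrA ltr_pM2r ?invr_gt0 //.
have hk : 0 <= (k%:R - 1) * k%:R :> R by rewrite mulr_ge0 // subr_ge0 ler1n.
have h1 : (k%:R - 1) * k%:R * (IZR t / 1000) * IZR J <= (k%:R - 1) * k%:R * rho * IZR J.
  by apply: ler_wpM2r => //; apply: ler_wpM2l => //; apply: ltW.
apply: lt_le_trans h1; move: hIJ; lra.
Qed.

Lemma step_weight_dec n (a b c : nat) :
  let F := step_weight n (quad_weight (Z.of_nat n) (Z.of_nat a) (Z.of_nat b) (Z.of_nat c)) in
  forall i, F i.+1 <= F i.
Proof.
move=> F i; rewrite /F /step_weight; case: (ltnP i n) => [iln|nli]; last by rewrite ltnNge ltnW.
case: ltnP => h; apply/RleP/IZR_le; rewrite /quad_weight; nia.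
Qed.

Lemma bigOmega_lnn_le n (x : R) : (0 < n)%N ->
  (forall q, prime q -> (q %| n)%N -> x <= lnn q) -> (bigOmega n)%:R * x <= lnn n.
Proof.
move=> n0 hx; have -> : lnn n = \sum_(p <- primes n) (logn p n)%:R * lnn p.
  rewrite {1}(prod_prime_decomp n0) prime_decompE big_map.
  have : {subset primes n <= prime} by move=> p; rewrite mem_primes => /andP[].
  elim: (primes n) => [|p s IH] ps; first by rewrite !big_nil lnn1.
  have sub : {subset s <= prime} by move=> q qs; apply: ps; rewrite inE qs orbT.
  have p0 : (0 < p)%N by apply: prime_gt0; apply: ps; rewrite inE eqxx.
  rewrite !big_cons lnnM ?expn_gt0 ?p0 ?IH //.
    congr (_ + _); elim: (logn p n) => [|m IHm]; first by rewrite expn0 lnn1 mul0r.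
    by rewrite expnS lnnM ?expn_gt0 ?p0 // IHm -natr1 mulrDl mul1r addrC.
  by rewrite big_seq; apply: prodn_cond_gt0 => q qs; rewrite expn_gt0 prime_gt0 //; apply: sub.
rewrite natr_sum mulr_suml big_seq [leRHS]big_seq; apply: ler_sum => p.
rewrite mem_primes => /and3P[pp _ pn]; apply: ler_wpM2l => //; exact: hx.
Qed.

Lemma infinite_pigeonhole (T : finType) (P : T -> nat -> Prop) :
  (forall M, exists t p, (M <= p)%N /\ P t p) ->
  exists t, forall M, exists p, (M <= p)%N /\ P t p.
Proof.
move=> inf; apply: Classical_Prop.NNPP => no.
have : forall t, exists M, forall p, (M <= p)%N -> ~ P t p.
  move=> t; apply: Classical_Prop.NNPP => not_t; apply: no; exists t => M.
  apply: Classical_Prop.NNPP => not_M; apply: not_t; exists M => p Mp Pp.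
  by apply: not_M; exists p.
move=> /fin_all_exists[f hf].
have [t [p [Mp Pp]]] := inf (\max_t f t)%N.
by apply: (hf t p) => //; apply: leq_trans Mp; apply: leq_bigmax.
Qed.

Definition odd_almost_prime_shift (D : nat) : Prop :=
  exists (C c : R), (0 < c)%R /\
  exists (b : nat) (d : int),
    odd b /\ (INR b <= C)%R /\
    ~~ odd (absz d) /\ (0 < absz d)%N /\ (absz d <= D)%N /\
    forall M : nat, exists p : nat,
      (M <= p)%N /\ prime p /\
      (INR (least_prime_factor (absz (Posz p + d)%R)) > Rpower (INR p) c)%R /\
      bigOmega (absz (Posz p + d)%R) = b.

Lemma bounded_gap_conclusion (hs : seq nat) D (c : R) : 0 < c ->
  {in hs, forall h, odd h} -> {in hs &, forall h h', (h <= h' + D)%N} ->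
  (exists N0 : nat, forall N, (N0 <= N)%N -> exists m h h' : nat,
    [/\ (N < m <= N + N)%N, [/\ h \in hs, h' \in hs & h != h'], prime (m + h),
     liouville (m + h') = -1 & forall q, prime q -> (q %| m + h')%N -> c * lnn N < lnn q]) ->
  odd_almost_prime_shift D.
Proof.
move=> c0 hs_odd hs_diam [N0 hN0].
pose H := (\max_(h <- hs) h)%N.
have hH h : h \in hs -> (h <= H)%N by move=> hh; rewrite /H (big_rem h hh) /= leq_maxl.
pose B := (Num.truncn (2 / c))%N.
pose P (t : 'I_B.+1 * seq_sub hs * seq_sub hs) p :=
  let: (b, h, h') := t in let n := (p + ssval h' - ssval h)%N in
  [/\ (ssval h <= p)%N /\ ssval h != ssval h', odd b, prime p, bigOmega n = b &
      exp (c / 2 * lnn p) < (pdiv n)%:R].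
have [[[b h] h'] hP] : exists t, forall M, exists p, (M <= p)%N /\ P t p.
  apply: infinite_pigeonhole => M.
  pose N := (N0 + M + H + 2)%N.
  have [m [h [h' [/andP[Nm mN] [hh hh' ne] pp lio hq]]]] := hN0 N ltac:(rewrite /N; lia).
  have hH1 := hH h hh; have hH2 := hH h' hh'.
  have N1 : (1 < N)%N by rewrite /N; lia.
  have lN0 : 0 < lnn N by apply: lnn_gt0.
  have big_le : (m + h' <= N ^ 2)%N /\ (m + h <= N ^ 2)%N.
    have : (N * (H + 2) <= N * N)%N by rewrite leq_mul2l /N; lia.
    by clear -N1 mN hH1 hH2; nia.
  have ln_sq x : (0 < x)%N -> (x <= N ^ 2)%N -> lnn x <= 2 * lnn N.
    move=> x0 xN; apply: (le_trans (ler_lnn x0 xN)).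
    by rewrite -mulnn lnnM ?(ltnW N1) // -mulr2n mulr_natl.
  have m1 : (1 < m + h')%N by clear -N1 Nm; lia.
  have bB : (bigOmega (m + h') < B.+1)%N.
    have := bigOmega_lnn_le (ltnW m1) (fun q pq qm => ltW (hq q pq qm)).
    move=> /le_trans /(_ (ln_sq _ (ltnW m1) big_le.1)); rewrite mulrA ler_pM2r // -ler_pdivlMr //.
    by rewrite ltnS -truncn_ge_nat // divr_ge0 // ltW.
  exists (Ordinal bB, SeqSub hh, SeqSub hh'), (m + h)%N; split; first by rewrite /N in Nm; clear -Nm; lia.
  rewrite /P /=; have -> : (m + h + h' - h = m + h')%N by rewrite addnAC addnK.
  split=> //=; first by rewrite leq_addl.
    move: lio; rewrite liouvilleE -signr_odd; case: (odd _) => //=.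
    by rewrite expr0 => e; exfalso; clear -e; lra.
  have -> : (pdiv (m + h'))%:R = exp (lnn (pdiv (m + h'))) :> R by rewrite exp_lnn // pdiv_gt0.
  apply: ltr_expR; apply: le_lt_trans (hq _ (pdiv_prime m1) (pdiv_dvd _)).
  rewrite mulrAC ler_pdivrMr // -mulrA ler_pM2l // mulrC.
  by apply: ln_sq big_le.2; apply: prime_gt0.
exists b%:R, (c / 2); split; first by rewrite divr_gt0.
exists b, (Posz (ssval h') - Posz (ssval h)).
have [p0 [_ [[_ ne] b_odd _ _ _]]] := hP 0%N.
have [o1 o2] := (hs_odd _ (ssvalP h), hs_odd _ (ssvalP h')).
have [d1 d2] := (hs_diam _ _ (ssvalP h) (ssvalP h'), hs_diam _ _ (ssvalP h') (ssvalP h)).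
split=> //; split; first by rewrite INRE.
have hx M : exists p, [/\ (M <= p)%N, (ssval h <= p)%N, prime p,
    bigOmega (p + ssval h' - ssval h) = b & exp (c / 2 * lnn p) < (pdiv (p + ssval h' - ssval h))%:R].
  by have [p [Mp [[hp _] _ pp Om lt]]] := hP M; exists p; split.
move: (ssval h) (ssval h') ne o1 o2 d1 d2 hx => x y ne o1 o2 d1 d2 hx.
split; first by clear -o1 o2; lia.
split; first by clear -ne; lia.
split; first by clear -d1 d2; lia.
move=> M; have [p [Mp xp pp Om lt]] := hx M.
exists p; have -> : absz (Posz p + (Posz y - Posz x)) = (p + y - x)%N by clear -xp; lia.
by do 3?split=> //; rewrite /least_prime_factor /Rpower !INRE.
Qed.

Lemma admissible_of_small (hs : seq nat) : {in hs, forall h q, prime q -> (q <= size hs)%N -> ~~ (q %| h)%N} ->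
  forall p, prime p -> exists v, {in hs, forall h, ~~ (p %| v + h)%N}.
Proof.
move=> small p pp; have [le_p|lt_p] := leqP p (size hs).
  by exists 0%N => h hh; apply: small.
have p0 := prime_gt0 pp.
pose f (h : nat) : 'I_p := Ordinal (ltn_pmod (p - h %% p) p0).
have : ~~ ([set: 'I_p] \subset [set x in map f hs]).
  apply/negP => /subset_leq_card; rewrite cardsT card_ord leqNgt => /negP; apply.
  apply: leq_ltn_trans lt_p; rewrite cardsE -(size_map f); exact: card_size.
case/subsetPn => v _; rewrite inE => hv; exists v => h hh; apply: contra hv => /dvdnP[j e].
apply/mapP; exists h => //; apply: val_inj => /=.
apply/eqP; rewrite -(modn_small (ltn_ord v)) -(eqn_modDr h) e modnMl -modnDmr subnK ?modnn //.
by rewrite ltnW // ltn_pmod.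
Qed.

Definition shift_check (hs : seq nat) D : bool :=
  [&& (1 < size hs)%N, uniq hs, all odd hs, all (fun h => all (fun h' => h <= h' + D)%N hs) hs &
    all (fun h => all (fun q => prime q ==> ~~ (q %| h)%N) (iota 0 (size hs).+1)) hs].

Lemma prime_shift_of_weight (hs : seq nat) D n t a b c (theta : R) :
  shift_check hs D -> (0 < n)%N -> (0 < t < 1000)%N ->
  weight_check (Z.of_nat n) (Z.of_nat (size hs)) (Z.of_nat t) (Z.of_nat a) (Z.of_nat b) (Z.of_nat c) ->
  t%:R / 1000 < theta -> condA theta -> condB theta ->
  odd_almost_prime_shift D.
Proof.
case/and5P=> k1 uhs hs_odd hs_diam hs_small n0 /andP[t0 t1] chk t_lt hA hB.
have T0 : 0 < t%:R / 1000 :> R by rewrite divr_gt0 // ltr0n.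
have T1 : t%:R / 1000 < 1 :> R by rewrite ltr_pdivrMr // mul1r ltr_nat.
have wc rho := @weight_checkP n (size hs) _ _ _ _ rho n0 (ltnW k1) chk.
rewrite IZR_of_nat in wc; move: (t%:R / 1000) T0 T1 t_lt wc => T T0 T1 t_lt wc.
have [rho [Trho rho1 rho_th]] : exists rho : R, [/\ T < rho, rho < 1 & rho < theta].
  have [h|h] := leP theta 1.
    by exists ((T + theta) / 2); split; move: T0 T1 t_lt h; lra.
  by exists ((T + 1) / 2); split; move: T0 T1 t_lt h; lra.
have adm := @admissible_of_small hs.
have Fn : step_weight n (quad_weight (Z.of_nat n) (Z.of_nat a) (Z.of_nat b) (Z.of_nat c)) n = 0 by rewrite /step_weight ltnn.
have [|c1 [c1_gt0 hN]] := good_infinitely k1 n0 uhs (erefl _) (step_weight_dec n a b c) Fn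
  _ hA hB (lt_trans T0 Trho) rho1 rho_th (wc _ Trho).
  apply: adm => h hh q pq q_le; move/allP: hs_small => /(_ h hh)/allP/(_ q).
  by rewrite mem_iota add0n ltnS q_le pq => /(_ isT).
apply: (bounded_gap_conclusion c1_gt0 _ _ hN); first by move=> h hh; exact: (allP hs_odd).
by move=> h h' hh hh'; exact: (allP (allP hs_diam h hh)).
Qed.

Theorem theorem8 (theta0 : R) (D : nat) :
  ((theta0 = 924/1000 /\ D = 6%N) \/ (theta0 = 739/1000 /\ D = 8%N) \/
   (theta0 = 643/1000 /\ D = 12%N) \/ (theta0 = 584/1000 /\ D = 16%N) \/
   (theta0 = 544/1000 /\ D = 20%N) \/ (theta0 = 516/1000 /\ D = 26%N))%R ->
  (exists theta : R, (theta0 < theta)%R /\ condA theta /\ condB theta) ->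
  exists (C c : R), (0 < c)%R /\
  exists (b : nat) (d : int),
    odd b /\ (INR b <= C)%R /\
    ~~ odd (absz d) /\ (0 < absz d)%N /\ (absz d <= D)%N /\
    forall M : nat, exists p : nat,
      (M <= p)%N /\ prime p /\
      (INR (least_prime_factor (absz (Posz p + d)%R)) > Rpower (INR p) c)%R /\
      bigOmega (absz (Posz p + d)%R) = b.
Proof.
(* The shifts are primes exceeding their number [k], hence an admissible tuple.  The coefficients of
   the quadratic weight come from a numerical maximisation of [j_mean / i_mean]. *)
move=> cases [theta [th [hA hB]]].
case: cases => [[e ->]|[[e ->]|[[e ->]|[[e ->]|[[e ->]|[e ->]]]]]]; rewrite {}e in th.
- by apply: (@prime_shift_of_weight [:: 5; 7; 11]%N 6 500 924 100 186 158) th hA hB; vm_compute.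
- by apply: (@prime_shift_of_weight [:: 11; 13; 17; 19]%N 8 500 739 100 257 410) th hA hB; vm_compute.
- by apply: (@prime_shift_of_weight [:: 11; 13; 17; 19; 23]%N 12 500 643 100 308 813) th hA hB; vm_compute.
- by apply: (@prime_shift_of_weight [:: 7; 11; 13; 17; 19; 23]%N 16 500 584 100 339 1384) th hA hB; vm_compute.
- by apply: (@prime_shift_of_weight [:: 11; 13; 17; 19; 23; 29; 31]%N 20 500 544 100 351 2133) th hA hB; vm_compute.
by apply: (@prime_shift_of_weight [:: 11; 13; 17; 19; 23; 29; 31; 37]%N 26 500 516 100 347 3065) th hA hB; vm_compute.
Qed.
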